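(* Let $\mathcal M=\langle M,\in^{\mathcal M}\rangle$ be a countable recursively saturated model of $\mathrm{ZFC}$ and let $I\subseteq M$ be an $H$-cut of $\mathcal M$. There is an embedding (injective group homomorphism) $j\mapsto\check j$ of $\mathrm{Aut}(\mathbb Q)$ into $\mathrm{Aut}(\mathcal M)$ such that for every non-trivial $j\in\mathrm{Aut}(\mathbb Q)$, $\mathcal I_{\mathrm{fix}}(\check j)=\langle I,\in^{\mathcal M}\rangle$.
   Context: $\mathcal{L}$ is the language with one binary relation $\in$; for $a\in M$, $a^*=\{x\in M:\mathcal M\models x\in a\}$. $\mathbb Q$ is the ordered set of rationals and $\mathrm{Aut}(\mathbb Q)$ its group of order-automorphisms; $\mathrm{Aut}(\mathcal M)$ is the automorphism group of $\mathcal M$. $\mathrm{MOST}$ is the theory with extensionality, pairing, emptyset, union, infinity, powerset, transitive containment, $\Delta_0$-separation, set foundation, ''every set can be well-ordered'', $\Sigma_1$-separation and $\Delta_0$-collection. For $\mathcal{L}$-structures $\mathcal{A}\subseteq\mathcal{B}$: end-extension means members (in $\mathcal B$) of elements of $A$ lie in $A$; powerset-preserving means additionally every $x\in B$ with $\mathcal B\models x\subseteq y$ for some $y\in A$ lies in $A$; topless means end-extension, $A\ne B$, and every $C\in B$ with $C^*\subseteq\mathrm{Ord}^{\mathcal A}$ lies in $A$. $I\subseteq M$ is an $H$-cut of $\mathcal M$ if $\mathcal M$ is a topless powerset-preserving end-extension of the substructure $\langle I,\in^{\mathcal M}\rangle$ and $\langle I,\in^{\mathcal M}\rangle\models\mathrm{MOST}$.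 For an automorphism $k$ of $\mathcal M$, $\mathcal I_{\mathrm{fix}}(k)$ is the substructure with domain $\{x\in M: k(y)=y\text{ for all }y\text{ with }\mathcal M\models y\in\mathrm{TC}(\{x\})\}$, transitive closure computed in $\mathcal M$. Recursively saturated: every recursive finitely realised type with finitely many parameters is realised. *)

(* Defs.v *)
From mathcomp Require Import all_boot all_order all_algebra.
From Stdlib Require List FunctionalExtensionality ProofIrrelevance.

Set Implicit Arguments.
Unset Strict Implicit.
Unset Printing Implicit Defensive.

(* Sets with one binary relation: used both for the language of set theory
   and for the ordered set of rationals. *)
Record structure := Structure {
  carrier :> Type;
  srel : carrier -> carrier -> Prop
}.

Arguments srel {s} _ _.

Declare Scope struct_scope.
Delimit Scope struct_scope with struct.
Notation "x 'ε' y" := (srel x y) (at level 70, no associativity) : struct_scope.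
Open Scope struct_scope.

Definition substr (M : structure) (A : M -> Prop) : structure :=
  {| carrier := {x : M | A x}; srel := fun x y => proj1_sig x ε proj1_sig y |}.

Definition rat_order : structure :=
  {| carrier := rat; srel := fun x y => (x < y)%R |}.

Definition countable (T : Type) : Prop := exists f : T -> nat, injective f.

Section Automorphisms.

Variable M : structure.

Record Aut := MkAut {
  aut_fun :> M -> M;
  aut_bij : bijective aut_fun;
  aut_rel : forall x y : M, aut_fun x ε aut_fun y <-> x ε y
}.

Lemma aut_ext (f g : Aut) : f =1 g -> f = g.
Proof.
case: f g => [f fb fr] [g gb gr] /= efg.
have e : f = g by apply: FunctionalExtensionality.functional_extensionality.
by subst g; congr MkAut; apply: ProofIrrelevance.proof_irrelevance.
Qed.

Lemma aut_id_rel (x y : M) : id x ε id y <-> x ε y.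
Proof. by []. Qed.

Definition aut_id : Aut := MkAut (Bijective (frefl id) (frefl id)) aut_id_rel.

Lemma aut_comp_rel (f g : Aut) (x y : M) : (f \o g) x ε (f \o g) y <-> x ε y.
Proof. by split=> [/aut_rel/aut_rel|] // h; apply/aut_rel/aut_rel. Qed.

Definition aut_comp (f g : Aut) : Aut :=
  MkAut (bij_comp (aut_bij f) (aut_bij g)) (aut_comp_rel f g).

End Automorphisms.

Arguments aut_id {M}.

(* First-order formulas over one binary relation and equality, with de Bruijn
   indices: fEx binds index 0. *)
Inductive form : Type :=
| fMem of nat & nat
| fEq of nat & nat
| fNot of form
| fAnd of form & form
| fEx of form.

Definition scons (T : Type) (x : T) (e : nat -> T) (i : nat) : T :=
  if i is i'.+1 then e i' else x.

Fixpoint sat (M : structure) (e : nat -> M) (phi : form) : Prop :=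
  match phi with
  | fMem i j => e i ε e j
  | fEq i j => e i = e j
  | fNot p => ~ sat e p
  | fAnd p q => sat e p /\ sat e q
  | fEx p => exists x : M, sat (scons x e) p
  end.

Fixpoint fv_below (n : nat) (phi : form) : Prop :=
  match phi with
  | fMem i j | fEq i j => i < n /\ j < n
  | fNot p => fv_below n p
  | fAnd p q => fv_below n p /\ fv_below n q
  | fEx p => fv_below n.+1 p
  end.

(* In delta0_ex the bound is the variable j of the ambient context, hence it
   is distinct from the bound variable. *)
Inductive delta0 : form -> Prop :=
| delta0_mem i j : delta0 (fMem i j)
| delta0_eq i j : delta0 (fEq i j)
| delta0_not p : delta0 p -> delta0 (fNot p)
| delta0_and p q : delta0 p -> delta0 q -> delta0 (fAnd p q)
| delta0_ex j p : delta0 p -> delta0 (fEx (fAnd (fMem 0 j.+1) p)).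

Inductive sigma1 : form -> Prop :=
| sigma1_delta0 p : delta0 p -> sigma1 p
| sigma1_ex p : sigma1 p -> sigma1 (fEx p).

(* Each axiom is given as its Tarskian truth condition in M; schemes range over
   the object-level formulas in a class G, with arbitrary parameters e. *)
Section Theories.

Variable M : structure.
Implicit Types x y z a b c r s t u v : M.

Definition subset x y := forall z, z ε x -> z ε y.
Definition is_empty x := forall z, ~ z ε x.
Definition is_pair s a b := forall z, z ε s <-> z = a \/ z = b.
Definition is_succ s x := forall z, z ε s <-> z ε x \/ z = x.
Definition transitive_set x := forall y, y ε x -> subset y x.

(* Kuratowski pair {{a}, {a, b}} *)
Definition is_opair s a b :=
  exists u v, [/\ is_pair u a a, is_pair v a b & is_pair s u v].

Definition rel_of r a b := exists2 s, is_opair s a b & s ε r.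

(* R is a strict well-order of x in the sense of M: least elements are only
   required for the subsets of x that are elements of M. *)
Definition well_orders (R : M -> M -> Prop) x : Prop :=
  [/\ forall a, a ε x -> ~ R a a,
      forall a b c, a ε x -> b ε x -> c ε x -> R a b -> R b c -> R a c,
      forall a b, a ε x -> b ε x -> [\/ R a b, a = b | R b a]
    & forall s, subset s x -> (exists z, z ε s) ->
        exists2 m : M, m ε s & forall z, z ε s -> z = m \/ R m z].

Definition is_ordinal x := transitive_set x /\ well_orders srel x.

Definition extensionality :=
  forall x y, (forall z, z ε x <-> z ε y) -> x = y.
Definition pairing := forall a b, exists s, is_pair s a b.
Definition emptyset := exists x, is_empty x.
Definition union :=
  forall x, exists u, forall z, z ε u <-> exists2 y, y ε x & z ε y.
Definition infinity :=
  exists x, (exists2 y, is_empty y & y ε x) /\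
            (forall y, y ε x -> exists2 s, is_succ s y & s ε x).
Definition powerset := forall x, exists s, forall y, y ε s <-> subset y x.
Definition transitive_containment :=
  forall x, exists2 y, transitive_set y & subset x y.
Definition set_foundation :=
  forall x, (exists y, y ε x) ->
    exists2 y, y ε x & forall z, ~ (z ε y /\ z ε x).
Definition well_ordering := forall x, exists r, well_orders (rel_of r) x.

Definition separation (G : form -> Prop) :=
  forall phi, G phi -> forall (e : nat -> M) a,
    exists b, forall x, x ε b <-> x ε a /\ sat (scons x e) phi.

Definition collection (G : form -> Prop) :=
  forall phi, G phi -> forall (e : nat -> M) a,
    (forall x, x ε a -> exists y, sat (scons y (scons x e)) phi) ->
    exists c, forall x, x ε a ->
      exists2 y, y ε c & sat (scons y (scons x e)) phi.

Definition replacement (G : form -> Prop) :=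
  forall phi, G phi -> forall (e : nat -> M) a,
    (forall x, x ε a -> exists! y, sat (scons y (scons x e)) phi) ->
    exists b, forall y, y ε b <->
      exists2 x, x ε a & sat (scons y (scons x e)) phi.

Definition all_forms (_ : form) : Prop := True.

Record models_ZFC : Prop := {
  ZFC_extensionality : extensionality;
  ZFC_pairing : pairing;
  ZFC_emptyset : emptyset;
  ZFC_union : union;
  ZFC_infinity : infinity;
  ZFC_powerset : powerset;
  ZFC_foundation : set_foundation;
  ZFC_separation : separation all_forms;
  ZFC_replacement : replacement all_forms;
  ZFC_choice : well_ordering
}.

Record models_MOST : Prop := {
  MOST_extensionality : extensionality;
  MOST_pairing : pairing;
  MOST_emptyset : emptyset;
  MOST_union : union;
  MOST_infinity : infinity;
  MOST_powerset : powerset;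
  MOST_transitive_containment : transitive_containment;
  MOST_delta0_separation : separation delta0;
  MOST_foundation : set_foundation;
  MOST_choice : well_ordering;
  MOST_sigma1_separation : separation sigma1;
  MOST_delta0_collection : collection delta0
}.

End Theories.

(* A substructure of B is identified with its domain A. *)
Section Extensions.

Variables (B : structure) (A : B -> Prop).

Definition Ord_in (x : B) : Prop :=
  exists hx : A x, @is_ordinal (substr A) (exist A x hx).

Definition end_extension : Prop := forall x y : B, A y -> x ε y -> A x.

Definition powerset_preserving : Prop :=
  end_extension /\ (forall x y : B, A y -> subset x y -> A x).

Definition topless : Prop :=
  [/\ end_extension, (exists x : B, ~ A x)
    & forall C : B, (forall x, x ε C -> Ord_in x) -> A C].

Definition H_cut : Prop :=
  [/\ powerset_preserving, topless & models_MOST (substr A)].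

End Extensions.

Section FixedPart.

Variable M : structure.

Definition is_TC (t s : M) : Prop :=
  [/\ transitive_set t, subset s t
    & forall u : M, transitive_set u -> subset s u -> subset t u].

Definition in_TC_sing (y x : M) : Prop :=
  exists s t : M, [/\ is_pair s x x, is_TC t s & y ε t].

(* domain of the substructure I_fix(k) *)
Definition I_fix (k : Aut M) (x : M) : Prop :=
  forall y : M, in_TC_sing y x -> k y = y.

End FixedPart.

(* The total recursive functions, with minimisation restricted to regular
   functions. *)
Inductive recursive : forall n, (n.-tuple nat -> nat) -> Prop :=
| rec_zero n : recursive (fun _ : n.-tuple nat => 0)
| rec_succ : recursive (fun v : 1.-tuple nat => (thead v).+1)
| rec_proj n (i : 'I_n) : recursive (fun v : n.-tuple nat => tnth v i)
| rec_comp m n (g : m.-tuple nat -> nat) (h : 'I_m -> n.-tuple nat -> nat) :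
    recursive g -> (forall i, recursive (h i)) ->
    recursive (fun v : n.-tuple nat => g [tuple h i v | i < m])
| rec_prim n (g : n.-tuple nat -> nat) (h : n.+2.-tuple nat -> nat) :
    recursive g -> recursive h ->
    recursive (fun v : n.+1.-tuple nat =>
      nat_rect (fun=> nat) (g [tuple of behead v])
        (fun k r => h [tuple of k :: r :: behead v]) (thead v))
| rec_min n (g : n.+1.-tuple nat -> nat) (f : n.-tuple nat -> nat) :
    recursive g ->
    (forall v, g [tuple of f v :: v] = 0 /\
               forall k, k < f v -> g [tuple of k :: v] <> 0) ->
    recursive f.

Definition recursive_set (A : nat -> Prop) : Prop :=
  exists2 f : 1.-tuple nat -> nat, recursive f
    & forall k, (A k /\ f [tuple k] = 1) \/ (~ A k /\ f [tuple k] = 0).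

(* Cantor pairing *)
Definition cpair (x y : nat) : nat := ((x + y) * (x + y).+1)./2 + y.

Fixpoint godel (phi : form) : nat :=
  match phi with
  | fMem i j => 5 * cpair i j
  | fEq i j => 5 * cpair i j + 1
  | fNot p => 5 * godel p + 2
  | fAnd p q => 5 * cpair (godel p) (godel q) + 3
  | fEx p => 5 * godel p + 4
  end.

Definition recursive_type (p : form -> Prop) : Prop :=
  recursive_set (fun k => exists2 phi, p phi & godel phi = k).

(* Index 0 is the variable of the type, index i.+1 the i-th parameter. The
   default value of nth is irrelevant for formulas with indices below
   (size a).+1. *)
Definition realises (M : structure) (a : seq M) (x : M) (p : form -> Prop) :=
  forall phi, p phi -> sat (nth x (x :: a)) phi.

Definition recursively_saturated (M : structure) : Prop :=
  forall (a : seq M) (p : form -> Prop),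
    recursive_type p ->
    (forall phi, p phi -> fv_below (size a).+1 phi) ->
    (forall s : seq form, (forall phi, List.In phi s -> p phi) ->
       exists x : M, realises a x (fun phi => List.In phi s)) ->
    exists x : M, realises a x p.

(* Main.v *)
From mathcomp Require Import all_boot all_order all_algebra zify.
From Stdlib Require Import Classical ClassicalEpsilon.
From Stdlib Require Import FunctionalExtensionality ProofIrrelevance.
Require Import Defs.

(** Call a set of [M] wide if it contains every element of [I]. Toplessness
    turns facts about the ordinals of [I] into facts about some ordinal outside
    [I], so that below each wide [K] there is a wide [L] all of whose subsets
    belong to [K]. A finite configuration consists of an element [a] of [M] and
    an increasing tuple from a well-ordered set [X] that does not inject into a
    wide [K], where all tuples from [X] of the same length have the same type
    over [a] and [K]. Recursive saturation and the Erdos-Rado theorem inside [M]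
    allow one, after shrinking [K], to adjoin to [a] a function whose value at
    the tuple is a given element of [M], to insert a new element anywhere in the
    tuple, and to adjoin to [a] an injection of the tuple into a given wide set.
    After countably many steps this gives indiscernibles [c q] indexed by the
    rationals such that every element of [M] is [F (c q1, ..., c qn)] with [F]
    adjoined at some step, and an order automorphism [j] acts on [M] by
    [F (c q1, ..., c qn) |-> F (c (j q1), ..., c (j qn))]. This action is trivial
    on [I]. If it fixed the transitive closure of some [x] outside [I] pointwise,
    then it would fix pointwise a wide set that injects into this closure, but
    every wide set contains a copy of the [c q], which is moved when [j] is not
    the identity. *)

Set Implicit Arguments.
Unset Strict Implicit.
Unset Printing Implicit Defensive.

(** * Definability *)

(** The obstacle is that [I] is not definable in the model, so nothing can be coloured by, counted
    against or chosen from [I] internally. A wide [K] stands in for [I], and the absence of an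
    injection into [K] stands in for a cardinality bound, so cardinals and iterated power sets need
    not be developed. Each construction uses up a fixed finite number of power sets; they are paid
    for by moving down an endless descending sequence of wide sets, so a configuration can be
    refined again and again while staying large and homogeneous. A second obstacle is that the model
    has no truth predicate. Equality of types is not a property inside it: finitely many formulas
    are handled internally, and recursive saturation supplies one object that serves all formulas.
    The $\Sigma_1$-separation and $\Delta_0$-collection of [I] enter through a collapsing argument,
    which shows that [I] contains every transitive set that injects into one of its elements. *)

Fixpoint ren (r : nat -> nat) (phi : form) : form :=
  match phi with
  | fMem i j => fMem (r i) (r j)
  | fEq i j => fEq (r i) (r j)
  | fNot p => fNot (ren r p)
  | fAnd p q => fAnd (ren r p) (ren r q)
  | fEx p => fEx (ren (fun i => if i is i'.+1 then (r i').+1 else 0) p)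
  end.

Lemma sat_ext (M : structure) (phi : form) (e e' : nat -> M) :
  e =1 e' -> (sat e phi <-> sat e' phi).
Proof.
elim: phi e e' => [i j|i j|p IH|p IHp q IHq|p IH] e e' ee /=; rewrite ?ee //.
- by rewrite (IH _ _ ee).
- by rewrite (IHp _ _ ee) (IHq _ _ ee).
- have E x : scons x e =1 scons x e' by case=> //=.
  by split=> -[x h]; exists x; [rewrite -(IH _ _ (E x))|rewrite (IH _ _ (E x))].
Qed.

Lemma sat_eqfun (M : structure) (phi : form) (e e' : nat -> M) :
  sat e phi -> e =1 e' -> sat e' phi.
Proof. by move=> h /sat_ext <-. Qed.

Lemma sat_ren (M : structure) (phi : form) (r : nat -> nat) (e : nat -> M) :
  sat e (ren r phi) <-> sat (fun i => e (r i)) phi.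
Proof.
elim: phi r e => [i j|i j|p IH|p IHp q IHq|p IH] r e //=.
- by rewrite IH.
- by rewrite IHp IHq.
- by split=> -[x h]; exists x; move: h; rewrite IH; apply sat_ext => -[|i].
Qed.

Lemma delta0_ren (phi : form) : delta0 phi -> forall r, delta0 (ren r phi).
Proof.
by elim=> *; rewrite /=; constructor; auto.
Qed.

Record fclass (G : form -> Prop) : Prop := FClass {
  fclass_mem : forall i j, G (fMem i j);
  fclass_eq : forall i j, G (fEq i j);
  fclass_not : forall p, G p -> G (fNot p);
  fclass_and : forall p q, G p -> G q -> G (fAnd p q);
  fclass_ex : forall j p, G p -> G (fEx (fAnd (fMem 0 j.+1) p));
  fclass_ren : forall p r, G p -> G (ren r p)
}.

Lemma fclass_all : fclass all_forms. Proof. by split. Qed.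

Lemma fclass_delta0 : fclass delta0.
Proof. by split=> *; try constructor=> //; apply: delta0_ren. Qed.

Section Definability.

Variable M : structure.
Implicit Types (G : form -> Prop) (C : M -> Prop) (P Q : (nat -> M) -> Prop).
Implicit Types (t : (nat -> M) -> M) (e : nat -> M).

(** Every variable of a formula is read either as an entry of the environment or as a constant, so
    renaming variables and adding parameters only change [f]. *)
Definition asg (f : nat -> nat + M) e (i : nat) : M :=
  match f i with inl j => e j | inr m => m end.

Definition Dfn G C P : Prop :=
  exists phi f, [/\ G phi, forall i m, f i = inr m -> C m
    & forall e, P e <-> sat (asg f e) phi].

Definition Df := Dfn all_forms.

(** These are the terms allowed in bounded formulas. Substituting a definable function as in [Tm]
    costs an unbounded quantifier, so that is done for the class of all formulas only. *)
Definition btm C t : Prop :=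
  (exists i, forall e, t e = e i) \/ (exists2 m, C m & forall e, t e = m).

Definition Tm C t : Prop := Df C (fun e => e 0 = t (fun i => e i.+1)).

Definition anyc (_ : M) : Prop := True.
Definition noc (_ : M) : Prop := False.

Lemma btm_var C i : btm C (fun e => e i). Proof. by left; exists i. Qed.
Lemma btm_cst (C : M -> Prop) m : C m -> btm C (fun=> m).
Proof. by right; exists m. Qed.

Lemma Dfn_ext G C P Q : (forall e, P e <-> Q e) -> Dfn G C P -> Dfn G C Q.
Proof. by move=> pq [phi [f [h1 h2 h3]]]; exists phi, f; split=> // e; rewrite -pq. Qed.

Lemma Dfn_mono G C C' P : (forall m, C m -> C' m) -> Dfn G C P -> Dfn G C' P.
Proof. by move=> cc [phi [f [h1 h2 h3]]]; exists phi, f; split=> // i m /h2 /cc. Qed.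

Lemma Dfn_ren G C P (r : nat -> nat) :
  Dfn G C P -> Dfn G C (fun e => P (fun i => e (r i))).
Proof.
move=> [phi [f [h1 h2 h3]]].
exists phi, (fun i => match f i with inl j => inl (r j) | inr m => inr m end).
split=> // [i m|e].
  by case E: (f i) => [j|m'] //= [<-]; apply: h2 E.
by rewrite h3; apply: sat_ext => i; rewrite /asg; case: (f i).
Qed.

Section Closure.

Variables (G : form -> Prop) (C : M -> Prop).
Hypothesis clG : fclass G.

Lemma btm_code t : btm C t -> exists2 s : nat + M,
  forall m, s = inr m -> C m & forall e, t e = match s with inl j => e j | inr m => m end.
Proof.
by move=> [[i h]|[m cm h]]; [exists (inl i)|exists (inr m)] => // m' [<-].
Qed.

Lemma Dfn_bmem t1 t2 : btm C t1 -> btm C t2 -> Dfn G C (fun e => t1 e ε t2 e).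
Proof.
move=> /btm_code [s1 c1 h1] /btm_code [s2 c2 h2].
exists (fMem 0 1), (fun i => if i is 0 then s1 else s2); split.
- exact: fclass_mem.
- by case.
- by move=> e /=; rewrite h1 h2 /asg.
Qed.

Lemma Dfn_beq t1 t2 : btm C t1 -> btm C t2 -> Dfn G C (fun e => t1 e = t2 e).
Proof.
move=> /btm_code [s1 c1 h1] /btm_code [s2 c2 h2].
exists (fEq 0 1), (fun i => if i is 0 then s1 else s2); split.
- exact: fclass_eq.
- by case.
- by move=> e /=; rewrite h1 h2 /asg.
Qed.

Lemma Dfn_not P : Dfn G C P -> Dfn G C (fun e => ~ P e).
Proof.
move=> [phi [f [h1 h2 h3]]]; exists (fNot phi), f; split=> //.
  exact: fclass_not.
by move=> e; rewrite /= h3.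
Qed.

Lemma Dfn_and P Q : Dfn G C P -> Dfn G C Q -> Dfn G C (fun e => P e /\ Q e).
Proof.
move=> [p [f [h1 h2 h3]]] [q [g [k1 k2 k3]]].
(* Even variables serve the first formula and odd ones the second, so their readings cannot
   clash. *)
exists (fAnd (ren double p) (ren (fun i => i.*2.+1) q)).
exists (fun i => if odd i then g i./2 else f i./2); split.
- by apply: fclass_and => //; apply: fclass_ren.
- by move=> i m; case: ifP => _; [apply: k2|apply: h2].
- move=> e; rewrite h3 k3 /= !sat_ren; split=> -[a b]; split;
  [apply: (sat_eqfun a)|apply: (sat_eqfun b)|apply: (sat_eqfun a)|apply: (sat_eqfun b)] => i;
  by rewrite /asg /= ?odd_double //= ?doubleK ?uphalf_double.
Qed.

Lemma Dfn_or P Q : Dfn G C P -> Dfn G C Q -> Dfn G C (fun e => P e \/ Q e).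
Proof.
move=> dp dq; apply: (@Dfn_ext _ _ (fun e => ~ (~ P e /\ ~ Q e))).
  move=> e; split=> [h|]; last by tauto.
  by case: (classic (P e)) => hp; [left|right; apply: NNPP => hq; apply: h].
by apply: Dfn_not; apply: Dfn_and; apply: Dfn_not.
Qed.

Lemma Dfn_imp P Q : Dfn G C P -> Dfn G C Q -> Dfn G C (fun e => P e -> Q e).
Proof.
move=> dp dq; apply: (@Dfn_ext _ _ (fun e => ~ P e \/ Q e)).
  by move=> e; split=> [[]//|h]; case: (classic (P e)) => hp; [right; apply: h|left].
by apply: Dfn_or => //; apply: Dfn_not.
Qed.

Lemma Dfn_iff P Q : Dfn G C P -> Dfn G C Q -> Dfn G C (fun e => P e <-> Q e).
Proof. by move=> dp dq; apply: Dfn_and; apply: Dfn_imp. Qed.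

Lemma Dfn_bex t (P : M -> (nat -> M) -> Prop) :
  btm C t -> Dfn G C (fun e => P (e 0) (fun i => e i.+1)) ->
  Dfn G C (fun e => exists x, x ε t e /\ P x e).
Proof.
move=> /btm_code [s cs hs] [phi [f [h1 h2 h3]]].
pose r i := if f i is inl 0 then 0 else i.+2.
pose g i := if i is i'.+1 then
  match f i' with inl 0 => inl 0 | inl j.+1 => inl j | inr m => inr m end else s.
exists (fEx (fAnd (fMem 0 1) (ren r phi))), g; split.
- by apply: (fclass_ex clG); apply: fclass_ren.
- by case=> [|i] m /=; [apply: cs|case E: (f i) => [[|j]|m'] //= [<-]; apply: h2 E].
- move=> e /=; split=> -[x [a b]]; exists x; split; move: a b; rewrite /asg /= -?hs //.
    move=> _ /(h3 (scons x e)) b; apply/sat_ren; apply: (sat_eqfun b) => i.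
    by rewrite /r /asg /=; case E: (f i) => [[|j]|m] //=; rewrite /g /= E.
  move=> _ /sat_ren b; apply/(h3 (scons x e)); apply: (sat_eqfun b) => i.
  by rewrite /r /asg /=; case E: (f i) => [[|j]|m] //=; rewrite /g /= E.
Qed.

Lemma Dfn_ball t (P : M -> (nat -> M) -> Prop) :
  btm C t -> Dfn G C (fun e => P (e 0) (fun i => e i.+1)) ->
  Dfn G C (fun e => forall x, x ε t e -> P x e).
Proof.
move=> bt dp; apply: (@Dfn_ext _ _ (fun e => ~ exists x, x ε t e /\ ~ P x e)).
  move=> e; split=> [h x hx|h [x [hx]]]; last by apply; apply: h.
  by apply: NNPP => hp; apply: h; exists x.
by apply: Dfn_not; apply: (@Dfn_bex t (fun x e => ~ P x e)) => //; apply: Dfn_not.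
Qed.

End Closure.

Section General.

Variable C : M -> Prop.

Lemma Df_ext P Q : (forall e, P e <-> Q e) -> Df C P -> Df C Q.
Proof. exact: Dfn_ext. Qed.
Lemma Df_not P : Df C P -> Df C (fun e => ~ P e).
Proof. exact: (Dfn_not fclass_all). Qed.
Lemma Df_and P Q : Df C P -> Df C Q -> Df C (fun e => P e /\ Q e).
Proof. exact: (Dfn_and fclass_all). Qed.
Lemma Df_or P Q : Df C P -> Df C Q -> Df C (fun e => P e \/ Q e).
Proof. exact: (Dfn_or fclass_all). Qed.
Lemma Df_imp P Q : Df C P -> Df C Q -> Df C (fun e => P e -> Q e).
Proof. exact: (Dfn_imp fclass_all). Qed.
Lemma Df_iff P Q : Df C P -> Df C Q -> Df C (fun e => P e <-> Q e).
Proof. exact: (Dfn_iff fclass_all). Qed.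

Lemma Df_ex (P : M -> (nat -> M) -> Prop) :
  Df C (fun e => P (e 0) (fun i => e i.+1)) -> Df C (fun e => exists x, P x e).
Proof.
move=> [phi [f [h1 h2 h3]]].
pose r i := if f i is inl 0 then 0 else i.+1.
pose g i := match f i with inl 0 => inl 0 | inl j.+1 => inl j | inr m => inr m end.
exists (fEx (ren r phi)), g; split=> //.
- by move=> i m; rewrite /g; case E: (f i) => [[|j]|m'] //= [<-]; apply: h2 E.
- move=> e /=; split=> -[x a]; exists x.
    move: a => /(h3 (scons x e)) b; apply/sat_ren; apply: (sat_eqfun b) => i.
    by rewrite /r /asg /=; case E: (f i) => [[|j]|m] //=; rewrite /g /= E.
  move: a => /sat_ren b; apply/(h3 (scons x e)); apply: (sat_eqfun b) => i.
  by rewrite /r /asg /=; case E: (f i) => [[|j]|m] //=; rewrite /g /= E.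
Qed.

Lemma Df_all (P : M -> (nat -> M) -> Prop) :
  Df C (fun e => P (e 0) (fun i => e i.+1)) -> Df C (fun e => forall x, P x e).
Proof.
move=> dp; apply: (@Dfn_ext _ _ (fun e => ~ exists x, ~ P x e)).
  move=> e; split=> [h x|h [x]]; last by apply.
  by apply: NNPP => hp; apply: h; exists x.
by apply: Df_not; apply: (@Df_ex (fun x e => ~ P x e)); apply: Df_not.
Qed.

Lemma Df_ex2 (P Q : M -> (nat -> M) -> Prop) :
  Df C (fun e => P (e 0) (fun i => e i.+1)) ->
  Df C (fun e => Q (e 0) (fun i => e i.+1)) ->
  Df C (fun e => exists2 x, P x e & Q x e).
Proof.
move=> dp dq; apply: (@Dfn_ext _ _ (fun e => exists x, P x e /\ Q x e)).
  by move=> e; split=> [[x [a b]]|[x a b]]; exists x.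
by apply: (@Df_ex (fun x e => P x e /\ Q x e)); apply: Df_and.
Qed.

Lemma Df_and3 P Q R : Df C P -> Df C Q -> Df C R ->
  Df C (fun e => [/\ P e, Q e & R e]).
Proof.
move=> dp dq dr; apply: (@Dfn_ext _ _ (fun e => P e /\ (Q e /\ R e))).
  by move=> e; split=> [[a [b c]]|[a b c]].
by do 2 apply: Df_and => //.
Qed.

Lemma Df_and4 P Q R S : Df C P -> Df C Q -> Df C R -> Df C S ->
  Df C (fun e => [/\ P e, Q e, R e & S e]).
Proof.
move=> dp dq dr ds; apply: (@Dfn_ext _ _ (fun e => P e /\ [/\ Q e, R e & S e])).
  by move=> e; split=> [[a [b c d]]|[a b c d]].
by apply: Df_and => //; apply: Df_and3.
Qed.

Lemma Df_or3 P Q R : Df C P -> Df C Q -> Df C R ->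
  Df C (fun e => [\/ P e, Q e | R e]).
Proof.
move=> dp dq dr; apply: (@Dfn_ext _ _ (fun e => P e \/ (Q e \/ R e))).
  by move=> e; split=> [[a|[a|a]]|[]]; (try by constructor 1); (try by constructor 2);
     (try by constructor 3); auto.
by do 2 apply: Df_or => //.
Qed.

(** Classically, a proposition independent of the environment is one of two truth values, so
    external facts may occur inside definable predicates. *)
Lemma Df_true (T : Prop) : Df C (fun=> T).
Proof.
case: (classic T) => h.
  apply: (@Dfn_ext _ _ (fun e => e 0 = e 0)); first by move=> e; split.
  by apply: (Dfn_beq fclass_all); apply: btm_var.
apply: (@Dfn_ext _ _ (fun e => ~ e 0 = e 0)); first by move=> e; split.
by apply: Df_not; apply: (Dfn_beq fclass_all); apply: btm_var.
Qed.

Lemma Tm_var i : Tm C (fun e => e i).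
Proof. by apply: (Dfn_beq fclass_all); [apply: btm_var|apply: (btm_var _ i.+1)]. Qed.

Lemma Tm_cst (m : M) : C m -> Tm C (fun=> m).
Proof. by move=> cm; apply: (Dfn_beq fclass_all); [apply: btm_var|apply: btm_cst]. Qed.

Lemma Tm_shift t : Tm C t -> Tm C (fun e => t (fun i => e i.+1)).
Proof. by apply: (Dfn_ren (fun i => if i is i'.+1 then i'.+2 else 0)). Qed.

Lemma Df_sub t (P : M -> (nat -> M) -> Prop) :
  Tm C t -> Df C (fun e => P (e 0) (fun i => e i.+1)) -> Df C (fun e => P (t e) e).
Proof.
move=> dt dp; apply: (@Dfn_ext _ _ (fun e => exists x, x = t e /\ P x e)).
  by move=> e; split=> [[x [-> //]]|h]; exists (t e).
by apply: (@Df_ex (fun x e => x = t e /\ P x e)); apply: Df_and.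
Qed.

Lemma Df_mem t1 t2 : Tm C t1 -> Tm C t2 -> Df C (fun e => t1 e ε t2 e).
Proof.
move=> h1 h2; apply: (@Df_sub t1 (fun x e => x ε t2 e)) => //.
apply: (@Df_sub _ (fun x e => e 0 ε x)); first exact: Tm_shift.
by apply: (Dfn_bmem fclass_all); apply: btm_var.
Qed.

Lemma Df_eq t1 t2 : Tm C t1 -> Tm C t2 -> Df C (fun e => t1 e = t2 e).
Proof. by move=> h1 h2; apply: (@Df_sub t1 (fun x e => x = t2 e)). Qed.

Lemma Df_sat (phi : form) (s : nat -> (nat -> M) -> M) :
  (forall i, Tm C (s i)) -> Df C (fun e => sat (fun i => s i e) phi).
Proof.
elim: phi s => [i j|i j|p IH|p IHp q IHq|p IH] s ds /=.
- exact: Df_mem.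
- exact: Df_eq.
- by apply: Df_not; apply: IH.
- by apply: Df_and; [apply: IHp|apply: IHq].
- apply: (@Df_ex (fun x e => sat (scons x (fun i => s i e)) p)).
  apply: (@Dfn_ext _ _ (fun e => sat (fun i => (if i is i'.+1 then fun e => s i' (fun k => e k.+1) else fun e => e 0) e) p)).
    by move=> e; apply: sat_ext => -[|i].
  by apply: IH => -[|i]; [apply: Tm_var|apply: Tm_shift].
Qed.

Lemma Df_subst P (s : nat -> (nat -> M) -> M) :
  Df C P -> (forall i, Tm C (s i)) -> Df C (fun e => P (fun i => s i e)).
Proof.
move=> [phi [f [h1 h2 h3]]] ds.
apply: (@Dfn_ext _ _ (fun e => sat (fun i => (match f i with inl j => s j | inr m => fun=> m end) e) phi)).
  by move=> e; rewrite h3; apply: sat_ext => i; rewrite /asg; case: (f i).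
by apply: Df_sat => i; case E: (f i) => [j|m] //; apply: Tm_cst; apply: h2 E.
Qed.

(** A quantifier over an external finite list is a finite conjunction; this is how finitely many
    formulas of a type enter a single formula. *)
Lemma Df_seq_all (T : Type) (s : seq T) (P : T -> (nat -> M) -> Prop) :
  (forall x, Df C (P x)) -> Df C (fun e => forall x, List.In x s -> P x e).
Proof.
move=> dp; elim: s => [|x s IH].
  by apply: (@Dfn_ext _ _ (fun=> True)); [move=> e; split|apply: Df_true].
apply: (@Dfn_ext _ _ (fun e => P x e /\ forall y, List.In y s -> P y e)); last exact: Df_and.
by move=> e; split=> [[a b] y [<-//|]|h]; [apply: b|split=> [|y hy]; apply: h; [left|right]].
Qed.

End General.

(** Reading every variable as the same element compares types in one variable without asking which
    variables are free. *)
Definition eqt (x y : M) : Prop :=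
  forall phi, sat (fun=> x) phi <-> sat (fun=> y) phi.

Definition teq C (x y : M) : Prop :=
  forall phi e, (forall i, C (e i)) -> (sat (scons x e) phi <-> sat (scons y e) phi).

Lemma eqt_Df (P : M -> Prop) x y : Df noc (fun e => P (e 0)) -> eqt x y -> (P x <-> P y).
Proof.
move=> [phi [f [_ h2 h3]]] xy.
have h z : P z <-> sat (fun=> z) phi.
  rewrite (h3 (fun=> z)); apply: sat_ext => i; rewrite /asg.
  by case E: (f i) => [j|m] //; case: (h2 _ _ E).
by rewrite !h.
Qed.

Lemma teq_Df C (P : M -> Prop) x y :
  (exists m, C m) -> Df C (fun e => P (e 0)) -> teq C x y -> (P x <-> P y).
Proof.
move=> [c cc] [phi [f [_ h2 h3]]] xy.
pose r i := if f i is inl _ then 0 else i.+1.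
pose e i := if f i is inr m then m else c.
have h z : P z <-> sat (scons z e) (ren r phi).
  rewrite (h3 (fun=> z)) sat_ren; apply: sat_ext => i; rewrite /asg /r.
  by case E: (f i) => [j|m] //=; rewrite /e E.
by rewrite !h; apply: xy => i; rewrite /e; case E: (f i) => [j|m] //; apply: h2 E.
Qed.

Lemma teq_mono C C' x y : (forall m, C m -> C' m) -> teq C' x y -> teq C x y.
Proof. by move=> cc xy phi e he; apply: xy => i; apply: cc. Qed.

Lemma teq_sym C x y : teq C x y -> teq C y x.
Proof. by move=> xy phi e he; rewrite xy. Qed.

End Definability.

(** * Set theory inside the model *)

Definition Df1 (M : structure) (C : M -> Prop) (P : M -> Prop) : Prop :=
  Df C (fun e => P (e 0)).
Definition Df2 (M : structure) (C : M -> Prop) (R : M -> M -> Prop) : Prop :=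
  Df C (fun e => R (e 0) (e 1)).
Definition Df3 (M : structure) (C : M -> Prop) (R : M -> M -> M -> Prop) : Prop :=
  Df C (fun e => R (e 0) (e 1) (e 2)).
Definition Tm1 (M : structure) (C : M -> Prop) (g : M -> M) : Prop :=
  Tm C (fun e => g (e 0)).
Definition Tm2 (M : structure) (C : M -> Prop) (g : M -> M -> M) : Prop :=
  Tm C (fun e => g (e 0) (e 1)).

Section Composition.

Variables (M : structure) (C : M -> Prop).
Implicit Types (t : (nat -> M) -> M).

Lemma Df_rel1 (R : M -> Prop) t1 :
  Df1 C R -> Tm C t1 -> Df C (fun e => R (t1 e)).
Proof. by move=> dR d1; apply: (Df_subst (s := fun=> t1) dR). Qed.

Lemma Df_rel2 (R : M -> M -> Prop) t1 t2 :
  Df2 C R -> Tm C t1 -> Tm C t2 ->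
  Df C (fun e => R (t1 e) (t2 e)).
Proof.
move=> dR d1 d2.
by apply: (Df_subst (s := fun i => if i is 0 then t1 else t2) dR) => -[].
Qed.

Lemma Df_rel3 (R : M -> M -> M -> Prop) t1 t2 t3 :
  Df3 C R -> Tm C t1 -> Tm C t2 -> Tm C t3 ->
  Df C (fun e => R (t1 e) (t2 e) (t3 e)).
Proof.
move=> dR d1 d2 d3; pose s i := match i with 0 => t1 | 1 => t2 | _ => t3 end.
by apply: (Df_subst (s := s) dR) => -[|[|i]].
Qed.

Lemma Tm_fun1 (g : M -> M) t1 :
  Tm1 C g -> Tm C t1 -> Tm C (fun e => g (t1 e)).
Proof.
move=> dg d1.
by apply: (Df_rel2 (R := fun x y => x = g y)); [|apply: Tm_var|apply: Tm_shift].
Qed.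

Lemma Tm_fun2 (g : M -> M -> M) t1 t2 :
  Tm2 C g -> Tm C t1 -> Tm C t2 ->
  Tm C (fun e => g (t1 e) (t2 e)).
Proof.
move=> dg d1 d2; apply: (Df_rel3 (R := fun x y z => x = g y z)) => //.
- exact: Tm_var.
- exact: Tm_shift.
- exact: Tm_shift.
Qed.

End Composition.

Ltac dfn_user := fail.

Ltac dfn_unfold := cbv beta delta [subset transitive_set is_empty].

Ltac dfn_term :=
  lazymatch goal with
  | |- Tm _ (fun _ => ?t) => first [by apply: Tm_cst | by []]
  | |- Tm _ (fun e => e _) => apply: Tm_var
  end.

Ltac dfn_hyp :=
  match goal with
  | H : Df1 _ ?P |- Df _ (fun e => ?P _) => apply: (Df_rel1 H)
  | H : Df2 _ ?R |- Df _ (fun e => ?R _ _) => apply: (Df_rel2 H)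
  | H : Df3 _ ?R |- Df _ (fun e => ?R _ _ _) => apply: (Df_rel3 H)
  | H : Tm1 _ ?g |- Tm _ (fun e => ?g _) => apply: (Tm_fun1 H)
  | H : Tm2 _ ?g |- Tm _ (fun e => ?g _ _) => apply: (Tm_fun2 H)
  end.

(** Definability goals are solved by recursion on the syntax of the predicate. Constant predicates
    are tried before the connectives, so that [Df_true] absorbs whatever does not mention the
    environment. [dfn_user] and [dfn_unfold] are extended as new operations appear. *)
Ltac dfn_step :=
  cbv beta;
  lazymatch goal with
  | |- Df1 _ _ => unfold Df1
  | |- Df2 _ _ => unfold Df2
  | |- Df3 _ _ => unfold Df3
  | |- Tm1 _ _ => unfold Tm1
  | |- Tm2 _ _ => unfold Tm2
  | |- Df _ (fun _ => ?T) => apply: Df_true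
  | |- Df _ (fun e => _ <-> _) => apply Df_iff
  | |- Df _ (fun e => ~ _) => apply Df_not
  | |- Df _ (fun e => _ /\ _) => apply Df_and
  | |- Df _ (fun e => _ \/ _) => apply Df_or
  | |- Df _ (fun e => and3 _ _ _) => apply Df_and3
  | |- Df _ (fun e => and4 _ _ _ _) => apply Df_and4
  | |- Df _ (fun e => or3 _ _ _) => apply Df_or3
  | |- Df _ (fun e => ex _) => apply Df_ex
  | |- Df _ (fun e => ex2 _ _) => apply Df_ex2
  | |- Df _ (fun e => _ -> _) => first [apply Df_imp | apply Df_all]
  | |- Df _ (fun e => forall x, _) => apply Df_all
  | |- Df _ (fun e => srel _ _) => apply Df_mem
  | |- Df _ (fun e => @eq _ _ _) => apply Df_eq
  | _ => first [dfn_hyp | dfn_term | dfn_user | assumption | progress dfn_unfold]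
  end.

Ltac dfn := repeat dfn_step.

(* Bundling lets the instance of ZFC be inferred from the carrier. *)
Record zmodel := ZModel { zmodel_str :> structure; zmodel_zfc : models_ZFC zmodel_str }.

Section Basics.

Variable M : zmodel.
Implicit Types (a b c x y z w s u v g p : M) (C : M -> Prop).

Lemma inhabited_model : inhabited M.
Proof. by case: (ZFC_emptyset (zmodel_zfc M)) => x _; constructor. Qed.

(** Hilbert's epsilon makes all set-builder terms total; the membership rule is then earned by
    proving that the set exists. *)
Definition cls (P : M -> Prop) : M :=
  epsilon inhabited_model (fun s => forall z, z ε s <-> P z).

Lemma mem_cls (P : M -> Prop) :
  (exists s, forall z, z ε s <-> P z) -> forall z, z ε cls P <-> P z.
Proof. exact: (epsilon_spec inhabited_model (fun s => forall z, z ε s <-> P z)). Qed.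

Lemma extM x y : (forall z, z ε x <-> z ε y) -> x = y.
Proof. exact: (ZFC_extensionality (zmodel_zfc M)). Qed.

Lemma Df_unary C (P : M -> Prop) : (exists m, C m) -> Df C (fun e => P (e 0)) ->
  exists phi e, (forall i, C (e i)) /\ forall x, P x <-> sat (scons x e) phi.
Proof.
move=> [c cc] [phi [f [_ h2 h3]]].
exists (ren (fun i => if f i is inl _ then 0 else i.+1) phi).
exists (fun i => if f i is inr m then m else c); split.
  by move=> i; case E: (f i) => [j|m] //; apply: h2 E.
move=> z; rewrite (h3 (fun=> z)) sat_ren; apply: sat_ext => i; rewrite /asg.
by case E: (f i) => [j|m] //=; rewrite E.
Qed.

Lemma Df_binary (P : M -> M -> Prop) : Df2 (@anyc M) P ->
  exists phi e, forall x y, P x y <-> sat (scons x (scons y e)) phi.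
Proof.
case: inhabited_model => c [phi [f [_ h2 h3]]].
exists (ren (fun i => match f i with inl 0 => 0 | inl _ => 1 | _ => i.+2 end) phi).
exists (fun i => if f i is inr m then m else c) => x y.
rewrite (h3 (scons x (fun=> y))) sat_ren; apply: sat_ext => i; rewrite /asg.
by case E: (f i) => [[|j]|m] //=; rewrite E.
Qed.

Lemma sep_ex (P : M -> Prop) a : Df1 (@anyc M) P ->
  exists s, forall z, z ε s <-> z ε a /\ P z.
Proof.
case: inhabited_model => c dP.
have [phi [e [_ h]]] := Df_unary (ex_intro (@anyc M) c Logic.I) dP.
have [s hs] := ZFC_separation (zmodel_zfc M) (phi := phi) I e a.
by exists s => z; rewrite hs h.
Qed.

Lemma mem_cls_sub (P : M -> Prop) a : Df1 (@anyc M) P ->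
  (forall z, P z -> z ε a) -> forall z, z ε cls P <-> P z.
Proof.
move=> dP h; apply: mem_cls; have [s hs] := sep_ex a dP.
by exists s => z; rewrite hs; split=> [[]//|hz]; split=> //; apply: h.
Qed.

(** The axiom demands a value at every element, so [a] is first cut down to the domain of [R]. *)
Lemma repl_ex (R : M -> M -> Prop) a : Df2 (@anyc M) R ->
  (forall x y y', x ε a -> R x y -> R x y' -> y = y') ->
  exists s, forall y, y ε s <-> exists2 x, x ε a & R x y.
Proof.
move=> dR uR.
have [|phi [e h]] := @Df_binary (fun y x => R x y).
  exact: (Dfn_ren (fun i => match i with 0 => 1 | _ => 0 end) dR).
have [|a' ha'] := @sep_ex (fun x => exists y, R x y) a.
  apply: Df_ex; cbv beta.
  exact: (Dfn_ren (fun i => match i with 0 => 1 | _ => 0 end) dR).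
have [|s hs] := ZFC_replacement (zmodel_zfc M) (phi := phi) I (e := e) (a := a').
  move=> x /ha' [xa [y xy]]; exists y; split; first by apply/h.
  by move=> y' /h; apply: uR xy.
exists s => y; rewrite hs; split=> -[x hx hy]; exists x.
- by case/ha': hx.
- by apply/h.
- by apply/ha'; split=> //; exists y.
- by apply/h.
Qed.

Lemma Tm_cls C (F : (nat -> M) -> M -> Prop) :
  (forall e z, z ε cls (F e) <-> F e z) ->
  Df C (fun e => F (fun i => e i.+1) (e 0)) -> Tm C (fun e => cls (F e)).
Proof.
move=> hF dF.
apply: (@Df_ext _ _ (fun e => forall z, z ε e 0 <-> F (fun i => e i.+1) z)).
  move=> e; split=> [h|-> z]; last exact: hF.
  by apply: extM => z; rewrite h hF.
dfn.
exact: (Dfn_ren (fun i => if i is i'.+1 then i'.+2 else 0) dF).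
Qed.

Definition emp : M := cls (fun=> False).
Lemma mem_emp z : z ε emp <-> False.
Proof.
rewrite mem_cls //; case: (ZFC_emptyset (zmodel_zfc M)) => x hx; exists x => w.
by split=> // /hx.
Qed.

Definition pr a b : M := cls (fun z => z = a \/ z = b).
Lemma mem_pr a b z : z ε pr a b <-> z = a \/ z = b.
Proof. by rewrite mem_cls //; apply: (ZFC_pairing (zmodel_zfc M)). Qed.

Definition un a : M := cls (fun z => exists y, y ε a /\ z ε y).
Lemma mem_un a z : z ε un a <-> exists y, y ε a /\ z ε y.
Proof.
rewrite mem_cls //; case: (ZFC_union (zmodel_zfc M) a) => u h; exists u => w.
by rewrite h; split=> [[y]|[y []]]; exists y.
Qed.

Definition pw a : M := cls (fun z => subset z a).
Lemma mem_pw a z : z ε pw a <-> subset z a.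
Proof. by rewrite mem_cls //; apply: (ZFC_powerset (zmodel_zfc M)). Qed.

Definition cup a b : M := un (pr a b).
Lemma mem_cup a b z : z ε cup a b <-> z ε a \/ z ε b.
Proof.
rewrite mem_un; split=> [[y [/mem_pr [->|->]]]|[h|h]]; auto.
  by exists a; split=> //; apply/mem_pr; left.
by exists b; split=> //; apply/mem_pr; right.
Qed.

Definition adj a b : M := cup a (pr b b).
Lemma mem_adj a b z : z ε adj a b <-> z ε a \/ z = b.
Proof. by rewrite mem_cup mem_pr; tauto. Qed.

Definition opair a b : M := pr (pr a a) (pr a b).

Lemma pr_inj a b c : pr a b = pr a c -> b = c.
Proof.
move=> h.
have: b ε pr a c by rewrite -h; apply/mem_pr; right.
have: c ε pr a b by rewrite h; apply/mem_pr; right.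
by move=> /mem_pr [->|->] /mem_pr [].
Qed.

Lemma opair_inj a b a' b' : opair a b = opair a' b' -> a = a' /\ b = b'.
Proof.
move=> h.
have e : a = a'.
  have: pr a a ε opair a' b' by rewrite -h; apply/mem_pr; left.
  have ha : a' ε pr a' a' by apply/mem_pr; left.
  have hb : a' ε pr a' b' by apply/mem_pr; left.
  by move=> /mem_pr [E|E]; [move: ha|move: hb]; rewrite -E => /mem_pr [].
by subst a'; split=> //; apply: (@pr_inj a); apply: (@pr_inj (pr a a)).
Qed.

Lemma is_opairE s a b : is_opair s a b <-> s = opair a b.
Proof.
split=> [[u [v [hu hv hs]]]|->].
  have -> : s = pr u v by apply: extM => z; rewrite hs mem_pr.
  have -> : u = pr a a by apply: extM => z; rewrite hu mem_pr.
  by have -> : v = pr a b by apply: extM => z; rewrite hv mem_pr.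
by exists (pr a a), (pr a b); split=> z; rewrite mem_pr.
Qed.

Lemma rel_ofE w a b : rel_of w a b <-> opair a b ε w.
Proof. by split=> [[s /is_opairE ->]|h] //; exists (opair a b) => //; apply/is_opairE. Qed.

Lemma Df_rel_of C (t1 t2 t3 : (nat -> M) -> M) :
  Tm C t1 -> Tm C t2 -> Tm C t3 -> Df C (fun e => rel_of (t1 e) (t2 e) (t3 e)).
Proof.
by move=> h1 h2 h3; apply: (@Df_rel3 _ _ (@rel_of M)) => //; rewrite /rel_of /is_opair /is_pair; dfn.
Qed.

Lemma Tm_pr C (t1 t2 : (nat -> M) -> M) :
  Tm C t1 -> Tm C t2 -> Tm C (fun e => pr (t1 e) (t2 e)).
Proof.
apply: (@Tm_fun2 _ _ (fun a b => pr a b)).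
by apply: Tm_cls => [e z|]; [exact: mem_pr|dfn].
Qed.

Lemma Tm_un C (t1 : (nat -> M) -> M) : Tm C t1 -> Tm C (fun e => un (t1 e)).
Proof.
apply: (@Tm_fun1 _ _ (fun a => un a)).
by apply: Tm_cls => [e z|]; [exact: mem_un|dfn].
Qed.

Lemma Tm_pw C (t1 : (nat -> M) -> M) : Tm C t1 -> Tm C (fun e => pw (t1 e)).
Proof.
apply: (@Tm_fun1 _ _ (fun a => pw a)).
by apply: Tm_cls => [e z|]; [exact: mem_pw|rewrite /subset; dfn].
Qed.

Lemma Tm_emp C : Tm C (fun=> emp).
Proof. by apply: Tm_cls => [e z|]; [exact: mem_emp|dfn]. Qed.

Lemma Tm_opair C (t1 t2 : (nat -> M) -> M) :
  Tm C t1 -> Tm C t2 -> Tm C (fun e => opair (t1 e) (t2 e)).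
Proof. by move=> h1 h2; do 2 apply: Tm_pr => //. Qed.

Lemma Tm_cup C (t1 t2 : (nat -> M) -> M) :
  Tm C t1 -> Tm C t2 -> Tm C (fun e => cup (t1 e) (t2 e)).
Proof. by move=> h1 h2; apply: Tm_un; apply: Tm_pr. Qed.

Lemma Tm_adj C (t1 t2 : (nat -> M) -> M) :
  Tm C t1 -> Tm C t2 -> Tm C (fun e => adj (t1 e) (t2 e)).
Proof. by move=> h1 h2; apply: Tm_cup => //; apply: Tm_pr. Qed.

End Basics.

Arguments emp {M}.

Ltac dfn_user ::=
  lazymatch goal with
  | |- Df _ (fun e => rel_of _ _ _) => apply Df_rel_of
  | |- Tm _ (fun e => opair _ _) => apply Tm_opair
  | |- Tm _ (fun e => adj _ _) => apply Tm_adj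
  | |- Tm _ (fun e => cup _ _) => apply Tm_cup
  | |- Tm _ (fun e => pr _ _) => apply Tm_pr
  | |- Tm _ (fun e => un _) => apply Tm_un
  | |- Tm _ (fun e => pw _) => apply Tm_pw
  | |- Tm _ (fun e => emp) => apply Tm_emp
  end.

Section Products.

Variable M : zmodel.
Implicit Types (a b c x y z w s u v g p h : M) (C : M -> Prop).

Lemma opair_mem x y a b : x ε a -> y ε b -> opair x y ε pw (pw (cup a b)).
Proof.
move=> xa yb; apply/mem_pw => z /mem_pr h; apply/mem_pw => w.
by case: h => -> /mem_pr [->|->]; apply/mem_cup; auto.
Qed.

Lemma mem_un_opair x y g : opair x y ε g -> x ε un (un g) /\ y ε un (un g).
Proof.
move=> h; have k : pr x y ε un g.
  by apply/mem_un; exists (opair x y); split=> //; apply/mem_pr; right.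
by split; apply/mem_un; exists (pr x y); split=> //; apply/mem_pr; auto.
Qed.

Definition cart a b : M := cls (fun z => exists x y, [/\ x ε a, y ε b & z = opair x y]).
Lemma mem_cart a b z : z ε cart a b <-> exists x y, [/\ x ε a, y ε b & z = opair x y].
Proof.
apply: (mem_cls_sub (a := pw (pw (cup a b)))); first by dfn.
by move=> w [x [y [xa yb ->]]]; apply: opair_mem.
Qed.
Lemma mem_cart_pair a b x y : opair x y ε cart a b <-> x ε a /\ y ε b.
Proof.
rewrite mem_cart; split=> [[x' [y' [xa yb /opair_inj [-> ->]]]]|[xa yb]] //.
by exists x, y.
Qed.
Lemma Tm_cart C (t1 t2 : (nat -> M) -> M) :
  Tm C t1 -> Tm C t2 -> Tm C (fun e => cart (t1 e) (t2 e)).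
Proof.
apply: (@Tm_fun2 _ _ (fun a b => cart a b)).
by apply: Tm_cls => [e z|]; [exact: mem_cart|dfn].
Qed.

(* If g is not single-valued at x, this is the union of the values. *)
Definition app g x : M := cls (fun z => exists y, opair x y ε g /\ z ε y).
Lemma mem_app g x z : z ε app g x <-> exists y, opair x y ε g /\ z ε y.
Proof.
apply: (mem_cls_sub (a := un (un (un g)))); first by dfn.
move=> w [y [yg wy]]; apply/mem_un; exists y; split=> //.
by case: (mem_un_opair yg).
Qed.
Lemma appE g x y : opair x y ε g -> (forall y', opair x y' ε g -> y' = y) -> app g x = y.
Proof.
move=> h u; apply: extM => z; rewrite mem_app.
by split=> [[y' [/u -> //]]|zy]; exists y.
Qed.
Lemma Tm_app C (t1 t2 : (nat -> M) -> M) :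
  Tm C t1 -> Tm C t2 -> Tm C (fun e => app (t1 e) (t2 e)).
Proof.
apply: (@Tm_fun2 _ _ (fun a b => app a b)).
by apply: Tm_cls => [e z|]; [exact: mem_app|dfn].
Qed.

Definition p1 p : M := cls (fun z => exists x y, p = opair x y /\ z ε x).
Definition p2 p : M := cls (fun z => exists x y, p = opair x y /\ z ε y).
Lemma mem_p1 p z : z ε p1 p <-> exists x y, p = opair x y /\ z ε x.
Proof.
apply: (mem_cls_sub (a := un (un (un (pr p p))))); first by dfn.
move=> w [x [y [-> wx]]]; apply/mem_un; exists x; split=> //.
by have [] := @mem_un_opair x y (pr (opair x y) (opair x y)) _; first by apply/mem_pr; left.
Qed.
Lemma mem_p2 p z : z ε p2 p <-> exists x y, p = opair x y /\ z ε y.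
Proof.
apply: (mem_cls_sub (a := un (un (un (pr p p))))); first by dfn.
move=> w [x [y [-> wx]]]; apply/mem_un; exists y; split=> //.
by have [] := @mem_un_opair x y (pr (opair x y) (opair x y)) _; first by apply/mem_pr; left.
Qed.
Lemma p1E x y : p1 (opair x y) = x.
Proof.
apply: extM => z; rewrite mem_p1; split=> [[x' [y' [/opair_inj [<- _] //]]]|h].
by exists x, y.
Qed.
Lemma p2E x y : p2 (opair x y) = y.
Proof.
apply: extM => z; rewrite mem_p2; split=> [[x' [y' [/opair_inj [_ <-] //]]]|h].
by exists x, y.
Qed.
Lemma Tm_p1 C (t1 : (nat -> M) -> M) : Tm C t1 -> Tm C (fun e => p1 (t1 e)).
Proof.
apply: (@Tm_fun1 _ _ (fun a => p1 a)).
by apply: Tm_cls => [e z|]; [exact: mem_p1|dfn].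
Qed.
Lemma Tm_p2 C (t1 : (nat -> M) -> M) : Tm C t1 -> Tm C (fun e => p2 (t1 e)).
Proof.
apply: (@Tm_fun1 _ _ (fun a => p2 a)).
by apply: Tm_cls => [e z|]; [exact: mem_p2|dfn].
Qed.

Lemma foundationM (P : M -> Prop) a : Df1 (@anyc M) P ->
  (exists x, x ε a /\ P x) ->
  exists x, [/\ x ε a, P x & forall y, y ε x -> y ε a -> ~ P y].
Proof.
move=> dP [x [xa px]]; have [s hs] := sep_ex a dP.
have [|y /hs [ya py] hy] := ZFC_foundation (zmodel_zfc M) (x := s).
  by exists x; apply/hs.
by exists y; split=> // z zy za pz; apply: (hy z); split=> //; apply/hs.
Qed.

Lemma mem_irr x : ~ x ε x.
Proof.
move=> xx; have [||y [/mem_pr h _]] := @foundationM (fun=> True) (pr x x).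
- exact: Df_true.
- by exists x; split=> //; apply/mem_pr; left.
- have -> : y = x by case: h.
  by move=> /(_ x xx); apply=> //; apply/mem_pr; left.
Qed.

Lemma mem_asym x y : x ε y -> ~ y ε x.
Proof.
move=> xy yx; have [||z [/mem_pr h _]] := @foundationM (fun=> True) (pr x y).
- exact: Df_true.
- by exists x; split=> //; apply/mem_pr; left.
case: h => -> h.
- by apply: (h y) => //; apply/mem_pr; right.
- by apply: (h x) => //; apply/mem_pr; left.
Qed.

End Products.

Ltac dfn_user ::=
  lazymatch goal with
  | |- Df _ (fun e => rel_of _ _ _) => apply Df_rel_of
  | |- Tm _ (fun e => opair _ _) => apply Tm_opair
  | |- Tm _ (fun e => adj _ _) => apply Tm_adj
  | |- Tm _ (fun e => cup _ _) => apply Tm_cup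
  | |- Tm _ (fun e => pr _ _) => apply Tm_pr
  | |- Tm _ (fun e => un _) => apply Tm_un
  | |- Tm _ (fun e => pw _) => apply Tm_pw
  | |- Tm _ (fun e => emp) => apply Tm_emp
  | |- Tm _ (fun e => cart _ _) => apply Tm_cart
  | |- Tm _ (fun e => app _ _) => apply Tm_app
  | |- Tm _ (fun e => p1 _) => apply Tm_p1
  | |- Tm _ (fun e => p2 _) => apply Tm_p2
  end.

(** * Well-orders and recursion *)

Section WellOrders.

Variable M : zmodel.
Implicit Types (a b c x y z w s u v g p h X : M) (C : M -> Prop).
Local Notation any := (@anyc M).

Lemma wo_least R X (P : M -> Prop) : well_orders R X -> Df1 any P ->
  (exists x, x ε X /\ P x) ->
  exists m, [/\ m ε X, P m & forall y, y ε X -> P y -> y = m \/ R m y].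
Proof.
move=> [_ _ _ wo] dP [x [xX px]]; have [s hs] := sep_ex X dP.
have [||m /hs [mX pm] hm] := wo s; first by move=> y /hs [].
  by exists x; apply/hs.
by exists m; split=> // y yX py; apply: hm; apply/hs.
Qed.

Lemma wo_ind R X (P : M -> Prop) : well_orders R X -> Df1 any P ->
  (forall x, x ε X -> (forall y, y ε X -> R y x -> P y) -> P x) ->
  forall x, x ε X -> P x.
Proof.
move=> wo dP IH x xX; apply: NNPP => npx.
have [||m [mX npm hm]] := @wo_least R X (fun x => ~ P x) wo; first exact: Df_not.
  by exists x.
apply: npm; apply: IH => // y yX ym; apply: NNPP => npy.
case: (wo) => irr tr _ _; case: (hm y yX npy) => [e|my].
  by subst y; apply: irr ym.
by apply: (irr m) => //; apply: tr my ym.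
Qed.

Lemma wo_sub R X s : well_orders R X -> subset s X -> well_orders R s.
Proof.
move=> [h1 h2 h3 h4] sX; split.
- by move=> a /sX; apply: h1.
- by move=> a b c /sX ha /sX hb /sX hc; apply: h2.
- by move=> a b /sX ha /sX hb; apply: h3.
- by move=> s' s's; apply: h4 => z /s's /sX.
Qed.

Lemma wo_asym R X x y : well_orders R X -> x ε X -> y ε X -> R x y -> ~ R y x.
Proof. by move=> [irr tr _ _] xX yX xy yx; apply: (irr x) => //; apply: tr xy yx. Qed.

Lemma wo_ex X : exists r, well_orders (rel_of r) X.
Proof. exact: (ZFC_choice (zmodel_zfc M)). Qed.

Lemma choice_in (F : M -> M -> Prop) a b : Df2 any F ->
  (forall x, x ε a -> exists y, y ε b /\ F x y) ->
  exists g, forall x, x ε a -> exists y,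
    [/\ y ε b, F x y, app g x = y & forall y', opair x y' ε g <-> y' = y].
Proof.
move=> dF hF; have [r wr] := wo_ex b.
pose L x y := [/\ y ε b, F x y & forall y', y' ε b -> F x y' -> y' = y \/ rel_of r y y'].
have dL : Df2 any L by rewrite /L; dfn.
have [|g hg] := @sep_ex M (fun p => exists x y, p = opair x y /\ L x y) (cart a b).
  by dfn.
exists g => x xa.
have [||y [yb fy hy]] := @wo_least _ b (F x) wr; [by dfn|by case: (hF x xa) => y []; exists y|].
have key y' : opair x y' ε g <-> y' = y.
  rewrite hg mem_cart_pair; split=> [[_ [x' [y0 [/opair_inj [<- <-] [y'b fy' hy']]]]]|->].
    case: (hy y' y'b fy') => // yy'; case: (hy' y yb fy) => // y'y.
    by case: (wo_asym wr yb y'b yy' y'y).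
  by split=> //; exists x, y.
exists y; split=> //; apply: appE; first by apply/key.
by move=> y' /key.
Qed.

(** The one equivalence says that [h] is single-valued and injective on [a]. Pairs starting outside
    [a] are ignored, so [h] serves subsets of [a] unchanged. *)
Definition injn h a b : Prop :=
  (forall x, x ε a -> exists y, y ε b /\ opair x y ε h) /\
  (forall x x' y y', x ε a -> x' ε a -> opair x y ε h -> opair x' y' ε h ->
     (x = x' <-> y = y')).

Definition le a b : Prop := exists h, injn h a b.

Lemma le_of_rel (F : M -> M -> Prop) a b : Df2 any F ->
  (forall x, x ε a -> exists y, y ε b /\ F x y) ->
  (forall x x' y, x ε a -> x' ε a -> F x y -> F x' y -> x = x') -> le a b.
Proof.
move=> dF hF iF; have [g hg] := choice_in dF hF; exists g; split.
  by move=> x /hg [y [yb _ _ hy]]; exists y; split=> //; apply/hy.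
move=> x x' y y' xa x'a.
case: (hg x xa) (hg x' x'a) => [y1 [_ f1 _ h1]] [y2 [_ f2 _ h2]] /h1 -> /h2 ->.
by split=> [E|E]; [subst x'; apply/h2/h1|apply: (iF x x' y1) => //; rewrite E].
Qed.

Lemma le_refl_sub a b : subset a b -> le a b.
Proof.
move=> ab; apply: (@le_of_rel (fun x y => x = y)); first by dfn.
  by move=> x /ab xb; exists x.
by move=> x x' y _ _ -> ->.
Qed.

Lemma le_trans a b c : le a b -> le b c -> le a c.
Proof.
move=> [h [h1 h2]] [k [k1 k2]].
apply: (@le_of_rel (fun x z => exists y, [/\ y ε b, opair x y ε h & opair y z ε k])).
- by dfn.
- move=> x /h1 [y [yb xy]]; have [z [zc yz]] := k1 y yb.
  by exists z; split=> //; exists y.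
- move=> x x' z xa x'a [y [yb xy yz]] [y' [y'b xy' yz']].
  by apply/(h2 _ _ _ _ xa x'a xy xy'); apply/(k2 _ _ _ _ yb y'b yz yz').
Qed.

Lemma not_le_pw a : ~ le (pw a) a.
Proof.
move=> [h [h1 h2]].
have [|d hd] := @sep_ex M (fun y => exists s, [/\ s ε pw a, opair s y ε h & ~ y ε s]) a.
  by dfn.
have dP : d ε pw a by apply/mem_pw => y /hd [].
have [y [ya dy]] := h1 d dP.
have nyd : ~ y ε d.
  move=> yd; case/hd: (yd) => _ [s [sP sy nys]].
  by have E := (h2 _ _ _ _ dP sP dy sy).2 erefl; subst s.
by apply: (nyd); apply/hd; split=> //; exists d.
Qed.

End WellOrders.

Ltac dfn_unfold ::= cbv beta delta [subset transitive_set is_empty le injn].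

(** * Recursion along well-orders and comparability of sizes *)

Section Recursion.

Variable M : zmodel.
Implicit Types (a b c x y z w s u v g p h X : M) (C : M -> Prop).
Local Notation any := (@anyc M).

(** Whether [u] enters [P] depends on the part of [P] below [u]. An approximation at [u] obeys the
    rule below [u] and admits [u]; by induction it agrees with [P] there, so [P] can be defined by
    the existence of an approximation. *)
Lemma subset_recursion R X (F : M -> (M -> Prop) -> Prop) :
  well_orders R X -> Df2 any R ->
  (forall u A B, (forall w, A w <-> B w) -> F u A -> F u B) ->
  Df2 any (fun u p => F u (fun w => w ε p /\ R w u)) ->
  exists P, forall u, u ε P <-> u ε X /\ F u (fun w => w ε P /\ R w u).
Proof.
move=> wo dR eF dF; case: (wo) => irr tr _ _.
pose FF u p := F u (fun w => w ε p /\ R w u); rewrite -/FF in dF.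
pose ok u p := [/\ subset p X, forall w, w ε X -> R w u -> (w ε p <-> FF w p) & FF u p].
have dok : Df2 any ok by rewrite /ok; dfn.
have [|P hP] := @sep_ex M (fun u => exists p, ok u p) X; first by dfn.
exists P => u; rewrite -/(FF u P); suff [uX|nuX] : u ε X \/ ~ u ε X.
- suff -> : FF u P <-> u ε P by split=> [|[]].
  move: u uX; apply: (wo_ind wo); first by dfn.
  move=> u uX IH; split=> [fu|/hP [_ [p [pX hp fu]]]].
    apply/hP; split=> //; exists P; split=> //; first by move=> w /hP [].
    by move=> w wX wu; rewrite IH.
  apply: (eF u _ _ _ fu) => w; suff h : w ε X -> R w u -> (w ε p <-> w ε P).
    by split=> -[wp wu]; split=> //; apply/h => //; [apply: pX|case/hP: wp].
  move=> wX; move: w wX; apply: (wo_ind wo); first by dfn.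
  move=> w wX IHw wu; rewrite hp // -(IH w) //.
  by split; apply: (eF w) => v; split=> -[vp vw]; split=> //; apply/IHw => //;
    (try by apply: pX); (try by case/hP: vp);
    apply: tr wu => //; (try by apply: pX); (try by case/hP: vp).
- by split=> [/hP|] [].
- exact: classic.
Qed.

Section ValueRecursion.

Variables (R : M -> M -> Prop) (X : M) (G : M -> M).
Hypotheses (wo : well_orders R X) (dR : Df2 any R) (dG : Tm1 any G).

Definition valsb g u : M := cls (fun v => exists w, R w u /\ opair w v ε g).

Lemma mem_valsb g u v : v ε valsb g u <-> exists w, R w u /\ opair w v ε g.
Proof.
apply: (mem_cls_sub (a := un (un g))); first by dfn.
by move=> z [w [_ /mem_un_opair []]].
Qed.

Lemma Tm_valsb : Tm2 any valsb.
Proof. by apply: Tm_cls => [e z|]; [exact: mem_valsb|dfn]. Qed.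

Definition approx (U : M -> Prop) g : Prop := forall p, p ε g <->
  exists w v, [/\ w ε X, U w, p = opair w v & v = G (valsb g w)].

Lemma approx_pair U g w v : approx U g ->
  (opair w v ε g <-> [/\ w ε X, U w & v = G (valsb g w)]).
Proof.
move=> ag; rewrite ag; split=> [[w' [v' [wX uw /opair_inj [-> ->] ->]]]|[wX uw ->]] //.
by exists w, (G (valsb g w)).
Qed.

Lemma valsb_eq U U' g g' u : approx U g -> approx U' g' -> u ε X ->
  (forall w, w ε X -> R w u -> U w /\ U' w) -> valsb g u = valsb g' u.
Proof.
case: (wo) => irr tr _ _ ag ag' uX hu; move: u uX hu.
suff key : forall u, u ε X -> (forall w, w ε X -> R w u -> U w /\ U' w) ->
    valsb g u = valsb g' u by [].
move=> u uX hu.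
have h : forall w, w ε X -> R w u -> valsb g w = valsb g' w.
  apply: (wo_ind wo); first by have dV := Tm_valsb; dfn.
  move=> w wX IH wu; apply: extM => v; rewrite !mem_valsb.
  split=> -[w' [w'w]].
    case/(approx_pair _ _ ag) => w'X _ ->; exists w'; split=> //.
    have w'u : R w' u by apply: tr wu.
    by apply/(approx_pair _ _ ag'); split=> //; [case: (hu w')|rewrite IH].
  case/(approx_pair _ _ ag') => w'X _ ->; exists w'; split=> //.
  have w'u : R w' u by apply: tr wu.
  by apply/(approx_pair _ _ ag); split=> //; [case: (hu w')|rewrite IH].
apply: extM => v; rewrite !mem_valsb; split=> -[w [wu]].
  case/(approx_pair _ _ ag) => wX _ ->; exists w; split=> //.
  by apply/(approx_pair _ _ ag'); split=> //; [case: (hu w)|rewrite h].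
case/(approx_pair _ _ ag') => wX _ ->; exists w; split=> //.
by apply/(approx_pair _ _ ag); split=> //; [case: (hu w)|rewrite h].
Qed.

Lemma Df_approx_below : Df2 any (fun u g => approx (fun w => R w u) g).
Proof. by have dV := Tm_valsb; rewrite /approx; dfn. Qed.

(** Stated for any downward closed [U], so that one proof serves the induction step, where [U] is
    the segment below a point, and the final step, where [U] is everything. *)
Lemma approx_step U : Df1 any U ->
  (forall w w', w ε X -> w' ε X -> R w' w -> U w -> U w') ->
  (forall w, w ε X -> U w -> exists g, approx (fun v => R v w) g) ->
  exists g, approx U g.
Proof.
move=> dU Udn hU; have dA := Df_approx_below; have dV := Tm_valsb.
case: (wo) => irr tr _ _.
pose A w g := approx (fun v => R v w) g; rewrite -/A in dA.
pose Q w p := [/\ w ε X, U w & exists g, A w g /\ p = @opair M w (G (valsb g w))].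
have [||S hS] := @repl_ex M Q X.
- by rewrite /Q; dfn.
- move=> w p p' wX [_ _ [g [ag ->]]] [_ _ [g' [ag' ->]]].
  by rewrite (valsb_eq ag ag').
have key w g : w ε X -> U w -> A w g -> valsb S w = valsb g w.
  move=> wX uw ag; apply: extM => v; rewrite !mem_valsb; split=> -[w' [w'w]].
    move=> /hS [w1 w1X [_ uw1 [g' [ag' /opair_inj [E ->]]]]]; subst w1.
    exists w'; split=> //; apply/(approx_pair _ _ ag); split=> //; congr G.
    by apply: (valsb_eq ag' ag) => // w2 w2X h; split=> //; apply: tr w'w.
  case/(approx_pair _ _ ag) => w'X _ ->; exists w'; split=> //.
  have uw' := Udn _ _ wX w'X w'w uw; have [g' ag'] := hU w' w'X uw'.
  apply/hS; exists w' => //; split=> //; exists g'; split=> //; congr opair; congr G.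
  by apply: (valsb_eq ag ag') => // w2 w2X h; split=> //; apply: tr w'w.
exists S => p; rewrite hS; split=> [[w wX [_ uw [g [ag ->]]]]|[w [v [wX uw -> ->]]]].
  by exists w, (G (valsb g w)); rewrite (key w g).
have [g ag] := hU w wX uw; exists w => //; split=> //; exists g; split=> //.
by rewrite (key w g).
Qed.

Lemma value_recursion : exists g, forall w v,
  opair w v ε g <-> w ε X /\ v = G (valsb g w).
Proof.
have [|||g ag] := @approx_step (fun=> True); first by dfn.
- by [].
- suff h : forall w, w ε X -> exists g, approx (fun v => R v w) g by move=> w /h.
  have dA := Df_approx_below; pose A u g := approx (fun w => R w u) g.
  rewrite -/A in dA; apply: (wo_ind (P := fun u => exists g, A u g) wo); first by dfn.
  move=> u uX IH; apply: approx_step; first by dfn.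
    by case: wo => irr tr _ _ w w' wX w'X; apply: tr.
  exact: IH.
- by exists g => w v; rewrite (approx_pair _ _ ag); split=> [[]|[]].
Qed.

End ValueRecursion.

(** Along a well-order of [a], each point is sent to the least element of [b] not yet used. If [b]
    is exhausted below some point, then [b] injects into [a]; otherwise [a] injects into [b]. *)
Lemma le_total a b : le a b \/ le b a.
Proof.
have [r wr] := wo_ex a; have [r' wr'] := wo_ex b.
pose L s v := [/\ v ε b, ~ v ε s
  & forall v', v' ε b -> ~ v' ε s -> v' = v \/ rel_of r' v v'].
(* When nothing of [b] is left the value is [b] itself, which foundation keeps apart from the
   elements of [b]. *)
pose H s z := (exists v, L s v /\ z ε v) \/ ((~ exists v, L s v) /\ z ε b).
have dL : Df2 any L by rewrite /L; dfn.
have mG s z : z ε cls (H s) <-> H s z.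
  apply: (mem_cls_sub (a := cup (un b) b)); first by rewrite /H; dfn.
  move=> w [[v [[vb _ _] wv]]|[_ wb]]; apply/mem_cup; last by right.
  by left; apply/mem_un; exists v.
pose G s := @cls M (H s).
have dG : Tm1 any G by apply: Tm_cls => // ; rewrite /H; dfn.
have GL s v : L s v -> G s = v.
  move=> lv; apply: extM => z; rewrite mG; split=> [[[v' [lv' zv']]|[[]]]|zv].
  - suff -> : v = v' by [].
    case: lv lv' => vb nv hv [v'b nv' hv']; case: (hv v' v'b nv') => // vv'.
    by case: (hv' v vb nv) => // v'v; case: (wo_asym wr' vb v'b vv' v'v).
  - by exists v.
  - by left; exists v.
have Gb s : ~ (exists v, L s v) -> G s = b.
  move=> nl; apply: extM => z; rewrite mG.
  by split=> [[[v [lv _]]|[] //]|zb]; [case: nl; exists v|right].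
have dr : Df2 any (rel_of r) by dfn.
have [g hg] := @value_recursion (rel_of r) a G wr dr dG.
have dv := @Tm_valsb (rel_of r) dr.
have least s : (exists v, L s v) \/ forall v, v ε b -> v ε s.
  case: (classic (exists v, v ε b /\ ~ v ε s)) => [h|h].
    have [|v [vb nv hv]] := wo_least wr' _ h; first by dfn.
    by left; exists v.
  by right=> v vb; apply: NNPP => nv; apply: h; exists v.
have uniq : forall w w' v, w ε a -> w' ε a -> v ε b -> opair w v ε g -> opair w' v ε g -> w = w'.
  move=> w w' v; suff asym : forall w1 w2, w1 ε a -> w2 ε a -> v ε b -> opair w1 v ε g -> opair w2 v ε g ->
      ~ rel_of r w1 w2.
    move=> wa w'a vb h h'; case: (wr) => _ _ tot _.
    by case: (tot w w' wa w'a) => // /asym; case.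
  move=> w1 w2 w1a w2a vb h1 h2 w12; have [_ E2] := (hg _ _).1 h2.
  have vin : v ε valsb (rel_of r) g w2 by apply/(mem_valsb dr); exists w1.
  case: (least (valsb (rel_of r) g w2)) => [[v' lv']|hb].
    by move: E2; rewrite (GL _ _ lv') => E; subst v'; case: lv'.
  move: E2; rewrite Gb => [E|[v' [v'b nv' _]]]; last exact: nv' (hb _ v'b).
  by subst v; apply: (mem_irr vb).
case: (classic (exists w, w ε a /\ forall v, v ε b -> v ε valsb (rel_of r) g w)).
  move=> [w [wa hw]]; right.
  apply: (@le_of_rel M (fun v w' => opair w' v ε g)); first by dfn.
    move=> v /hw /(mem_valsb dr) [w' [_ h]]; exists w'; split=> //.
    by case/hg: h.
  by move=> v v' w' _ _ /hg [_ ->] /hg [_ ->].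
move=> nw; left.
apply: (@le_of_rel M (fun w v => v ε b /\ opair w v ε g)); first by dfn.
  move=> w wa; case: (least (valsb (rel_of r) g w)) => [[v lv]|hb]; last first.
    by case: nw; exists w.
  exists v; split; first by case: lv.
  by split; [case: lv|apply/hg; split=> //; rewrite (GL _ _ lv)].
by move=> w w' v wa w'a [vb h] [_ h']; apply: uniq h h'.
Qed.

End Recursion.

(** * Ordinals, levels and rigidity *)

Section Ordinals.

Variable M : zmodel.
Implicit Types (a b c x y z w s t u v g p h X : M) (C : M -> Prop).
Local Notation any := (@anyc M).

(* By foundation these are exactly the von Neumann ordinals. *)
Definition ord x : Prop :=
  transitive_set x /\ forall y, y ε x -> transitive_set y.

Lemma ord_mem x y : ord x -> y ε x -> ord y.
Proof. by move=> [tx hx] yx; split; [apply: hx|move=> z zy; apply: hx; apply: (tx y)]. Qed.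

Lemma ord_total x y : ord x -> ord y -> [\/ x ε y, x = y | y ε x].
Proof.
move=> ox0 oy0; apply: NNPP => n0.
pose cmp u v := [\/ u ε v, u = v | v ε u].
have dcmp : Df2 any cmp by rewrite /cmp; dfn.
have [||x1 [x1a [ox [y1 [oy n1]]] minx]] :=
  @foundationM M (fun u => ord u /\ exists v, ord v /\ ~ cmp u v) (adj x x).
- by rewrite /ord; dfn.
- by exists x; split; [apply/mem_adj; right|split=> //; exists y].
have [||y2 [y2a [oy2 n2] miny]] :=
  @foundationM M (fun v => ord v /\ ~ cmp x1 v) (adj y1 y1).
- by rewrite /ord; dfn.
- by exists y1; split; [apply/mem_adj; right|split].
apply: (n2); suff -> : x1 = y2 by constructor 2.
apply: extM => z; split=> hz.
  have za : z ε adj x x.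
    apply/mem_adj; left; case/mem_adj: x1a => [h|E]; last by subst x1.
    by case: ox0 => tx _; apply: (tx x1).
  have oz := ord_mem ox hz.
  have : cmp z y2.
    by apply: NNPP => nz; apply: (minx z hz za); split=> //; exists y2.
  move=> [//|E|h]; exfalso; apply: n2; constructor 3; first by rewrite -E.
  by case: ox => tx _; apply: (tx z).
have za : z ε adj y1 y1.
  apply/mem_adj; left; case/mem_adj: y2a => [h|E]; last by subst y2.
  by case: oy => ty _; apply: (ty y2).
have : cmp x1 z.
  by apply: NNPP => nz; apply: (miny z hz za); split=> //; apply: ord_mem hz.
move=> [h|E|//]; exfalso; apply: n2; constructor 1; last by rewrite E.
by case: oy2 => ty _; apply: (ty z).
Qed.

Lemma wo_ord X : (forall x, x ε X -> ord x) -> well_orders srel X.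
Proof.
move=> oX; split.
- by move=> a _; apply: mem_irr.
- by move=> a b c _ _ /oX [tc _] ab bc; apply: (tc b).
- by move=> a b /oX oa /oX ob; apply: ord_total.
- move=> s sX [z zs].
  have [||m [ms _ hm]] := @foundationM M (fun=> True) s; [by dfn|by exists z|].
  exists m => // y ys; case: (ord_total (oX _ (sX _ ms)) (oX _ (sX _ ys))); auto.
  by move=> ym; case: (hm y ym ys).
Qed.

Lemma ord_is_ordinal x : ord x -> is_ordinal x.
Proof. by move=> ox; split; [case: ox|apply: wo_ord => y; apply: ord_mem]. Qed.

Lemma TC_sup x : exists t, transitive_set t /\ x ε t.
Proof.
have [W [[e0 he0 e0W] sW]] := ZFC_infinity (zmodel_zfc M).
(* An inductive set need not be well-ordered by membership; its ordinals are, and they still have no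
   last element. *)
have [|X hX] := @sep_ex M (fun n => ord n) W; first by rewrite /ord; dfn.
have X0 : e0 ε X by apply/hX; split=> //; split=> y /he0.
have XS n : n ε X -> exists2 m, m ε X & n ε m.
  move=> /hX [nW [tn hn]]; have [m hm mW] := sW n nW.
  exists m; last by apply/hm; right.
  apply/hX; split=> //; split=> y /hm [yn|->].
  - by move=> z zy; apply/hm; left; apply: (tn y).
  - by move=> z zn; apply/hm; left.
  - exact: hn.
  - exact: tn.
have wX : well_orders srel X by apply: wo_ord => y /hX [].
(* With [s] the set of earlier values, a value consists of [x] and all members of members of earlier
   values. As there is always a next index, the union of the values is transitive. *)
pose G s := cup (pr x x) (un (un s)).
have dG : Tm1 any G by rewrite /G; dfn.
have dM : Df2 any (@srel M) by dfn.
have [g hg] := value_recursion wX dM dG.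
have [|T hT] := @sep_ex M (fun z => exists n v, opair n v ε g /\ z ε v) (un (un (un g))).
  by dfn.
have inT n v z : opair n v ε g -> z ε v -> z ε T.
  move=> h zv; apply/hT; split; last by exists n, v.
  by apply/mem_un; exists v; split=> //; case: (mem_un_opair h).
exists T; split; last first.
  apply: (inT e0 (G (valsb srel g e0))); first by apply/hg.
  by apply/mem_cup; left; apply/mem_pr; left.
move=> y /hT [_ [n [v [h yv]]]] z zy.
case/hg: (h) => nX _; have [m mX nm] := XS n nX.
apply: (inT m (G (valsb srel g m))); first by apply/hg.
apply/mem_cup; right; apply/mem_un; exists y; split=> //.
by apply/mem_un; exists v; split=> //; apply/(mem_valsb dM); exists n.
Qed.

Lemma TC_ex x : exists t, is_TC t x.
Proof.
have [T [tT xT]] := TC_sup x.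
have [|t ht] := @sep_ex M (fun z => forall u, transitive_set u -> subset x u -> z ε u) T.
  by dfn.
exists t; split.
- move=> y /ht [yT hy] z zy; apply/ht; split; first exact: (tT y).
  by move=> u tu xu; apply: (tu y) => //; apply: hy.
- by move=> y yx; apply/ht; split; [apply: (tT x)|move=> u _; apply].
- by move=> u tu xu z /ht [_]; apply.
Qed.

Lemma mem_ind (P : M -> Prop) : Df1 any P ->
  (forall x, (forall y, y ε x -> P y) -> P x) -> forall x, P x.
Proof.
move=> dP IH x; apply: NNPP => npx; have [T [tT xT]] := TC_sup x.
have [||y [yT npy hy]] := @foundationM M (fun y => ~ P y) T; [by dfn|by exists x|].
by apply: npy; apply: IH => z zy; apply: NNPP; apply: hy => //; apply: (tT y).
Qed.

End Ordinals.

Ltac dfn_unfold ::= cbv beta delta [subset transitive_set is_empty le injn ord].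

(* Scott's levels: a definition of the cumulative hierarchy without ordinals *)
Section Levels.

Variable M : zmodel.
Implicit Types (a b c x y z w r s t u v g p h X : M) (C : M -> Prop).
Local Notation any := (@anyc M).

Definition history h : Prop := forall x, x ε h ->
  forall z, z ε x <-> exists c, [/\ c ε x, c ε h & subset z c].

Definition level s : Prop := exists h, history h /\
  forall z, z ε s <-> exists c, c ε h /\ subset z c.

Lemma Df_level : Df1 any level.
Proof. by rewrite /level /history; dfn. Qed.

Lemma level_sub s x y : level s -> x ε s -> subset y x -> y ε s.
Proof.
move=> [h [_ hs]] /hs [c [ch xc]] yx; apply/hs; exists c; split=> //.
by move=> z /yx /xc.
Qed.

Lemma level_trans s : level s -> transitive_set s.
Proof.
move=> [h [hh hs]] x /hs [c [ch xc]] y /xc /(hh c ch) [d [_ dh yd]].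
by apply/hs; exists d.
Qed.

Lemma history_trans h c : history h -> c ε h ->
  forall d, d ε c -> d ε h -> subset d c.
Proof.
move=> hh ch0; apply: NNPP => n0.
have [||{ch0 n0}c [ch nc hc]] :=
  @foundationM M (fun c => ~ forall d, d ε c -> d ε h -> subset d c) h; first by dfn.
  by exists c.
apply: nc => d dc dh y yd; apply/(hh c ch); exists d; split=> //.
case/(hh d dh): (yd) => e [ed eh ye] z /ye.
by apply: (NNPP _ (hc d dc dh)).
Qed.

Lemma history_level h c : history h -> c ε h -> level c.
Proof.
move=> hh ch; have [k hk] := @sep_ex M (fun d => d ε h) c ltac:(by dfn).
exists k; split=> [x /hk [xc xh] z|z].
  rewrite (hh x xh); split=> -[d [dx dh zd]]; exists d; split=> //.
    by apply/hk; split=> //; apply: (history_trans hh ch xc xh).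
  by case/hk: dh.
rewrite (hh c ch); split=> [[d [dc dh zd]]|[d [/hk [dc dh] zd]]]; exists d; split=> //.
by apply/hk.
Qed.

Lemma level_pot s z : level s -> (z ε s <-> exists r, [/\ r ε s, level r & subset z r]).
Proof.
move=> ls; split=> [|[r [rs _ zr]]]; last exact: level_sub zr.
case: (ls) => h [hh hs] /hs [c [ch zc]]; exists c; split=> //.
  by apply/hs; exists c; split=> // y.
exact: history_level ch.
Qed.

(** A minimal counterexample is taken in both arguments, as for ordinals; by [level_pot] a level is
    determined by the levels it contains. *)
Lemma level_total s t : level s -> level t -> [\/ s ε t, s = t | t ε s].
Proof.
move=> ls0 lt0; apply: NNPP => n0; have dL := Df_level.
pose cmp u v := [\/ u ε v, u = v | v ε u].
have dcmp : Df2 any cmp by rewrite /cmp; dfn.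
have [||s1 [s1a [ls [t1 [lt n1]]] mins]] :=
  @foundationM M (fun u => level u /\ exists v, level v /\ ~ cmp u v) (adj s s).
- by dfn.
- by exists s; split; [apply/mem_adj; right|split=> //; exists t].
have [||t2 [t2a [lt2 n2] mint]] :=
  @foundationM M (fun v => level v /\ ~ cmp s1 v) (adj t1 t1).
- by dfn.
- by exists t1; split; [apply/mem_adj; right|split].
have up x y z : level y -> x ε adj y y -> z ε x -> z ε adj y y.
  move=> ly /mem_adj [xy|->] zx; apply/mem_adj; left=> //.
  exact: (level_trans ly xy).
apply: (n2); suff -> : s1 = t2 by constructor 2.
apply: extM => z; rewrite (level_pot _ ls) (level_pot _ lt2).
split=> -[r [rs lr zr]]; exists r; split=> //.
  have : cmp r t2.
    by apply: NNPP => nr; apply: (mins r rs (up _ _ _ ls0 s1a rs)); split=> //; exists t2.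
  move=> [//|E|h]; exfalso; apply: n2; constructor 3; first by rewrite -E.
  exact: (level_trans ls rs).
have : cmp s1 r.
  by apply: NNPP => nr; apply: (mint r rs (up _ _ _ lt t2a rs)).
move=> [h|E|//]; exfalso; apply: n2; constructor 1; last by rewrite E.
exact: (level_trans lt2 rs).
Qed.

Lemma level_least (P : M -> Prop) : Df1 any P -> (exists s, level s /\ P s) ->
  exists s, [/\ level s, P s & forall r, level r -> P r -> r = s \/ s ε r].
Proof.
move=> dP [s [ls ps]]; have dL := Df_level.
have [||m [ms [lm pm] hm]] := @foundationM M (fun u => level u /\ P u) (adj s s).
- by dfn.
- by exists s; split=> //; apply/mem_adj; right.
exists m; split=> // r lr pr; case: (level_total lr lm); auto=> rm.
case: (hm r rm) => //; apply/mem_adj; left.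
by case/mem_adj: ms => [ms|E]; [apply: (level_trans ls ms)|subst m].
Qed.

(** The levels that lie in [a] or in a member of [a] form a history. *)
Lemma level_above a : (forall s, s ε a -> level s) ->
  exists t, level t /\ subset a t.
Proof.
move=> la; have dL := Df_level.
have [|h hh] := @sep_ex M (fun r => level r) (cup a (un a)); first by dfn.
have hdn r q : r ε h -> level q -> q ε r -> q ε h.
  move=> /hh [/mem_cup ra lr] lq qr; apply/hh; split=> //; apply/mem_cup; right.
  case: ra => [ra|/mem_un [s [sa rs]]]; apply/mem_un; first by exists r.
  by exists s; split=> //; apply: (level_trans (la s sa) rs).
have hist : history h.
  move=> x xh z; have lx : level x by case/hh: (xh).
  rewrite (level_pot _ lx); split=> -[r [rx rr zr]]; exists r; split=> //.
    exact: hdn xh rr rx.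
  by case/hh: rr.
have [|t ht] := @sep_ex M (fun z => exists c, c ε h /\ subset z c) (pw (un h)).
  by dfn.
have ht' z : z ε t <-> exists c, c ε h /\ subset z c.
  rewrite ht; split=> [[]|[c [ch zc]]] //; split; last by exists c.
  by apply/mem_pw => y /zc yc; apply/mem_un; exists c.
exists t; split; first by exists h.
move=> s sa; apply/ht'; exists s; split=> [|y //]; apply/hh; split; last exact: la.
by apply/mem_cup; left.
Qed.

Lemma level_ex x : exists s, level s /\ x ε s.
Proof.
have dL := Df_level; move: x; apply: mem_ind; first by dfn.
move=> x IH.
pose Q z s := [/\ level s, z ε s & forall r, level r -> z ε r -> r = s \/ s ε r].
have dQ : Df2 any Q by rewrite /Q; dfn.
have [|a ha] := @repl_ex M Q x dQ.
  move=> z s s' _ [ls zs hs] [ls' zs' hs'].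
  case: (hs _ ls' zs') => // h; case: (hs' _ ls zs) => // h'.
  by case: (mem_asym h h').
have la s : s ε a -> level s by move=> /ha [z _ []].
have [t [lt at_]] := level_above la.
have xt : subset x t.
  move=> z zx; have [|s [ls zs hs]] := @level_least (fun s => z ε s) _ (IH z zx).
    by dfn.
  apply: (level_trans lt (y := s)) => //.
  by apply: at_; apply/ha; exists z.
have [|t' [lt' tt']] := @level_above (pr t t).
  by move=> s /mem_pr [->|->].
exists t'; split=> //; apply: level_sub xt => //.
by apply: tt'; apply/mem_pr; left.
Qed.

(** Scott's trick: replacement is applied to the function sending [x] to the least level that
    contains a witness. *)
Lemma collectionM (F : M -> M -> Prop) a : Df2 any F ->
  (forall x, x ε a -> exists y, F x y) ->
  exists b, forall x, x ε a -> exists y, y ε b /\ F x y.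
Proof.
move=> dF hF; have dL := Df_level.
pose P x s := exists y, y ε s /\ F x y.
have dP : Df2 any P by rewrite /P; dfn.
pose Q x s := [/\ level s, P x s & forall r, level r -> P x r -> r = s \/ s ε r].
have [||b hb] := @repl_ex M Q a.
- by rewrite /Q; dfn.
- move=> x s s' _ [ls ps hs] [ls' ps' hs'].
  case: (hs _ ls' ps') => // h; case: (hs' _ ls ps) => // h'.
  by case: (mem_asym h h').
exists (un b) => x xa; have [y xy] := hF x xa; have [s0 [ls0 ys0]] := level_ex y.
have [||s [ls [y' [y's xy']] hs]] := @level_least (P x); first by dfn.
  by exists s0; split=> //; exists y.
exists y'; split=> //; apply/mem_un; exists s; split=> //.
by apply/hb; exists x => //; split=> //; exists y'.
Qed.

Lemma choiceM (F : M -> M -> Prop) a : Df2 any F ->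
  (forall x, x ε a -> exists y, F x y) ->
  exists g, forall x, x ε a -> F x (app g x).
Proof.
move=> dF hF; have [b hb] := collectionM dF hF.
by have [g hg] := choice_in dF hb; exists g => x /hg [y [_ fy -> _]].
Qed.

End Levels.

(** * Transitive sets are determined by a copy of their membership relation *)

Section Rigidity.

Variable M : zmodel.
Implicit Types (a b c x y z w r s t u v g p h k X : M) (C : M -> Prop).
Local Notation any := (@anyc M).

(* The reflexive closure is taken so that isolated points are recorded. *)
Definition traces h t r : Prop := forall p, p ε r <-> exists u v a b,
  [/\ u ε t, v ε t, u ε v \/ u = v & [/\ opair u a ε h, opair v b ε h & p = opair a b]].

Lemma traces_ex h t y : injn h t y -> exists r, traces h t r /\ subset r (cart y y).
Proof.
move=> [h1 h2].
have [|r hr] := @sep_ex M (fun p => exists u v a b,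
  [/\ u ε t, v ε t, u ε v \/ u = v & [/\ opair u a ε h, opair v b ε h & p = opair a b]])
  (cart y y); first by dfn.
exists r; split=> [p|p /hr []] //; rewrite hr; split=> [[]|H] //; split=> //.
case: H => u [v [a [b [ut vt _ [ua vb ->]]]]]; apply/mem_cart_pair.
have [a' [ay ua']] := h1 u ut; have [b' [b'y vb']] := h1 v vt.
rewrite ((h2 _ _ _ _ ut ut ua ua').1 erefl) ((h2 _ _ _ _ vt vt vb vb').1 erefl).
by split.
Qed.

(** Uniqueness of the Mostowski collapse. At a minimal bad [u], the diagonal pair at its image under
    [h] provides a point [u'] of [t'] with the same image under [k]; the relation [r] and minimality
    give both the same members. *)
Lemma rigid_half h k t t' y r : transitive_set t -> transitive_set t' ->
  injn h t y -> injn k t' y -> traces h t r -> traces k t' r ->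
  forall u, u ε t -> u ε t' /\ forall a, opair u a ε h <-> opair u a ε k.
Proof.
move=> tt tt' [h1 h2] [k1 k2] rh rk u ut.
pose P u := u ε t' /\ exists a, opair u a ε h /\ opair u a ε k.
suff [ut' [a [ha ka]]] : P u.
  split=> // b; split=> hb.
    by rewrite -((h2 _ _ _ _ ut ut ha hb).1 erefl).
  by rewrite -((k2 _ _ _ _ ut' ut' ka hb).1 erefl).
have dP : Df1 any P by rewrite /P; dfn.
apply: NNPP => n0; have [||{u ut n0}u [ut npu IH]] := @foundationM M (fun u => ~ P u) t.
- by dfn.
- by exists u.
apply: npu; have [a [ay ua]] := h1 u ut.
have : opair a a ε r.
  by apply/rh; exists u, u, a, a; split=> //; right.
move=> /rk [u' [u1 [a1 [a2 [u't' u1t' _ [k1' k2' /opair_inj [E1 E2]]]]]]]; subst a1 a2.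
suff E : u = u' by subst u'; split=> //; exists a.
apply: extM => z; split=> hz.
  have zt := tt u ut z hz; have [zt' [b [zb zb']]] := NNPP _ (IH z hz zt).
  have : opair b a ε r by apply/rh; exists z, u, b, a; split=> //; left.
  move=> /rk [z1 [u2 [b1 [a1 [z1t u2t m [kz ku /opair_inj [E1 E2]]]]]]]; subst b1 a1.
  have E1 := (k2 _ _ _ _ zt' z1t zb' kz).2 erefl.
  have E2 := (k2 _ _ _ _ u't' u2t k1' ku).2 erefl.
  subst z1 u2; case: m => // E; subst u'.
  have E := (h2 _ _ _ _ zt ut zb ua).2 ((k2 _ _ _ _ zt' zt' zb' k1').1 erefl).
  by subst z; case: (mem_irr hz).
have zt' := tt' u' u't' z hz; have [b [by_ zb']] := k1 z zt'.
have : opair b a ε r by apply/rk; exists z, u', b, a; split=> //; left.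
move=> /rh [z1 [u2 [b1 [a1 [z1t u2t m [hz1 hu /opair_inj [E1 E2]]]]]]]; subst b1 a1.
have E2 := (h2 _ _ _ _ ut u2t ua hu).2 erefl; subst u2.
case: m => [z1u|E]; last first.
  subst z1; have E := (h2 _ _ _ _ ut ut hz1 ua).1 erefl; subst b.
  have E := (k2 _ _ _ _ zt' u't' zb' k1').2 erefl.
  by subst z; case: (mem_irr hz).
have [z1t' [b2 [hb2 kb2]]] := NNPP _ (IH z1 z1u z1t).
have E := (h2 _ _ _ _ z1t z1t hb2 hz1).1 erefl; subst b2.
by have E := (k2 _ _ _ _ z1t' zt' kb2 zb').2 erefl; subst z1.
Qed.

Lemma rigid h k t t' y r : transitive_set t -> transitive_set t' ->
  injn h t y -> injn k t' y -> traces h t r -> traces k t' r -> t = t'.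
Proof.
move=> tt tt' hi ki rh rk; apply: extM => u; split=> hu.
  by case: (rigid_half tt tt' hi ki rh rk hu).
by case: (rigid_half tt' tt ki hi rk rh hu).
Qed.

(** If all ordinals injected into [y], each would be recovered from its trace, a subset of the
    square of [y], by [rigid]. Replacement would then make the class of all ordinals a set. *)
Lemma hartogs y : exists b, ord b /\ ~ le b y.
Proof.
apply: NNPP => n0.
have all b : ord b -> le b y by move=> ob; apply: NNPP => nb; apply: n0; exists b.
pose Q r b := ord b /\ exists h, injn h b y /\ traces h b r.
have [||O hO] := @repl_ex M Q (pw (cart y y)).
- by rewrite /Q /traces; dfn.
- move=> r b b' _ [ob [h [ih th]]] [ob' [h' [ih' th']]].
  by apply: (rigid _ _ ih ih' th th'); [case: ob|case: ob'].
have OE b : b ε O <-> ord b.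
  split=> [/hO [r _ []]|ob] //; have [h ih] := all b ob.
  have [r [tr ry]] := traces_ex ih; apply/hO; exists r; first by apply/mem_pw.
  by split=> //; exists h.
have oO : ord O.
  split=> [b /OE ob c cb|b /OE []] //; apply/OE; exact: ord_mem ob cb.
by apply: (@mem_irr M O); apply/OE.
Qed.

End Rigidity.

(** * The cut *)

Ltac dfn0_step :=
  cbv beta;
  lazymatch goal with
  | |- btm _ (fun _ => ?t) => apply: btm_cst; assumption
  | |- btm _ (fun e => e _) => apply: btm_var
  | |- Dfn _ _ (fun e => _ /\ _) => apply: (Dfn_and fclass_delta0)
  | |- Dfn _ _ (fun e => _ \/ _) => apply: (Dfn_or fclass_delta0)
  | |- Dfn _ _ (fun e => exists x, srel _ _ /\ _) => apply: (Dfn_bex fclass_delta0)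
  | |- Dfn _ _ (fun e => forall x, srel _ _ -> _) => apply: (Dfn_ball fclass_delta0)
  | |- Dfn _ _ (fun e => _ -> _) => apply: (Dfn_imp fclass_delta0)
  | |- Dfn _ _ (fun e => srel _ _) => apply: (Dfn_bmem fclass_delta0)
  | |- Dfn _ _ (fun e => @eq _ _ _) => apply: (Dfn_beq fclass_delta0)
  end.

Section Cut.

Variables (M : zmodel) (I : M -> Prop).
Hypothesis HI : H_cut I.
Implicit Types (a b c x y z w r s t u v g p q h k E L K : M) (C : M -> Prop).
Local Notation any := (@anyc M).
Local Notation sI := (substr I).

Let most : models_MOST sI. Proof. by case: HI. Qed.

Lemma I_end x y : I y -> x ε y -> I x.
Proof. by case: HI => [[h _] _ _]; apply: h. Qed.

Lemma I_sub x y : I y -> subset x y -> I x.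
Proof. by case: HI => [[_ h] _ _]; apply: h. Qed.

Lemma sI_eq (x y : sI) : proj1_sig x = proj1_sig y -> x = y.
Proof.
case: x y => [x hx] [y hy] /= E; subst y; congr exist.
exact: proof_irrelevance.
Qed.

Lemma I_pr a b : I a -> I b -> I (pr a b).
Proof.
move=> ha hb; have [[s hs] h] := MOST_pairing most (exist I a ha) (exist I b hb).
suff -> : pr a b = s by [].
apply: extM => z; rewrite mem_pr; split=> [[->|->]|zs].
- by apply/(h (exist I a ha)); left.
- by apply/(h (exist I b hb)); right.
- by case/(h (exist I z (I_end hs zs))): (zs) => [[->]|[->]]; auto.
Qed.

Lemma I_un a : I a -> I (un a).
Proof.
move=> ha; have [[s hs] h] := MOST_union most (exist I a ha).
suff -> : un a = s by [].
apply: extM => z; rewrite mem_un; split=> [[y [ya zy]]|zs].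
  have hy := I_end ha ya.
  by apply/(h (exist I z (I_end hy zy))); exists (exist I y hy).
by case/(h (exist I z (I_end hs zs))): (zs) => -[y hy] /= ya zy; exists y.
Qed.

Lemma I_pw a : I a -> I (pw a).
Proof.
move=> ha; have [[s hs] h] := MOST_powerset most (exist I a ha).
suff -> : pw a = s by [].
apply: extM => z; rewrite mem_pw; split=> [za|zs].
  by apply/(h (exist I z (I_sub ha za))) => -[w hw] /=; apply: za.
move=> w wz; have hz := I_end hs zs.
move: (zs) => /(h (exist I z hz)) /(_ (exist I w (I_end hz wz))); exact.
Qed.

Lemma I_emp : I emp.
Proof. by case: (MOST_emptyset most) => -[x hx] _; apply: I_sub hx _ => z /mem_emp. Qed.

Lemma I_cup a b : I a -> I b -> I (cup a b).
Proof. by move=> ha hb; apply: I_un; apply: I_pr. Qed.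

Lemma I_adj a b : I a -> I b -> I (adj a b).
Proof. by move=> ha hb; apply: I_cup => //; apply: I_pr. Qed.

Lemma I_opair a b : I a -> I b -> I (opair a b).
Proof. by move=> ha hb; do 2 apply: I_pr => //. Qed.

Lemma I_cart a b : I a -> I b -> I (cart a b).
Proof.
move=> ha hb; apply: (@I_sub _ (pw (pw (cup a b)))).
  by do 2 apply: I_pw; apply: I_cup.
by move=> z /mem_cart [x [y [xa yb ->]]]; apply: opair_mem.
Qed.

Lemma I_inductive : exists W, [/\ I W, emp ε W & forall n, n ε W -> adj n n ε W].
Proof.
have [[W hW] [[[e he] e0 eW] hS]] := MOST_infinity most.
exists W; split=> //.
  suff -> : emp = e by [].
  apply: extM => z; split=> [/mem_emp//|ze].
  by case: (e0 (exist I z (I_end he ze))).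
move=> n nW; have hn := I_end hW nW.
have [[s hs] h sW] := hS (exist I n hn) nW.
suff -> : adj n n = s by [].
apply: extM => z; rewrite mem_adj; split=> [[zn|->]|zs].
- by apply/(h (exist I z (I_end hn zn))); left.
- by apply/(h (exist I n hn)); right.
- by case/(h (exist I z (I_end hs zs))): (zs) => [|[->]]; auto.
Qed.

Lemma delta0_abs (phi : form) : delta0 phi ->
  forall e : nat -> sI, sat e phi <-> sat (fun i => proj1_sig (e i)) phi.
Proof.
elim=> [i j|i j|p _ IH|p q _ IHp _ IHq|j p _ IH] e //=.
- by split=> [->//|]; apply: sI_eq.
- by rewrite IH.
- by rewrite IHp IHq.
- split=> [[x [xj /IH hx]]|[x [xj hx]]].
    exists (proj1_sig x); split=> //.
    by apply: (sat_eqfun hx) => -[].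
  have Ix : I x by apply: I_end xj; case: (e j).
  exists (exist I x Ix); split=> //; apply/IH.
  by apply: (sat_eqfun hx) => -[].
Qed.

Section Delta0.

Variable F : M -> M -> Prop.
Hypothesis dF : Dfn delta0 I (fun e => F (e 0) (e 1)).

Lemma delta0_formula : exists phi (e : nat -> sI), delta0 phi /\
  forall g q : sI, F (proj1_sig g) (proj1_sig q) <-> sat (scons g (scons q e)) phi.
Proof.
have [phi [f [h1 h2 h3]]] := dF.
have c : sI := exist I emp I_emp.
pose r i := match f i with inl 0 => 0 | inl _ => 1 | inr _ => i.+2 end.
have hc i : exists m : sI, forall m', f i = inr m' -> proj1_sig m = m'.
  case E: (f i) => [j|m]; first by exists c.
  by exists (exist I m (h2 _ _ E)) => m' [<-].
pose e i := proj1_sig (constructive_indefinite_description _ (hc i)).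
exists (ren r phi), e; split=> [|g q]; first exact: delta0_ren.
rewrite delta0_abs; last exact: delta0_ren.
rewrite sat_ren (h3 (scons (proj1_sig g) (fun=> proj1_sig q))).
apply: sat_ext => i; rewrite /asg /r.
case Ei: (f i) => [[|j]|m] //=; rewrite /e.
by case: constructive_indefinite_description => m' /= /(_ m Ei) ->.
Qed.

Lemma sigma1_sepM a : I a -> exists B, I B /\
  forall q, q ε B <-> q ε a /\ exists g, I g /\ F g q.
Proof.
have [phi [e [dphi hphi]]] := delta0_formula; move=> ha.
have [|[B hB] h] := MOST_sigma1_separation most (phi := fEx phi) _ e (exist I a ha).
  by apply: sigma1_ex; apply: sigma1_delta0.
exists B; split=> // q; split=> [qB|[qa [g [hg gq]]]].
  case/(h (exist I q (I_end hB qB))): (qB) => /= qa [[g hg] /hphi gq].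
  by split=> //; exists g.
apply/(h (exist I q (I_end ha qa))); split=> //=.
by exists (exist I g hg); apply/hphi.
Qed.

Lemma delta0_collM a : I a -> (forall q, q ε a -> exists g, I g /\ F g q) ->
  exists c, I c /\ forall q, q ε a -> exists g, g ε c /\ F g q.
Proof.
have [phi [e [dphi hphi]]] := delta0_formula; move=> ha hF.
have [|[c hc] h] := MOST_delta0_collection most dphi (e := e) (a := exist I a ha).
  move=> [q hq] /= qa; have [g [hg gq]] := hF q qa.
  by exists (exist I g hg); apply/hphi.
exists c; split=> // q qa.
have [[g hg] gc /hphi gq] := h (exist I q (I_end ha qa)) qa.
by exists g.
Qed.

End Delta0.

(** The pair is described with bounded quantifiers only, in the shape that [dfn0_step] recognises,
    because it must become a $\Delta_0$ formula. *)
Definition opD p a u : Prop := exists x, x ε p /\ exists z, z ε p /\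
  ((a ε x /\ forall w, w ε x -> w = a) /\
   ((a ε z /\ (u ε z /\ forall w, w ε z -> w = a \/ w = u)) /\
    forall w, w ε p -> w = x \/ w = z)).

Lemma opDE p a u : opD p a u <-> p = opair a u.
Proof.
split=> [[x [xp [z [zp [[ax hx] [[az [uz hz]] hp]]]]]]|->].
  have Ex : x = pr a a.
    by apply: extM => w; rewrite mem_pr; split=> [/hx ->|[->|->]]; auto.
  have Ez : z = pr a u.
    by apply: extM => w; rewrite mem_pr; split=> [/hz|[->|->]].
  apply: extM => w; rewrite mem_pr -Ex -Ez; split=> [/hp|[->|->]] //.
exists (pr a a); split; first by apply/mem_pr; left.
exists (pr a u); split; first by apply/mem_pr; right.
split; [split|split; [split; [|split]|]].
- by apply/mem_pr; left.
- by move=> w /mem_pr [].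
- by apply/mem_pr; left.
- by apply/mem_pr; right.
- by move=> w /mem_pr.
- by move=> w /mem_pr.
Qed.

Definition inD a u g : Prop := exists p, p ε g /\ opD p a u.

Lemma inDE a u g : inD a u g <-> opair a u ε g.
Proof.
by split=> [[p [pg /opDE <-]]|h] //; exists (opair a u); split=> //; apply/opDE.
Qed.

(* g is a partial collapsing map of the relation E on y, defined at b *)
Definition collD y E b g : Prop :=
  (forall p, p ε g -> forall z, z ε p -> forall u, u ε z -> forall a, a ε y ->
     opD p a u ->
     (forall a', a' ε y -> inD a' a E -> exists u', u' ε u /\ inD a' u' g) /\
     (forall u', u' ε u -> exists a', a' ε y /\ (inD a' a E /\ inD a' u' g))) /\
  exists p, p ε g /\ exists z, z ε p /\ exists u, u ε z /\ opD p b u.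

Definition coll y E g : Prop := forall a u, a ε y -> opair a u ε g ->
  (forall a', a' ε y -> opair a' a ε E -> exists u', u' ε u /\ opair a' u' ε g) /\
  (forall u', u' ε u -> exists a', [/\ a' ε y, opair a' a ε E & opair a' u' ε g]).

Lemma collDE y E b g : collD y E b g <-> coll y E g /\ exists u, opair b u ε g.
Proof.
split=> -[h k]; split.
- move=> a u ay aug.
  have [|||h1 h2] := h (opair a u) aug (pr a u) _ u _ a ay.
  + by apply/mem_pr; right.
  + by apply/mem_pr; right.
  + by apply/opDE.
  split=> [a' a'y /inDE a'E|u' /h2 [a' [a'y [/inDE m1 /inDE m2]]]]; last by exists a'.
  by have [u' [u'u /inDE]] := h1 a' a'y a'E; exists u'.
- by case: k => p [pg [z [_ [u [_ /opDE E']]]]]; exists u; rewrite -E'.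
- move=> p pg z _ u _ a ay /opDE E'; subst p.
  have [h1 h2] := h a u ay pg.
  split=> [a' a'y /inDE a'E|u' /h2 [a' [a'y ? ?]]].
    by have [u' [u'u ?]] := h1 a' a'y a'E; exists u'; split=> //; apply/inDE.
  by exists a'; split=> //; split; apply/inDE.
- case: k => u ug; exists (opair b u); split=> //; exists (pr b u).
  split; first by apply/mem_pr; right.
  by exists u; split; [apply/mem_pr; right|apply/opDE].
Qed.

(** Relation and point are packed into one [q], so that separation in [I] can cut out all good
    combinations from a single set. *)
Definition collP y g q : Prop := exists z, z ε q /\
  exists E, E ε z /\ exists b, b ε z /\ (opD q E b /\ collD y E b g).

Lemma collPE y E b g :
  collP y g (opair E b) <-> coll y E g /\ exists u, opair b u ε g.
Proof.
rewrite -collDE; split=> [[z [_ [E' [_ [b' [_ [/opDE /opair_inj [-> ->]]]]]]]]|h] //.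
exists (pr E b); split; first by apply/mem_pr; right.
exists E; split; first by apply/mem_pr; left.
by exists b; split; [apply/mem_pr; right|split=> //; apply/opDE].
Qed.

Lemma collP_delta0 y : I y -> Dfn delta0 I (fun e => collP y (e 0) (e 1)).
Proof. by move=> hy; rewrite /collP /collD /inD /opD; repeat dfn0_step. Qed.

(** Here [t] and [h] are arbitrary in the model, but the image [E] of membership on [t] is a
    relation on [y], hence in [I]. Separation gives the set [Q] of pairs of a relation and a point
    at which some partial collapsing map from [I] is defined; collection bounds such maps by one
    [c]. Membership induction on [t] then shows that every point of [t] is a value of a map in
    [c]. *)
Lemma mostowski y : I y -> exists K, I K /\
  forall t h, transitive_set t -> injn h t y -> subset t K.
Proof.
move=> hy; have dC := collP_delta0 hy.
pose S := cart (pw (cart y y)) y.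
have hS : I S by apply: I_cart => //; apply: I_pw; apply: I_cart.
have [Q [hQ QE]] := sigma1_sepM dC hS.
have [|c [hc cE]] := delta0_collM dC hQ; first by move=> q /QE [].
(* Three unions lead from the maps to their pairs, to the members of the pairs, and to the
   coordinates. *)
exists (un (un (un c))); split; first by do 3 apply: I_un.
move=> t h tt [h1 h2].
have hfun : forall w a a', w ε t -> opair w a ε h -> opair w a' ε h -> a = a'.
  by move=> w a a' wt ha ha'; apply/(h2 _ _ _ _ wt wt ha ha').
have hinj : forall w w' a, w ε t -> w' ε t -> opair w a ε h -> opair w' a ε h -> w = w'.
  by move=> w w' a wt w't ha ha'; apply/(h2 _ _ _ _ wt w't ha ha').
have hran : forall w a, w ε t -> opair w a ε h -> a ε y.
  by move=> w a wt ha; have [a' [a'y ha']] := h1 w wt; rewrite (hfun w a a').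
have [|E HE] := @sep_ex M (fun p => exists v u a b, [/\ v ε t, u ε t, v ε u
   & [/\ opair v a ε h, opair u b ε h & p = opair a b]]) (cart y y).
  by dfn.
have EE : forall v u a b, v ε t -> u ε t -> opair v a ε h -> opair u b ε h ->
    (opair a b ε E <-> v ε u).
  move=> v u a b vt ut va ub; rewrite HE; split=> [[_ [v' [u' [a' [b' [v't u't vu]]]]]]|vu].
    move=> [va' ub' /opair_inj [Ea Eb]]; subst a' b'.
    by rewrite (hinj v v' a) // (hinj u u' b).
  split; first by apply/mem_cart_pair; split; [apply: hran va|apply: hran ub].
  by exists v, u, a, b.
have Eh : forall a u b, u ε t -> opair u b ε h -> opair a b ε E ->
    exists v, [/\ v ε u, v ε t & opair v a ε h].
  move=> a u b ut ub /HE [_ [v [u' [a' [b' [vt u't vu [va ub' /opair_inj [Ea Eb]]]]]]]].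
  by subst a' b'; exists v; rewrite (hinj u u' b).
have uniq : forall g, coll y E g -> forall w, w ε t -> forall a u,
    opair w a ε h -> opair a u ε g -> u = w.
  move=> g cg w wt; apply: NNPP => n0.
  have [||{n0 wt}w [wt nw IH]] := @foundationM M
    (fun w => ~ forall a u, opair w a ε h -> opair a u ε g -> u = w) t.
  - by dfn.
  - by exists w.
  apply: nw => a u wa au; have [k1 k2] := cg a u (hran _ _ wt wa) au.
  apply: extM => z; split=> [zu|zw].
    have [a' [a'y a'E a'z]] := k2 z zu; have [v [vw vt va']] := Eh _ _ _ wt wa a'E.
    by rewrite (NNPP _ (IH v vw vt) a' z).
  have zt := tt w wt z zw; have [b [b_y zb]] := h1 z zt.
  have [|u' [u'u bu']] := k1 b b_y; first by apply/(EE z w).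
  by rewrite -(NNPP _ (IH z zw zt) b u').
have inQ : forall w a, w ε t -> opair w a ε h -> opair E a ε Q.
  move=> w a wt wa; apply: NNPP => n0.
  have [||{n0 wt wa a}w [wt [a [wa nQ]] IH]] := @foundationM M
    (fun w => exists a, opair w a ε h /\ ~ opair E a ε Q) t.
  - by dfn.
  - by exists w; split=> //; exists a.
  (* All collected maps for [E] are glued; by [uniq] they invert [h] on [t]. The glued map is in [I]
     as a subset of a union, and then so is [w], whose members are all values of it. Adding the pair
     for [w] gives a collapsing map in [I] defined there. *)
  have [|G HG] := @sep_ex M (fun p => exists g, [/\ g ε c, coll y E g & p ε g]) (un c).
    by rewrite /coll; dfn.
  have sub_G : forall g, g ε c -> coll y E g -> subset g G.
    move=> g gc cg p pg; apply/HG; split; last by exists g.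
    by apply/mem_un; exists g.
  have inG : forall w' a', w' ε w -> opair w' a' ε h -> opair a' w' ε G.
    move=> w' a' w'w w'a'; have w't := tt w wt w' w'w.
    have q : opair E a' ε Q.
      by apply: NNPP => nq; apply: (IH w' w'w w't); exists a'.
    have [g [gc /collPE [cg [u au]]]] := cE _ q.
    by have E1 := uniq g cg w' w't a' u w'a' au; subst u; apply: (sub_G g).
  have hG : I G by apply: (I_sub (I_un hc)) => p /HG [].
  have hw : I w.
    apply: (@I_sub _ (un (un G))); first by do 2 apply: I_un.
    move=> w' w'w; have [a' [_ w'a']] := h1 w' (tt w wt w' w'w).
    by case: (mem_un_opair (inG w' a' w'w w'a')).
  have ay := hran w a wt wa.
  apply: nQ; apply/QE; split.
    apply/mem_cart_pair; split=> //; apply/mem_pw => p /HE [] //.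
  exists (adj G (opair a w)); split; first by apply: I_adj => //; apply: I_opair => //; apply: I_end ay.
  apply/collPE; split; last by exists w; apply/mem_adj; right.
  move=> a1 u a1y /mem_adj [/HG [_ [g [gc cg a1u]]]|/opair_inj [E1 E2]].
    have [k1 k2] := cg a1 u a1y a1u; split=> [a' a'y a'E|u' u'u].
      have [u' [u'u a'u']] := k1 a' a'y a'E; exists u'; split=> //.
      by apply/mem_adj; left; apply: (sub_G g).
    have [a' [a'y a'E a'u']] := k2 u' u'u; exists a'; split=> //.
    by apply/mem_adj; left; apply: (sub_G g).
  subst a1 u; split=> [a' a'y a'E|u' u'w].
    have [v [vw vt va']] := Eh _ _ _ wt wa a'E; exists v; split=> //.
    by apply/mem_adj; left; apply: inG.
  have u't := tt w wt u' u'w; have [a' [a'y u'a']] := h1 u' u't.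
  exists a'; split=> //; first by apply/(EE u' w).
  by apply/mem_adj; left; apply: inG.
move=> w wt; have [a [ay wa]] := h1 w wt.
have [g [gc /collPE [cg [u au]]]] := cE _ (inQ w a wt wa).
have E' := uniq g cg w wt a u wa au; subst u.
have [_] := mem_un_opair au; move=> /mem_un [z [/mem_un [p [pg zp]] wz]].
apply/mem_un; exists z; split=> //; apply/mem_un; exists p; split=> //.
by apply/mem_un; exists g.
Qed.

Lemma I_le t y : transitive_set t -> I y -> le t y -> I t.
Proof.
move=> tt /mostowski [K [hK h]] [k ik]; exact: I_sub hK (h t k tt ik).
Qed.

Lemma I_trans_containment x : I x -> exists t, [/\ I t, transitive_set t & x ε t].
Proof.
move=> hx; have hs : I (pr x x) by apply: I_pr.
have [[t ht] tt sub] := MOST_transitive_containment most (exist I _ hs).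
exists t; split=> //.
  move=> y yt z zy; have hy := I_end ht yt.
  exact: (tt (exist I y hy) yt (exist I z (I_end hy zy)) zy).
by apply: (sub (exist I x hx)) => /=; apply/mem_pr; left.
Qed.

(** Take an ordinal that does not inject into a transitive [t] not in [I]. Then [t] injects into it,
    so its being in [I] would put [t] into [I]. *)
Lemma ord_outside : exists b, ord b /\ ~ I b.
Proof.
have [x nx] : exists x, ~ I x by case: HI => _ [].
have [t [tt xt]] := TC_sup x; have [b [ob nb]] := hartogs t.
exists b; split=> // hb; apply: nx; apply: I_end xt.
by case: (le_total b t) => // h; apply: I_le h.
Qed.

Lemma ord_Ord_in x : ord x -> I x -> Ord_in I x.
Proof.
move=> ox hx; exists hx; have [tx [w1 w2 w3 w4]] := ord_is_ordinal ox.
split.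
  by move=> [y hy] /= yx [z hz] /=; apply: tx.
split.
- by move=> [a ha] /=; apply: w1.
- by move=> [a ha] [b hb] [c hc] /=; apply: w2.
- move=> [a ha] [b hb] /= ax bx; case: (w3 a b ax bx) => h.
  + by constructor 1.
  + by constructor 2; apply: sI_eq.
  + by constructor 3.
- move=> [s hs] /= sx [[z hz] /= zs].
  have [||m ms hm] := w4 s; last first.
  + exists (exist I m (I_end hs ms)) => // -[y hy] /= ys.
    by case: (hm y ys) => [Ey|]; [left; apply: sI_eq|right].
  + by exists z.
  + by move=> y ys; apply: (sx (exist I y (I_end hs ys))).
Qed.

(** Otherwise the ordinals of [I] would be exactly the ordinals satisfying [P] below some ordinal
    outside [I]. They would form an internal set, in [I] by toplessness, and this set would be an
    ordinal belonging to itself. *)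
Lemma overspill (P : M -> Prop) : Df1 any P -> (forall a, ord a -> I a -> P a) ->
  exists a, [/\ ord a, ~ I a & P a].
Proof.
move=> dP hP; apply: NNPP => n0; have [b [ob nb]] := ord_outside.
have [|O HO] := @sep_ex M (fun a => ord a /\ P a) b; first by dfn.
have OI : forall a, a ε O -> ord a /\ I a.
  move=> a /HO [_ [oa pa]]; split=> //.
  by apply: NNPP => na; apply: n0; exists a.
have hO : I O.
  by case: HI => _ [_ _ h] _; apply: h => a /OI [oa ha]; apply: ord_Ord_in.
have Oall : forall a, ord a -> I a -> a ε O.
  move=> a oa ha; apply/HO; split; last by split=> //; apply: hP.
  by case: (ord_total oa ob) => // [E|h]; [subst b|case: nb; apply: I_end h].
have oO : ord O.
  split=> a /OI [oa ha]; last by case: oa.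
  by move=> c ca; apply: Oall; [apply: ord_mem ca|apply: I_end ca].
by apply: (@mem_irr M O); apply: Oall.
Qed.

(** Hereditary size takes the role of rank: by [mostowski] the sets of hereditary size at most [a]
    form an element of [I] whenever [a] is in [I]. *)
Definition hset x a : Prop := exists t, [/\ transitive_set t, x ε t & le t a].

Lemma hset_trans x y a : hset y a -> x ε y -> hset x a.
Proof. by move=> [t [tt yt ta]] xy; exists t; split=> //; apply: (tt y). Qed.

Definition wide K : Prop := forall x, I x -> x ε K.

Lemma hset_wide a x : transitive_set a -> ~ I a -> I x -> hset x a.
Proof.
move=> ta na /I_trans_containment [t [ht tt xt]]; exists t; split=> //.
by case: (le_total t a) => // h; case: na; apply: I_le h.
Qed.

Lemma hset_inside a : I a -> exists L, I L /\ forall x, x ε L <-> hset x a.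
Proof.
move=> ha; have [K [hK h]] := mostowski ha.
have [|L HL] := @sep_ex M (fun x => hset x a) K; first by rewrite /hset; dfn.
exists L; split; first by apply: (I_sub hK) => x /HL [].
move=> x; rewrite HL; split=> [[]|hx] //; split=> //.
by case: hx => t [tt xt [k ik]]; apply: (h t k).
Qed.

(** For [a] in [I], the set of all [x] of hereditary size at most [a] has all its subsets in [I],
    hence in [K] and [K']. This spills over to an ordinal outside [I], where that set is wide. *)
Lemma wide_below K K' : wide K -> wide K' -> exists L,
  [/\ wide L, transitive_set L & forall s, subset s L -> s ε K /\ s ε K'].
Proof.
move=> wK wK'.
have [||a [oa na [L [HL LK]]]] := @overspill (fun a => exists L,
  (forall x, x ε L <-> hset x a) /\ forall s, subset s L -> s ε K /\ s ε K').
- by rewrite /hset; dfn.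
- move=> a _ /hset_inside [L [hL HL]]; exists L; split=> // s sL.
  by have hs := I_sub hL sL; split; [apply: wK|apply: wK'].
exists L; split=> // [x hx|y /HL hy x xy]; apply/HL; last exact: hset_trans xy.
by apply: hset_wide => //; case: oa.
Qed.

(** An element of [I] injects into [B], since otherwise [B] would inject into it and fall into [I]
    together with [x]. Overspill again passes to a wide set. *)
Lemma wide_le B x : transitive_set B -> x ε B -> ~ I x -> exists L,
  [/\ wide L, transitive_set L & le L B].
Proof.
move=> tB xB nx.
have [||a [oa na [L [HL LB]]]] := @overspill (fun a => exists L,
  (forall x, x ε L <-> hset x a) /\ le L B).
- by rewrite /hset; dfn.
- move=> a _ /hset_inside [L [hL HL]]; exists L; split=> //.
  case: (le_total L B) => // h; case: nx; apply: I_end xB.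
  exact: I_le h.
exists L; split=> // [y hy|y /HL hy z zy]; apply/HL; last exact: hset_trans zy.
by apply: hset_wide => //; case: oa.
Qed.

End Cut.

(** * Recursive saturation *)

Section RecursiveFunctions.

Implicit Types (n m : nat).

Lemma recursive_ext n (f g : n.-tuple nat -> nat) : f =1 g -> recursive f -> recursive g.
Proof. by move=> /functional_extensionality ->. Qed.

Definition rec1 (f : nat -> nat) : Prop :=
  recursive (fun v : 1.-tuple nat => f (tnth v ord0)).
Definition rec2 (f : nat -> nat -> nat) : Prop :=
  recursive (fun v : 2.-tuple nat => f (tnth v ord0) (tnth v (lift ord0 ord0))).

Lemma recursive_comp1 n (f : nat -> nat) (h : n.-tuple nat -> nat) :
  rec1 f -> recursive h -> recursive (fun v => f (h v)).
Proof.
move=> rf rh; apply: (recursive_ext _ (rec_comp (h := fun=> h) rf (fun=> rh))).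
by move=> v; rewrite tnth_mktuple.
Qed.

Lemma recursive_comp2 n (f : nat -> nat -> nat) (h k : n.-tuple nat -> nat) :
  rec2 f -> recursive h -> recursive k -> recursive (fun v => f (h v) (k v)).
Proof.
move=> rf rh rk; pose w (i : 'I_2) := if i == ord0 then h else k.
have rw i : recursive (w i) by rewrite /w; case: ifP.
apply: (recursive_ext _ (rec_comp rf rw)) => v.
by rewrite !tnth_mktuple.
Qed.

Lemma recursive_succ n (h : n.-tuple nat -> nat) : recursive h -> recursive (fun v => (h v).+1).
Proof. by move=> rh; apply: (recursive_comp1 (f := S)) => //; exact: rec_succ. Qed.

Lemma recursive_const n (c : nat) : recursive (fun _ : n.-tuple nat => c).
Proof. by elim: c => [|c IH]; [apply: rec_zero|apply: recursive_succ]. Qed.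

Lemma rec1_prim (f : nat -> nat) (h : nat -> nat -> nat) :
  rec2 h -> (forall k, f k.+1 = h k (f k)) -> rec1 f.
Proof.
move=> rh E; have r0 := @recursive_const 0 (f 0).
apply: (recursive_ext _ (rec_prim r0 rh)) => v.
rewrite (_ : thead v = tnth v ord0) //; elim: (tnth v ord0) => //= k IH.
by rewrite E -IH /tnth.
Qed.

Lemma rec2_prim (f : nat -> nat -> nat) (g : nat -> nat) (h : 3.-tuple nat -> nat) :
  rec1 g -> recursive h -> (forall x, f 0 x = g x) ->
  (forall k x, f k.+1 x = h [tuple k; f k x; x]) -> rec2 f.
Proof.
move=> rg rh E0 ES; apply: (recursive_ext _ (rec_prim rg rh)) => v.
case: v => -[|a [|b []]] // hv; rewrite /thead /tnth /=.
suff : forall n, nat_rect (fun=> nat) (g b)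
  (fun k r => h [tuple of k :: r :: behead (Tuple hv)]) n = f n b by apply.
elim=> [|k IH] /=; first by rewrite E0.
by rewrite ES -IH; congr h; apply: val_inj.
Qed.

Definition p30 : 'I_3 := ord0.
Definition p31 : 'I_3 := lift ord0 ord0.
Definition p32 : 'I_3 := lift ord0 (lift ord0 ord0).

Lemma rec1_id : rec1 id. Proof. exact: rec_proj. Qed.

Lemma rec2_add : rec2 addn.
Proof.
apply: (rec2_prim (g := id) (h := fun v => (tnth v p31).+1)) => //; first exact: rec1_id.
by apply: recursive_succ; apply: rec_proj.
Qed.

Lemma rec2_mul : rec2 muln.
Proof.
apply: (rec2_prim (g := fun=> 0) (h := fun v => tnth v p32 + tnth v p31)) => //.
- exact: recursive_const.
- by apply: (recursive_comp2 rec2_add); apply: rec_proj.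
Qed.

Lemma rec1_pred : rec1 predn.
Proof. by apply: (rec1_prim (h := fun k _ => k)) => //; apply: rec_proj. Qed.

Lemma rec2_rsub : rec2 (fun k x => x - k).
Proof.
apply: (rec2_prim (g := id) (h := fun v => (tnth v p31).-1)).
- exact: rec1_id.
- by apply: (recursive_comp1 rec1_pred); apply: rec_proj.
- by move=> x; rewrite subn0.
- by move=> k x; rewrite subnS.
Qed.

Lemma recursive_sub n (h k : n.-tuple nat -> nat) :
  recursive h -> recursive k -> recursive (fun v => h v - k v).
Proof. by move=> rh rk; apply: (recursive_comp2 rec2_rsub rk rh). Qed.

Lemma recursive_add n (h k : n.-tuple nat -> nat) :
  recursive h -> recursive k -> recursive (fun v => h v + k v).
Proof. exact: (recursive_comp2 rec2_add). Qed.

Lemma recursive_mul n (h k : n.-tuple nat -> nat) :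
  recursive h -> recursive k -> recursive (fun v => h v * k v).
Proof. exact: (recursive_comp2 rec2_mul). Qed.

Lemma rec1_odd : rec1 odd.
Proof.
apply: (rec1_prim (h := fun _ r => 1 - r)); last by move=> k /=; case: (odd k).
by apply: recursive_sub; [apply: recursive_const|apply: rec_proj].
Qed.

Lemma rec1_half : rec1 half.
Proof.
apply: (rec1_prim (h := fun k r => odd k + r)); last by move=> k; rewrite /= uphalf_half.
by apply: recursive_add; [apply: (recursive_comp1 rec1_odd)|]; apply: rec_proj.
Qed.

Lemma recursive_cpair n (h k : n.-tuple nat -> nat) :
  recursive h -> recursive k -> recursive (fun v => cpair (h v) (k v)).
Proof.
move=> rh rk; rewrite /cpair; apply: recursive_add => //.
apply: (recursive_comp1 rec1_half); apply: recursive_mul.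
  exact: recursive_add.
by apply: recursive_succ; apply: recursive_add.
Qed.

Lemma rec2_iter (h : nat -> nat) : rec1 h -> rec2 (fun n x => iter n h x).
Proof.
move=> rh; apply: (rec2_prim (g := id) (h := fun v => h (tnth v p31))) => //.
  exact: rec1_id.
by apply: (recursive_comp1 rh); apply: rec_proj.
Qed.

(** Since [g <= G g], membership of [k] is decided by comparing it with [G 0], ..., [G k], a bounded
    search. Equality and disjunction are expressed by truncated subtraction. *)
Lemma recursive_range (G : nat -> nat) : rec1 G -> (forall g, g <= G g) ->
  recursive_set (fun k => exists g, G g = k).
Proof.
move=> rG leG; pose eqf x y := 1 - ((x - y) + (y - x)).
have eqfE x y : eqf x y = (x == y).
  by rewrite /eqf; case: eqP => [->|]; lia.
pose s b k := nat_rect (fun=> nat) 0 (fun g r => 1 - (1 - (r + eqf (G g) k))) b.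
have sE b k : s b k = has (fun g => G g == k) (iota 0 b).
  elim: b => // b IH; rewrite -addn1 iotaD has_cat /= orbF addn1 /= IH eqfE.
  by case: (has _ _); case: (_ == _).
have rs : rec2 s.
  apply: (rec2_prim (g := fun=> 0)
    (h := fun v => 1 - (1 - (tnth v p31 + eqf (G (tnth v p30)) (tnth v p32))))) => //.
    exact: recursive_const.
  rewrite /eqf; do !(apply: recursive_sub || apply: recursive_add || apply: recursive_const
    || apply: (recursive_comp1 rG) || apply: rec_proj).
exists (fun v => s (tnth v ord0).+1 (tnth v ord0)).
  apply: (recursive_comp2 rs); last exact: rec_proj.
  by apply: recursive_succ; apply: rec_proj.
move=> k; rewrite sE [tnth _ _]/=; case: hasP => [[g _ /eqP E]|n].
  by left; split=> //; exists g.
right; split=> // -[g E]; apply: n; exists g; last by apply/eqP.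
by rewrite mem_iota /= add0n ltnS -E.
Qed.

End RecursiveFunctions.

(** * Codes of formulas and reduction to one free variable *)

Section GodelNumbers.

Lemma cpair_surj k : exists x y, cpair x y = k.
Proof.
elim: k => [|k [x [y E]]]; first by exists 0, 0.
case: x E => [|x] E.
  exists y.+1, 0; rewrite -E /cpair !add0n !addn0.
  have -> : y.+1 * y.+2 = y * y.+1 + y.+1.*2 by lia.
  by rewrite halfD odd_double andbF doubleK; lia.
by exists x, y.+1; rewrite -E /cpair addSnnS; lia.
Qed.

Lemma leq_cpair x y : x <= cpair x y /\ y <= cpair x y.
Proof.
rewrite /cpair; split; last by rewrite leq_addl.
apply: leq_trans (leq_addr _ _); case: (posnP x) => [->|x0] //.
have h : x.*2 <= (x + y) * (x + y).+1 by nia.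
by have := half_leq h; rewrite doubleK.
Qed.

(** Every number is a code, so the range of a recursive function over all numbers is the set of
    codes of the intended family of formulas. *)
Lemma godel_surj k : exists phi, godel phi = k.
Proof.
have [n] := ubnP k; elim: n k => // n IH k kn.
rewrite (divn_eq k 5); set c := k %/ 5; have := ltn_pmod k (isT : 0 < 5).
have [x [y E]] := cpair_surj c; have [lx ly] := leq_cpair x y.
case: (k %% 5) (divn_eq k 5) => [|[|[|[|[|//]]]]] Ek _; rewrite -/c in Ek.
- by exists (fMem x y); rewrite /= E; lia.
- by exists (fEq x y); rewrite /= E; lia.
- by have [|p Ep] := IH c; [lia|exists (fNot p); rewrite /= Ep; lia].
- have [|p Ep] := IH x; first lia; have [|q Eq] := IH y; first lia.
  by exists (fAnd p q); rewrite /= Ep Eq E; lia.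
- by have [|p Ep] := IH c; [lia|exists (fEx p); rewrite /= Ep; lia].
Qed.

Lemma fv_mono phi n m : n <= m -> fv_below n phi -> fv_below m phi.
Proof.
elim: phi n m => [i j|i j|p IH|p IHp q IHq|p IH] n m nm /=.
- by move=> [a b]; split; apply: leq_trans nm.
- by move=> [a b]; split; apply: leq_trans nm.
- exact: IH.
- by move=> [a b]; split; [apply: IHp a|apply: IHq b].
- by apply: IH.
Qed.

Lemma fv_godel phi : fv_below (godel phi).+1 phi.
Proof.
elim: phi => [i j|i j|p IH|p IHp q IHq|p IH] /=.
- by have [] := leq_cpair i j; lia.
- by have [] := leq_cpair i j; lia.
- by apply: fv_mono IH; lia.
- have [a b] := leq_cpair (godel p) (godel q).
  by split; [apply: fv_mono IHp|apply: fv_mono IHq]; lia.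
- by apply: fv_mono IH; lia.
Qed.

Lemma sat_fv (M : structure) phi n (e e' : nat -> M) : fv_below n phi ->
  (forall i, i < n -> e i = e' i) -> (sat e phi <-> sat e' phi).
Proof.
elim: phi n e e' => [i j|i j|p IH|p IHp q IHq|p IH] n e e' /=.
- by move=> [a b] E; rewrite !E.
- by move=> [a b] E; rewrite !E.
- by move=> a E; rewrite (IH n e e').
- by move=> [a b] E; rewrite (IHp n e e') // (IHq n e e').
- move=> a E; have h x : sat (scons x e) p <-> sat (scons x e') p.
    by apply: (IH n.+1) => // -[|i] //= lin; apply: E.
  by split=> -[x] /h; exists x.
Qed.

Lemma fv_ren phi n m r : fv_below n phi -> (forall i, i < n -> r i < m) ->
  fv_below m (ren r phi).
Proof.
elim: phi n m r => [i j|i j|p IH|p IHp q IHq|p IH] n m r /=.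
- by move=> [a b] h; split; apply: h.
- by move=> [a b] h; split; apply: h.
- exact: IH.
- by move=> [a b] h; split; [apply: IHp h|apply: IHq h].
- by move=> a h; apply: (IH n.+1) => // -[|i] //=; apply: h.
Qed.

(* Identifies all free variables of phi with variable 0; iterating the
   quantifier avoids computing which variables are free in phi. *)
Definition dup (p : form) : form := fEx (fAnd (fEq 0 1) p).
Definition unary (phi : form) : form := iter (godel phi).+1 dup phi.

Lemma sat_iter_dup (M : structure) n (e : nat -> M) phi :
  sat e (iter n dup phi) <-> sat (fun i => if i < n then e 0 else e (i - n)) phi.
Proof.
elim: n e => [|n IH] e /=; first by apply: sat_ext => i; rewrite subn0.
have E : (fun i => if i < n then e 0 else scons (e 0) e (i - n)) =1
         (fun i => if i < n.+1 then e 0 else e (i - n.+1)).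
  move=> i; rewrite ltnS; case: (ltngtP i n) => h //=.
    by rewrite -(subnSK h).
  by subst i; rewrite subnn.
split=> [[x [Ex /IH h]]|h].
  by move: h; rewrite /= in Ex; subst x; rewrite (sat_ext _ E).
by exists (e 0); split=> //; apply/IH; rewrite (sat_ext _ E).
Qed.

Lemma sat_unary (M : structure) (e : nat -> M) phi :
  sat e (unary phi) <-> sat (fun=> e 0) phi.
Proof.
by rewrite sat_iter_dup; apply: (sat_fv (fv_godel phi)) => i ->.
Qed.

Lemma fv_unary phi : fv_below 1 (unary phi).
Proof.
have : fv_below ((godel phi).+1 + 1) phi by apply: fv_mono (fv_godel phi); lia.
suff h n m : 0 < m -> fv_below (n + m) phi -> fv_below m (iter n dup phi) by apply: h.
elim: n m => // n IH m m0 h /=; split; first by split.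
apply: IH => //.
by rewrite addnS -addSn.
Qed.

Definition gdup (g : nat) : nat := 5 * (5 * cpair (5 * cpair 0 1 + 1) g + 3) + 4.

Lemma godel_unary phi : godel (unary phi) = iter (godel phi).+1 gdup (godel phi).
Proof. by rewrite /unary; elim: _.+1 => //= n ->. Qed.

Lemma rec1_gunary : rec1 (fun g => iter g.+1 gdup g).
Proof.
apply: (recursive_comp2 (f := fun n x => iter n gdup x)).
- apply: rec2_iter; rewrite /rec1 /gdup.
  by do !(apply: recursive_const || apply: recursive_cpair || apply: recursive_add
    || apply: recursive_mul || apply: rec_proj).
- by apply: recursive_succ; apply: rec_proj.
- exact: rec_proj.
Qed.

Lemma leq_gdup g : g <= gdup g.
Proof. by rewrite /gdup; have [_] := leq_cpair (5 * cpair 0 1 + 1) g; lia. Qed.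

End GodelNumbers.

Section Saturation.

Variable M : structure.
Hypothesis sat_M : recursively_saturated M.

(* With index 0 for x and the constants of rho from index 1 on, this says that
   R x d d' and phi d imply phi d'. *)
Definition invform (rho phi : form) : form :=
  fNot (fEx (fEx (fAnd rho (fAnd (fEx (fAnd (fEq 0 2) (unary phi)))
                                 (fNot (unary phi)))))).

Definition ginv (r u : nat) : nat :=
  5 * (5 * (5 * (5 * cpair r
    (5 * cpair (5 * (5 * cpair (5 * cpair 0 2 + 1) u + 3) + 4) (5 * u + 2) + 3) + 3)
    + 4) + 4) + 2.

Lemma recursive_invform rho :
  recursive_type (fun theta => exists phi, theta = invform rho phi).
Proof.
pose G g := ginv (godel rho) (iter g.+1 gdup g).
have EG phi : godel (invform rho phi) = G (godel phi) by rewrite /G -godel_unary.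
have rG : rec1 G.
  apply: (recursive_comp1 (f := ginv (godel rho)) _ rec1_gunary); rewrite /rec1 /ginv.
  by do !(apply: recursive_const || apply: recursive_cpair || apply: recursive_add
    || apply: recursive_mul || apply: rec_proj).
have leG g : g <= G g.
  have h n x : x <= iter n gdup x.
    by elim: n => // n IH; apply: leq_trans IH _; apply: leq_gdup.
  apply: leq_trans (h g.+1 g) _; rewrite /G /ginv; set u := iter _ _ _.
  set a := 5 * (5 * cpair (5 * cpair 0 2 + 1) u + 3) + 4.
  have [_ h1] := leq_cpair a (5 * u + 2).
  have [_ h2] := leq_cpair (godel rho) (5 * cpair a (5 * u + 2) + 3).
  by lia.
have [f rf hf] := recursive_range rG leG.
exists f => // k; case: (hf k) => [[[g Eg] E]|[n E]]; [left|right]; split=> //.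
  have [phi Ephi] := godel_surj g.
  by exists (invform rho phi); [exists phi|rewrite EG Ephi].
by move=> [theta [phi ->]] E'; apply: n; exists (godel phi); rewrite -EG.
Qed.

Lemma gather (T U : Type) (F : T -> U) (s : seq U) :
  (forall y, List.In y s -> exists x, y = F x) ->
  exists l, forall y, List.In y s -> exists2 x, List.In x l & y = F x.
Proof.
elim: s => [|y s IH] h; first by exists [::].
have [|l hl] := IH; first by move=> z zs; apply: h; right.
have [x ->] := h y (or_introl erefl); exists (x :: l) => z [<-|/hl [x' x'l ->]].
  by exists x; [left|].
by exists x'; [right|].
Qed.

(** The hypothesis says that the type asking, for every formula, that it be preserved along [R x] is
    finitely realised; [recursive_invform] makes this type recursive. *)
Lemma saturation (R : M -> M -> M -> Prop) : inhabited M -> Df3 (@anyc M) R ->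
  (forall l : seq form, exists x, forall d d', R x d d' ->
     forall phi, List.In phi l -> (sat (fun=> d) phi <-> sat (fun=> d') phi)) ->
  exists x, forall d d', R x d d' -> eqt d d'.
Proof.
move=> [c] [phi0 [f [_ _ hR]]] fin.
pose n := (godel phi0).+1.
(* The two quantifiers of [invform] put [d'] at index 0 and [d] at 1, which moves [x] to 2 and the
   [i]-th parameter to [i.+3]. *)
pose r i := match f i with inl 0 => 2 | inl 1 => 1 | inl _ => 0 | inr _ => i.+3 end.
pose a := [seq (if f i is inr m then m else c) | i <- iota 0 n].
pose rho := ren r phi0.
have sa : size a = n by rewrite size_map size_iota.
have hrho x d d' : R x d d' <-> sat (scons d' (scons d (nth x (x :: a)))) rho.
  rewrite (hR (fun i => match i with 0 => x | 1 => d | _ => d' end)) sat_ren.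
  apply: (sat_fv (fv_godel phi0)) => i; rewrite -/n => lin; rewrite /asg /r.
  case E: (f i) => [[|[|j]]|m] //=.
  by rewrite (nth_map 0) ?size_iota // nth_iota // add0n E.
have hinv x phi : sat (nth x (x :: a)) (invform rho phi) <->
    forall d d', R x d d' -> sat (fun=> d) phi -> sat (fun=> d') phi.
  rewrite [sat _ _]/=; split=> [h d d' Rd hd|h [d [d' [/hrho Rd [[z [Ez hz]] nz]]]]].
    apply: NNPP => nd; apply: h; exists d, d'; split; first by apply/hrho.
    split; last by move=> /sat_unary.
    by exists d; split=> //; apply/sat_unary.
  apply: nz; apply/sat_unary; apply: (h d) => //.
  by move/sat_unary: hz; rewrite /= in Ez; subst z.
have [theta [phi ->]|s hs|x hx] := @sat_M a _ (recursive_invform rho).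
- rewrite sa /=; split; last first.
    split; last by apply: fv_mono (fv_unary phi).
    by split=> //; apply: fv_mono (fv_unary phi).
  apply: (fv_ren (fv_godel phi0)) => i; rewrite -/n /r => lin.
  by case: (f i) => [[|[|j]]|m]; rewrite ?ltnS.
- have [l hl] := gather hs; have [x hx] := fin l.
  by exists x => theta /hl [phi pl ->]; apply/hinv => d d' /hx /(_ phi pl) ->.
- have hx' psi := (hinv x psi).1 (hx _ (ex_intro _ psi erefl)).
  exists x => d d' Rd phi; split=> [|hd']; first exact: hx'.
  (* The type only demands an implication; its instance for the negated formula gives the
     converse. *)
  by apply: NNPP => nd; apply: (hx' (fNot phi) d d' Rd nd).
Qed.

End Saturation.

(** * The Erdos-Rado theorem *)

Section Tuples.

Variable M : zmodel.
Implicit Types (a b c x y z w r s t u v g p q h k W X Y : M) (C : M -> Prop).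
Local Notation any := (@anyc M).

Definition seg W s x : M := cls (fun y => y ε s /\ opair y x ε W).

Lemma mem_seg W s x y : y ε seg W s x <-> y ε s /\ opair y x ε W.
Proof. by apply: (mem_cls_sub (a := s)); [dfn|move=> z []]. Qed.

Lemma Tm_seg C (t1 t2 t3 : (nat -> M) -> M) :
  Tm C t1 -> Tm C t2 -> Tm C t3 -> Tm C (fun e => seg (t1 e) (t2 e) (t3 e)).
Proof.
move=> d1 d2 d3.
pose s i := match i with 0 => fun e : nat -> M => e 0 | 1 => fun e => t1 (fun i => e i.+1)
  | 2 => fun e => t2 (fun i => e i.+1) | _ => fun e => t3 (fun i => e i.+1) end.
have d : Tm C (fun e => seg (e 0) (e 1) (e 2)).
  by apply: Tm_cls => [e z|]; [exact: mem_seg|dfn].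
apply: (Df_subst (s := s) d).
by case=> [|[|[|i]]]; [apply: Tm_var|apply: Tm_shift..].
Qed.

(* Increasing r-tuples of elements of s in the order W, coded as nested pairs
   with the last component outermost. *)
Fixpoint Tup (n : nat) W s t : Prop :=
  if n is n'.+1 then
    exists t' x, [/\ t = opair t' x, x ε s & Tup n' W (seg W s x) t']
  else t = emp.

Lemma Df_Tup C n : Df3 C (Tup n).
Proof.
elim: n => [|n IH]; rewrite /Tup -/Tup; dfn.
by apply: Tm_seg; apply: Tm_var.
Qed.

Lemma seg_sub W s s' x : subset s s' -> subset (seg W s x) (seg W s' x).
Proof. by move=> h y /mem_seg [ys yx]; apply/mem_seg; split=> //; apply: h. Qed.

Lemma Tup_sub n W s s' t : subset s s' -> Tup n W s t -> Tup n W s' t.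
Proof.
elim: n s s' t => // n IH s s' t h [t' [x [-> xs ht']]]; exists t', x; split=> //.
  exact: h.
by apply: IH ht'; apply: seg_sub.
Qed.

Fixpoint tup (l : seq M) : M := if l is x :: l' then opair (tup l') x else emp.

Fixpoint desc W s (l : seq M) : Prop :=
  if l is x :: l' then x ε s /\ desc W (seg W s x) l' else True.

Lemma Tup_tup W s l : Tup (size l) W s (tup l) <-> desc W s l.
Proof.
elim: l s => [|x l IH] s; first by split.
split=> [[t' [x' [/= /opair_inj [<- <-] xs /IH]]]|[xs /IH hl]] //.
by exists (tup l), x.
Qed.

Lemma desc_sub W s s' l : subset s s' -> desc W s l -> desc W s' l.
Proof.
elim: l s s' => // x l IH s s' h [xs dl]; split; first exact: h.
by apply: IH dl; apply: seg_sub.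
Qed.

(** The componentwise image under [h], used to code a tuple from a large set by a tuple from a wide
    set. *)
Fixpoint mt (n : nat) h t : M :=
  if n is n'.+1 then opair (mt n' h (p1 t)) (app h (p2 t)) else emp.

Lemma Tm_mt C n : Tm2 C (mt n).
Proof. by elim: n => [|n IH]; rewrite /mt -/mt; dfn. Qed.

Lemma injn_app h a b x : injn h a b -> x ε a ->
  [/\ app h x ε b, opair x (app h x) ε h & forall y, opair x y ε h -> y = app h x].
Proof.
move=> [h1 h2] xa; have [y [yb xy]] := h1 x xa.
have E : forall y', opair x y' ε h -> y' = y.
  by move=> y' xy'; apply/esym/(h2 _ _ _ _ xa xa xy xy').
by rewrite (appE xy E).
Qed.

Lemma injn_inj h a b x x' : injn h a b -> x ε a -> x' ε a -> app h x = app h x' -> x = x'.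
Proof.
move=> ih xa x'a E; have [_ h1 _] := injn_app ih xa; have [_ h2 _] := injn_app ih x'a.
by case: ih => _ /(_ _ _ _ _ xa x'a h1 h2) ->.
Qed.

Lemma mt_inj n h W s t t' :
  (forall x x', x ε s -> x' ε s -> app h x = app h x' -> x = x') ->
  Tup n W s t -> Tup n W s t' -> mt n h t = mt n h t' -> t = t'.
Proof.
elim: n s t t' => [|n IH] s t t' hh; first by move=> /= -> ->.
move=> [t1 [x [-> xs h1]]] [t1' [x' [-> xs' h1']]] /=.
rewrite !p1E !p2E => /opair_inj [E1 /(hh _ _ xs xs') E2]; subst x'.
rewrite (IH (seg W s x) t1 t1') // => y y' /mem_seg [ys _] /mem_seg [ys' _].
exact: hh.
Qed.

Lemma mt_eq n h h' W s t : (forall x, x ε s -> app h x = app h' x) ->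
  Tup n W s t -> mt n h t = mt n h' t.
Proof.
elim: n s t => // n IH s t hh [t' [x [-> xs ht']]] /=.
rewrite !p1E !p2E hh // (IH (seg W s x)) // => y /mem_seg [ys _]; exact: hh.
Qed.

End Tuples.

Section ErdosRado.

Variables (M : zmodel) (I : M -> Prop).
Implicit Types (a b c x y z w s t u v g p q h k W X Y P : M) (C : M -> Prop).
Implicit Types (lv : nat -> M).
Local Notation any := (@anyc M).

(** Power sets counted downwards: sets of elements of [lv i.+1] are elements of [lv i], and pairs of
    elements of [lv i.+2] are elements of [lv i]. Every term is wide, so the supply never ends. *)
Record chain lv : Prop := Chain {
  chain_wide : forall i, wide I (lv i);
  chain_pw : forall i s, subset s (lv i.+1) -> s ε lv i;
  chain_sub : forall i, subset (lv i.+1) (lv i)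
}.

Hypothesis I_emp : I emp.

Lemma chain_shift lv n : chain lv -> chain (fun i => lv (n + i)).
Proof.
by move=> [h1 h2 h3]; split=> [i|i s|i]; rewrite ?addnS; [apply: h1|apply: h2|apply: h3].
Qed.

Lemma chain_le lv i j : chain lv -> i <= j -> subset (lv j) (lv i).
Proof.
move=> ch; elim: j => [|j IH]; first by rewrite leqn0 => /eqP -> z.
rewrite leq_eqVlt => /orP [/eqP -> z //|ij] z /(chain_sub ch).
exact: IH.
Qed.

Lemma chain_opair lv i x y : chain lv -> x ε lv i.+2 -> y ε lv i.+2 -> opair x y ε lv i.
Proof.
move=> ch hx hy; apply: (chain_pw ch) => z /mem_pr [->|->];
  by apply: (chain_pw ch) => w /mem_pr [->|->].
Qed.

Lemma not_le_sub X a b : subset a b -> ~ le X b -> ~ le X a.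
Proof. by move=> ab nb Xa; apply: nb; apply: le_trans Xa (le_refl_sub ab). Qed.

Lemma mt_chain lv n i h W s t : chain lv -> (forall x, x ε s -> app h x ε lv (i + n.*2)) ->
  Tup n W s t -> mt n h t ε lv i.
Proof.
move=> ch; elim: n i s t => [|n IH] i s t hh; first by move=> _; apply: chain_wide.
move=> [t' [x [-> xs ht']]] /=; rewrite p1E p2E; apply: chain_opair => //.
  apply: IH ht' => y /mem_seg [ys _]; move: (hh y ys).
  by rewrite doubleS !addnS !addSn.
by apply: (chain_le ch _ (hh x xs)); rewrite doubleS !addnS ltnS ltnS leq_addr.
Qed.

(** * End-homogeneous sets from the ramification tree of a colouring *)

Section Ramification.

Variables (n : nat) (W X : M) (f : M -> M) (lv : nat -> M).
Hypotheses (wo : well_orders (rel_of W) X) (df : Tm1 any f) (ch : chain lv).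
(** Two indices per component bring the copy of an [n]-tuple from [lv c] to [lv 5]. Paired with its
    colour it lies in [lv 3], a set of such pairs lies in [lv 2], and a pair of two such sets in
    [lv 0]. *)
Let c := n.*2 + 5.
Hypothesis hf : forall t, Tup n.+1 W X t -> f t ε lv c.

(** The branch of the ramification tree below [y]: [u] is kept if it is coloured like [y] over all
    tuples from the part of the branch below [u]. *)
Definition IsP y P : Prop := forall u, u ε P <-> [/\ u ε X, opair u y ε W
  & forall t, Tup n W (seg W P u) t -> f (opair t u) = f (opair t y)].

Lemma IsP_ex y : exists P, IsP y P.
Proof.
have dT := @Df_Tup M any n.
pose F u (A : M -> Prop) := opair u y ε W /\ forall s, (forall w, w ε s <-> A w) ->
  forall t, Tup n W s t -> f (opair t u) = f (opair t y).
have [|||P hP] := @subset_recursion M (rel_of W) X F wo; first by dfn.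
- move=> u A B AB [uy h]; split=> // s hs; apply: h => w.
  by rewrite hs AB.
- by rewrite /F; dfn.
exists P => u; rewrite hP /F; split=> [[uX [uy h]]|[uX uy h]]; split=> //.
  by apply: h => w; rewrite mem_seg rel_ofE.
split=> // s hs; suff -> : s = seg W P u by [].
by apply: extM => w; rewrite hs mem_seg rel_ofE.
Qed.

(** The codes copy into a wide set the order of the branch and, in [code2], the colours it gives to
    [y]. The diagonal is included so that a one-point branch leaves a trace. *)
Definition code1 P h s : Prop := forall p, p ε s <-> exists u v,
  [/\ u ε P, v ε P, opair u v ε W \/ u = v & p = opair (app h u) (app h v)].
Definition code2 y P h s : Prop := forall p, p ε s <-> exists t,
  Tup n W P t /\ p = opair (mt n h t) (f (opair t y)).

Lemma wirr u : u ε X -> ~ opair u u ε W.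
Proof. by case: wo => irr _ _ _ uX /rel_ofE; apply: irr. Qed.

Lemma wtr u v w : u ε X -> v ε X -> w ε X -> opair u v ε W -> opair v w ε W -> opair u w ε W.
Proof. by case: wo => _ tr _ _ uX vX wX uv vw; apply/rel_ofE; apply: (tr u v w) => //; apply/rel_ofE. Qed.

Lemma wtot u v : u ε X -> v ε X -> [\/ opair u v ε W, u = v | opair v u ε W].
Proof.
case: wo => _ _ tot _ uX vX; case: (tot u v uX vX) => h.
- by constructor 1; apply/rel_ofE.
- by constructor 2.
- by constructor 3; apply/rel_ofE.
Qed.

Section Codes.

Variables (K y y' P P' h h' s1 s2 : M).
Hypotheses (yX : y ε X) (y'X : y' ε X) (hP : IsP y P) (hP' : IsP y' P').
Hypotheses (ih : injn h P K) (ih' : injn h' P' K).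
Hypotheses (c1 : code1 P h s1) (c1' : code1 P' h' s1).
Hypotheses (c2 : code2 y P h s2) (c2' : code2 y' P' h' s2).

Let PX : subset P X. Proof. by move=> u /hP []. Qed.
Let PX' : subset P' X. Proof. by move=> u /hP' []. Qed.

Lemma code_col s t : subset s P -> subset s P' -> (forall x, x ε s -> app h x = app h' x) ->
  Tup n W s t -> f (opair t y) = f (opair t y').
Proof.
move=> sP sP' hh ht.
have /c2' [t1 [ht1 /opair_inj [E1 ->]]] : opair (mt n h t) (f (opair t y)) ε s2.
  by apply/c2; exists t; split=> //; apply: Tup_sub ht.
suff -> : t = t1 by [].
apply: (mt_inj (h := h') (W := W) (s := P') (n := n)) => //.
- by move=> x x' xP x'P; apply: injn_inj ih' _ _.
- by apply: Tup_sub ht.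
- by rewrite -E1; apply/esym/(mt_eq hh ht).
Qed.

(** By induction along the order, let [u'] be the point of [P'] with the image of [u]. Both have the
    same predecessors in the branches, and over these [y] and [y'] give the same colours. If [u] and
    [u'] differed, the earlier one would satisfy the condition for entering the other branch, and so
    precede itself. *)
Lemma code_half u : u ε P -> u ε P' /\ app h u = app h' u.
Proof.
move=> uP; move: (PX uP) (uP).
pose Q u := u ε P -> u ε P' /\ app h u = app h' u.
suff : forall u, u ε X -> Q u by move=> q /q.
apply: (wo_ind wo); first by rewrite /Q; dfn.
move=> {uP}u uX IH uP.
have {}IH w : w ε P -> opair w u ε W -> w ε P' /\ app h w = app h' w.
  by move=> wP wu; apply: IH => //; [apply: PX|apply/rel_ofE].
have [u' [u'P' Eu]] : exists u', u' ε P' /\ app h' u' = app h u.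
  have /c1' [a [b [aP' _ _ /opair_inj [E _]]]] : opair (app h u) (app h u) ε s1.
    by apply/c1; exists u, u; split=> //; right.
  by exists a.
have u'X := PX' u'P'.
have segE : seg W P u = seg W P' u'.
  apply: extM => w; rewrite !mem_seg; split=> -[wP wu].
    have [wP' Ew] := IH w wP wu; split=> //.
    have /c1' [a [b [aP' bP' ab /opair_inj [E1 E2]]]] : opair (app h w) (app h u) ε s1.
      by apply/c1; exists w, u; split=> //; left.
    have Ea : w = a by apply: (injn_inj ih') => //; rewrite -Ew.
    have Eb : u' = b by apply: (injn_inj ih') => //; rewrite Eu.
    subst a b; case: ab => // E; subst w.
    have E : u' = u by apply: (injn_inj ih) => //; rewrite Ew.
    by subst u'; case: (wirr uX).
  have /c1 [a [b [aP bP ab /opair_inj [E1 E2]]]] : opair (app h' w) (app h' u') ε s1.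
    by apply/c1'; exists w, u'; split=> //; left.
  have Eb : u = b by apply: (injn_inj ih) => //; rewrite -Eu.
  subst b; case: ab => [au|E].
    have [aP' Ea] := IH a aP au.
    by have -> : w = a by apply: (injn_inj ih') => //; rewrite E1.
  subst a; have E : w = u' by apply: (injn_inj ih') => //; rewrite E1 Eu.
  by subst w; case: (wirr u'X).
have col t : Tup n W (seg W P u) t -> f (opair t y) = f (opair t y').
  apply: code_col => [w /mem_seg [] //|w|w /mem_seg [wP wu]].
    by rewrite segE => /mem_seg [].
  by case: (IH w wP wu).
have uy : opair u y ε W by case/hP: (uP).
have u'y' : opair u' y' ε W by case/hP': (u'P').
case: (wtot uX u'X) => [uu'|E|u'u].
- have uP' : u ε P'.
    apply/hP'; split=> //; first exact: wtr uu' u'y'.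
    move=> t ht; have ht' : Tup n W (seg W P u) t.
      rewrite segE; apply: Tup_sub ht => w /mem_seg [wP wu]; apply/mem_seg; split=> //.
      by apply: wtr wu uu' => //; apply: PX'.
    by rewrite -col //; case/hP: (uP) => _ _; apply.
  have : u ε seg W P u by rewrite segE; apply/mem_seg.
  by move=> /mem_seg [_ /(wirr uX)].
- by subst u'.
- have u'P : u' ε P.
    apply/hP; split=> //; first exact: wtr u'u uy.
    move=> t ht; have ht' : Tup n W (seg W P u) t.
      apply: Tup_sub ht => w /mem_seg [wP wu]; apply/mem_seg; split=> //.
      by apply: wtr wu u'u => //; apply: PX.
    by rewrite col //; case/hP': (u'P') => _ _; apply; rewrite -segE.
  have : u' ε seg W P' u' by rewrite -segE; apply/mem_seg.
  by move=> /mem_seg [_ /(wirr u'X)].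
Qed.

End Codes.

(** Equal codes give equal branches and equal colours over them; if one of [y], [y'] came earlier,
    it would lie on the other's branch, hence on its own. *)
Lemma code_inj K y y' P P' h h' s1 s2 : y ε X -> y' ε X -> IsP y P -> IsP y' P' ->
  injn h P K -> injn h' P' K -> code1 P h s1 -> code1 P' h' s1 ->
  code2 y P h s2 -> code2 y' P' h' s2 -> y = y'.
Proof.
move=> yX y'X hP hP' ih ih' c1 c1' c2 c2'.
have H := code_half yX y'X hP hP' ih ih' c1 c1' c2 c2'.
have H' := code_half y'X yX hP' hP ih' ih c1' c1 c2' c2.
have E : P = P' by apply: extM => u; split=> [/H []|/H' []].
subst P'; have col t : Tup n W P t -> f (opair t y) = f (opair t y').
  apply: (code_col ih' c2 c2') => //.
  by move=> x /H [].
case: (wtot yX y'X) => // yy'.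
- have : y ε P.
    apply/hP'; split=> // t ht; apply: col; apply: Tup_sub ht => w.
    by case/mem_seg.
  by case/hP => _ /(wirr yX).
- have : y' ε P.
    apply/hP; split=> // t ht; apply/esym/col; apply: Tup_sub ht => w.
    by case/mem_seg.
  by case/hP' => _ /(wirr y'X).
Qed.

(** If every branch injected into [lv c], sending each [y] to the codes of its branch would inject
    [X] into [lv 0]. *)
Lemma ramify : ~ le X (lv 0) -> exists y P, [/\ y ε X, subset P (seg W X y), ~ le P (lv c)
  & forall t u, u ε P -> Tup n W (seg W P u) t -> f (opair t u) = f (opair t y)].
Proof.
move=> nX; apply: NNPP => n0; apply: nX.
have small y P : y ε X -> IsP y P -> le P (lv c).
  move=> yX hP; apply: NNPP => nP; apply: n0; exists y, P; split=> //.
    by move=> u /hP [uX uy _]; apply/mem_seg.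
  by move=> t u /hP [_ _]; apply.
have dT := @Df_Tup M any n; have dmt := @Tm_mt M any n.
have dseg := @Tm_seg M any.
have dP : Df2 any IsP.
  by rewrite /IsP; dfn; apply: dseg; apply: Tm_var || by apply: Tm_cst.
apply: (@le_of_rel M (fun y s => exists P h s1 s2, [/\ s = opair s1 s2, IsP y P,
   injn h P (lv c) & code1 P h s1 /\ code2 y P h s2])).
- by rewrite /code1 /code2; dfn.
- move=> y yX; have [P hP] := IsP_ex y; have [h ih] := small y P yX hP.
  have happ x : x ε P -> app h x ε lv c by move=> xP; case: (injn_app ih xP).
  have c3 : 3 <= c by rewrite /c addnC.
  have [|s1 h1] := @sep_ex M (fun p => exists u v,
    [/\ u ε P, v ε P, opair u v ε W \/ u = v & p = opair (app h u) (app h v)]) (lv 3).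
    by dfn.
  have [|s2 h2] := @sep_ex M (fun p => exists t,
    Tup n W P t /\ p = opair (mt n h t) (f (opair t y))) (lv 3).
    by dfn.
  have le5 : subset (lv c) (lv 5) by apply: chain_le => //; rewrite /c leq_addl.
  exists (opair s1 s2); split.
    apply: chain_opair => //; apply: chain_pw => // p; first by move=> /h1 [].
    by move=> /h2 [].
  exists P, h, s1, s2; split=> //; split=> p; rewrite ?h1 ?h2.
    split=> [[]//|H]; split=> //.
    by case: H => u [v [uP vP _ ->]]; apply: chain_opair => //; apply: le5; apply: happ.
  split=> [[]//|H]; split=> //.
  case: H => t [ht ->]; apply: chain_opair => //.
    by apply: (mt_chain ch (s := P) (W := W)) ht => x; rewrite addnC; apply: happ.
  apply: le5; apply: hf; exists t, y; split=> //.
  by apply: Tup_sub ht => u /hP [uX uy _]; apply/mem_seg.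
- move=> y y' s yX y'X [P [h [s1 [s2 [-> hP ih [c1 c2]]]]]].
  move=> [P' [h' [s1' [s2' [/opair_inj [E1 E2] hP' ih' [c1' c2']]]]]].
  subst s1' s2'.
  exact: (code_inj yX y'X hP hP' ih ih' c1 c1' c2 c2').
Qed.

End Ramification.

(** On an end-homogeneous set the last argument may be replaced by [y], leaving a colouring of
    shorter tuples. The index [m] depends only on [n] and the chain, so colours can be designed to
    lie in [lv m] before [X] and [f] are given. *)
Lemma erdos_rado (n : nat) : forall lv, chain lv -> exists m, forall W X f,
  well_orders (rel_of W) X -> Tm1 any f -> (forall t, Tup n W X t -> f t ε lv m) ->
  ~ le X (lv 0) -> exists Y, [/\ subset Y X, ~ le Y (lv m)
    & forall t t', Tup n W Y t -> Tup n W Y t' -> f t = f t'].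
Proof.
elim: n => [|n IH] lv ch.
  by exists 0 => W X f _ _ _ nX; exists X; split=> // t t' /= -> ->.
pose c := n.*2 + 5; have [m hm] := IH _ (chain_shift c ch).
exists (c + m) => W X f wo df hf nX.
have [|y [P [yX PX nP hP]]] := ramify wo df ch (n := n) _ nX.
  by move=> t /hf; apply: chain_le => //; rewrite leq_addr.
have PX' : subset P X by move=> u /PX /mem_seg [].
have [||t ht||Y [YP nY hY]] := hm W P (fun t => f (opair t y)).
- exact: wo_sub PX'.
- by dfn.
- by apply: hf; exists t, y; split=> //; apply: Tup_sub ht.
- by rewrite addn0.
exists Y; split=> //; first by move=> u /YP /PX'.
move=> t t' [t1 [x [-> xY h1]]] [t1' [x' [-> xY' h1']]].
have red t2 x2 : x2 ε Y -> Tup n W (seg W Y x2) t2 -> f (opair t2 x2) = f (opair t2 y).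
  by move=> x2Y h2; apply: hP; [apply: YP|apply: Tup_sub h2; apply: seg_sub].
rewrite !red //; apply: hY; [apply: Tup_sub h1|apply: Tup_sub h1'] => w;
  by case/mem_seg.
Qed.

End ErdosRado.

(** * Homogeneous sets *)

Ltac dfn_sat :=
  lazymatch goal with
  | |- Df _ (fun e => sat (fun _ => _) _) => apply: Df_sat => ?
  end.

Section Types.

Variables (M : zmodel) (I : M -> Prop).
Hypotheses (HI : H_cut I) (sat_M : recursively_saturated M).
Implicit Types (a b c d x y z w s t u v g p q h k W X Y K L : M) (C : M -> Prop).
Implicit Types (lv : nat -> M) (phi : form).
Local Notation any := (@anyc M).
Local Notation "'In_' K" := (fun z => z ε K) (at level 10, K at level 9).

Fixpoint num (i : nat) : M := if i is i'.+1 then adj (num i') (num i') else emp.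

Lemma Tm_num C i : Tm C (fun=> num i).
Proof. by elim: i => [|i IH]; [apply: Tm_emp|apply: Tm_adj]. Qed.

Lemma I_num i : I (num i).
Proof. by elim: i => [|i IH]; [apply: I_emp HI|apply: I_adj]. Qed.

Lemma num_lt i j : i < j -> num i ε num j.
Proof.
elim: j => // j IH; rewrite ltnS leq_eqVlt => /orP [/eqP ->|/IH h]; apply/mem_adj;
  by [right|left].
Qed.

Lemma num_inj i j : num i = num j -> i = j.
Proof.
move=> E; case: (ltngtP i j) => // /num_lt; rewrite E => h; by case: (mem_irr h).
Qed.

Lemma num_set : exists w, I w /\ forall i, num i ε w.
Proof.
have [w [hw w0 wS]] := I_inductive HI; exists w; split=> //.
by elim=> [|i IH] //; apply: wS.
Qed.

(** The side condition is folded into the relation: where [Q] fails, the empty set is declared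
    equivalent to a nonempty one, which no type allows. *)
Lemma saturationQ (R : M -> M -> M -> Prop) (Q : M -> Prop) : Df3 any R -> Df1 any Q ->
  (forall l : seq form, exists x, Q x /\ forall d d', R x d d' ->
     forall phi, List.In phi l -> (sat (fun=> d) phi <-> sat (fun=> d') phi)) ->
  exists x, Q x /\ forall d d', R x d d' -> eqt d d'.
Proof.
move=> dR dQ fin.
pose R' x d d' := R x d d' \/ (~ Q x /\ (d = emp /\ d' = num 1)).
have [||l|x hx] := @saturation M sat_M R'; first exact: inhabited_model.
- by rewrite /R'; dfn.
- by have [x [qx hx]] := fin l; exists x => d d' [/hx|[]].
exists x; split; last by move=> d d' h; apply: hx; left.
apply: NNPP => nq; have E : eqt emp (num 1) by apply: hx; right.
have := @eqt_Df M (fun z => exists y, y ε z) emp (num 1) _ E.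
move=> [|_ h]; first by dfn.
by case: h => [|y /mem_emp]; first by exists emp; apply/mem_adj; right.
Qed.

(** The truth values at [d] are recorded as a path through repeated splitting of the indices of [o]
    into odd and even, so for injective [o] the label determines them. *)
Fixpoint label (l : seq form) (o : nat -> M) d v : Prop :=
  if l is phi :: l' then
    (sat (fun=> d) phi /\ label l' (fun i => o i.*2.+1) d v) \/
    (~ sat (fun=> d) phi /\ label l' (fun i => o i.*2) d v)
  else v = o 0.

Lemma Df_label l o : Df2 any (label l o).
Proof.
elim: l o => [|phi l IH] o; rewrite /label -/label; dfn.
- by dfn_sat; dfn.
- exact: IH.
- by dfn_sat; dfn.
- exact: IH.
Qed.

Lemma label_range l o d v : label l o d v -> exists i, v = o i.
Proof.
elim: l o => [|phi l IH] o /=; first by exists 0.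
by move=> [[_ /IH [i ->]]|[_ /IH [i ->]]]; eexists.
Qed.

Lemma label_ex l o d : exists v, label l o d v.
Proof.
elim: l o => [|phi l IH] o /=; first by exists (o 0).
case: (classic (sat (fun=> d) phi)) => h.
  by have [v hv] := IH (fun i => o i.*2.+1); exists v; left.
by have [v hv] := IH (fun i => o i.*2); exists v; right.
Qed.

Lemma label_agree l o d d' v : injective o -> label l o d v -> label l o d' v ->
  forall phi, List.In phi l -> (sat (fun=> d) phi <-> sat (fun=> d') phi).
Proof.
elim: l o => // psi l IH o io.
have i1 : injective (fun i => o i.*2.+1) by move=> i j /io [] /double_inj.
have i2 : injective (fun i => o i.*2) by move=> i j /io /double_inj.
have clash i j : o i.*2.+1 <> o j.*2.
  by move=> /io E; have := odd_double j; rewrite -E /= odd_double.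
move=> [[s1 l1]|[s1 l1]] [[s2 l2]|[s2 l2]] phi.
- by case=> [<-|]; [split|apply: (IH _ i1 l1 l2)].
- have [i Ei] := label_range l1; have [j Ej] := label_range l2.
  by case: (clash i j); rewrite -Ei -Ej.
- have [i Ei] := label_range l1; have [j Ej] := label_range l2.
  by case: (clash j i); rewrite -Ei -Ej.
- by case=> [<-|]; [split|apply: (IH _ i2 l1 l2)].
Qed.

(* Finitely many formulas need finitely many labels; by saturation the labels
   from one set in I suffice for all formulas. *)
Lemma type_labels U : exists w T, [/\ I w,
  forall d, d ε U -> exists v, v ε w /\ opair d v ε T
  & forall d d' v, d ε U -> d' ε U -> opair d v ε T -> opair d' v ε T -> eqt d d'].
Proof.
have [w [hw nw]] := num_set.
have [|||T [h1 h2]] := @saturationQ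
  (fun T d d' => exists v, [/\ d ε U, d' ε U, opair d v ε T & opair d' v ε T])
  (fun T => forall d, d ε U -> exists v, v ε w /\ opair d v ε T); [by dfn|by dfn| |].
  move=> l; have dl := @Df_label l num.
  have [|T hT] := @sep_ex M (fun p => exists d v, p = opair d v /\ label l num d v) (cart U w).
    by dfn.
  exists T; split=> [d dU|d d' [v [dU d'U]]].
    have [v hv] := label_ex l num d; have [i Ei] := label_range hv.
    have vw : v ε w by rewrite Ei.
    by exists v; split=> //; apply/hT; split; [apply/mem_cart_pair|exists d, v].
  move=> /hT [_ [d1 [v1 [/opair_inj [<- <-] l1]]]] /hT [_ [d2 [v2 [/opair_inj [<- <-] l2]]]].
  exact: (label_agree num_inj l1 l2).
exists w, T; split=> // d d' v dU d'U dv d'v; apply: h2; by exists v.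
Qed.

Fixpoint finseq (e : nat -> M) (n : nat) : M :=
  if n is n'.+1 then adj (finseq e n') (opair (num n') (e n')) else emp.

Lemma mem_finseq e n p : p ε finseq e n <-> exists2 i, i < n & p = opair (num i) (e i).
Proof.
elim: n => [|n IH] /=; first by rewrite mem_emp; split=> // -[].
rewrite mem_adj IH; split=> [[[i hi ->]|->]|[i]]; first by exists i => //; apply: ltnW.
  by exists n.
by rewrite ltnS leq_eqVlt => /orP [/eqP -> ->|hi ->]; [right|left; exists i].
Qed.

Lemma app_finseq e n i : i < n -> app (finseq e n) (num i) = e i.
Proof.
move=> hi; apply: appE; first by apply/mem_finseq; exists i.
by move=> y /mem_finseq [j _ /opair_inj [/num_inj -> ->]].
Qed.

(** Finitely many parameters from [lv i.+3] are coded by one finite sequence in [lv i]: two indices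
    for the pairs and one for the set of them. *)
Lemma eqt_teq lv i x y : chain I lv ->
  (forall d, d ε lv i -> eqt (opair x d) (opair y d)) -> teq (In_ (lv i.+3)) x y.
Proof.
move=> ch h phi e he; pose n := (godel phi).+1; pose d := finseq e n.
have dl : d ε lv i.
  apply: (chain_pw ch) => p /mem_finseq [j _ ->]; apply: (chain_opair ch) => //.
  by apply: (chain_wide ch); apply: I_num.
pose env z j := if j is j'.+1 then app (p2 z) (num j') else p1 z.
have E z : sat (scons z e) phi <-> sat (env (opair z d)) phi.
  apply: (sat_fv (fv_godel phi)) => -[|j] hj; rewrite /env /= ?p1E ?p2E //.
  by rewrite app_finseq //; apply: ltnW.
rewrite !E; apply: (@eqt_Df M (fun z => sat (env z) phi)) (h d dl).
apply: Df_sat => -[|j]; rewrite /env; dfn; exact: Tm_num.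
Qed.

(** The parameters in [lv 1] satisfying a formula together with [a] and [m] form an element of
    [lv 0]. These finitely many sets serve as constants in a statement about [a] that transfers to
    [b]. *)
Lemma fin_ext lv a b m (l : seq form) : chain I lv -> teq (In_ (lv 0)) a b ->
  exists y, forall phi, List.In phi l -> forall d, d ε lv 1 ->
    (sat (fun=> opair (opair a m) d) phi <-> sat (fun=> opair (opair b y) d) phi).
Proof.
move=> ch ab.
pose S phi := cls (fun d => d ε lv 1 /\ sat (fun=> opair (opair a m) d) phi).
have mS phi d : d ε S phi <-> d ε lv 1 /\ sat (fun=> opair (opair a m) d) phi.
  by apply: (mem_cls_sub (a := lv 1)); [dfn; dfn_sat; dfn|move=> z []].
have hS phi : S phi ε lv 0 by apply: (chain_pw ch) => d /mS [].
have h1 : lv 1 ε lv 0 by apply: (chain_pw ch).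
have [|||y hy] := (@teq_Df M (In_ (lv 0)) (fun z => exists y, forall phi, List.In phi l ->
  forall d, d ε lv 1 -> (d ε S phi <-> sat (fun=> opair (opair z y) d) phi)) a b _ _ ab).1.
- by exists (lv 1).
- dfn; apply: Df_seq_all => phi; dfn; last by dfn_sat; dfn.
- exists m => phi _ d d1; rewrite mS; by split=> [[]|].
exists y => phi pl d d1; rewrite -(hy phi pl d d1) mS; by split=> [|[]].
Qed.

(** The forth step of a back-and-forth argument. The price of four indices is one for [fin_ext] and
    three for [eqt_teq]. *)
Lemma hom_ext lv a b m : chain I lv -> teq (In_ (lv 0)) a b ->
  exists y, teq (In_ (lv 4)) (opair a m) (opair b y).
Proof.
move=> ch ab; have [|||y [_ hy]] := @saturationQ (fun y d1 d2 => exists d, [/\ d ε lv 1,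
  d1 = opair (opair a m) d & d2 = opair (opair b y) d]) (fun=> True); [by dfn|by dfn| |].
  move=> l; have [y hy] := fin_ext m l ch ab; exists y; split=> // d d' [c [c1 -> ->]] phi pl.
  exact: hy.
by exists y; apply: (eqt_teq (i := 1) ch) => d d1; apply: hy; exists d.
Qed.

Lemma Tup_set n W X : exists T, forall t, t ε T <-> Tup n W X t.
Proof.
elim: n => [|n [T hT]]; first by exists (pr emp emp) => t; rewrite mem_pr /=; split=> [[]|]; auto.
have dT := @Df_Tup M any n.+1.
have [|T' hT'] := @sep_ex M (fun t => Tup n.+1 W X t) (cart T X); first by dfn.
exists T' => t; rewrite hT'; split=> [[]//|ht]; split=> //.
case: ht => t' [x [-> xX ht']]; apply/mem_cart_pair; split=> //; apply/hT.
by apply: Tup_sub ht' => y /mem_seg [].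
Qed.

(** The colour of [t] is the map sending a parameter [d] to the label of the type of [t] with [a]
    and [d]. For [d] in [lv (m0 + 3)] this map is an element of [lv m0]; three further indices turn
    agreement at single [d] into agreement over a set of constants. *)
Lemma homog1 n lv : chain I lv -> exists m, forall W X a, well_orders (rel_of W) X ->
  ~ le X (lv 0) -> exists Y, [/\ subset Y X, ~ le Y (lv m)
    & forall t t', Tup n W Y t -> Tup n W Y t' -> teq (In_ (lv m)) (opair a t) (opair a t')].
Proof.
move=> ch; have [m0 hm] := erdos_rado (I_emp HI) n ch.
exists (m0 + 6) => W X a wo nX.
have [T hT] := Tup_set n W X; pose D := lv (m0 + 3).
have [w [S [hw tot S1]]] := type_labels (cart (cart (pr a a) T) D).
pose F t p := exists d v, [/\ d ε D, v ε w, p = opair d v & opair (opair (opair a t) d) v ε S].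
have mF t p : p ε cls (F t) <-> F t p.
  apply: (mem_cls_sub (a := cart D w)); first by rewrite /F; dfn.
  by move=> q [d [v [dD vw -> _]]]; apply/mem_cart_pair.
have [||Y [YX nY hY]] := hm W X (fun t => cls (F t)) wo _ _ nX.
- by apply: Tm_cls => [e z|]; [exact: mF|rewrite /F; dfn].
- move=> t _; apply: (chain_pw ch) => p /mF [d [v [dD vw -> _]]].
  apply: (chain_opair ch); first by move: dD; rewrite /D !addnS addn0.
  by apply: (chain_wide ch); apply: (I_end HI) vw.
exists Y; split=> //.
  by apply: not_le_sub nY; apply: (chain_le ch); rewrite leq_addr.
move=> t t' ht ht'; rewrite -[m0 + 6]/(m0 + (3 + 3)) addnA [_ + 3]addnC.
apply: (eqt_teq ch) => d dD; rewrite -/D in dD.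
have U s : Tup n W Y s -> opair (opair a s) d ε cart (cart (pr a a) T) D.
  move=> hs; apply/mem_cart_pair; split=> //; apply/mem_cart_pair; split.
    by apply/mem_pr; left.
  by apply/hT; apply: Tup_sub hs.
have [v [vw vS]] := tot _ (U t ht).
have : opair d v ε cls (F t) by apply/mF; exists d, v.
rewrite (hY t t') // => /mF [d' [v' [_ _ /opair_inj [<- <-] vS']]].
exact: S1 (U t ht) (U t' ht') vS vS'.
Qed.

Lemma homog N lv : chain I lv -> exists m, forall W X a, well_orders (rel_of W) X ->
  ~ le X (lv 0) -> exists Y, [/\ subset Y X, ~ le Y (lv m)
    & forall n, n <= N -> forall t t', Tup n W Y t -> Tup n W Y t' ->
      teq (In_ (lv m)) (opair a t) (opair a t')].
Proof.
elim: N lv => [|N IH] lv ch.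
  have [m hm] := homog1 0 ch; exists m => W X a wo nX.
  have [Y [h1 h2 h3]] := hm W X a wo nX; exists Y; split=> // n.
  by rewrite leqn0 => /eqP ->.
have [m1 h1] := IH lv ch; have [m2 h2] := homog1 N.+1 (chain_shift m1 ch).
exists (m1 + m2) => W X a wo nX; have [Y [YX nY hY]] := h1 W X a wo nX.
have [||Z [ZY nZ hZ]] := h2 W Y a; first exact: wo_sub YX.
  by rewrite addn0.
exists Z; split=> //; first by move=> z /ZY /YX.
move=> n; rewrite leq_eqVlt => /orP [/eqP ->|hn] t t' ht ht'; first exact: hZ.
apply: (@teq_mono M _ (In_ (lv m1))).
  by move=> z; apply: (chain_le ch); rewrite leq_addr.
by apply: (hY n hn); [apply: Tup_sub ht|apply: Tup_sub ht'].
Qed.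

Lemma In_nth (l : seq M) y : List.In y l -> exists2 i, i < size l & nth emp l i = y.
Proof.
by elim: l => //= x l IH [->|/IH [i hi E]]; [exists 0|exists i.+1].
Qed.

Lemma In_iota i m n : m <= i < m + n -> List.In i (iota m n).
Proof.
elim: n m => [|n IH] m; first by rewrite addn0 ltnNge; case: (m <= i).
rewrite leq_eqVlt => /andP [/orP [/eqP ->|mi] h]; [by left|right].
by apply: IH; rewrite mi addSnnS.
Qed.

Lemma fin_le Y K (l : seq M) : wide I K -> (forall y, y ε Y -> List.In y l) -> le Y K.
Proof.
move=> wK hl; pose A y v i := y = nth emp l i /\ v = num i.
pose s := iota 0 (size l).
(* The double negation expresses a finite disjunction by means of [Df_seq_all]. *)
apply: (@le_of_rel M (fun y v => ~ forall i, List.In i s -> ~ A y v i)).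
- by dfn; apply: Df_seq_all => i; rewrite /A; dfn.
- move=> y /hl /In_nth [i hi E]; exists (num i); split; first by apply: wK; apply: I_num.
  by move=> /(_ i (In_iota (m := 0) hi)); apply; split.
- move=> y y' v _ _ h h'; apply: NNPP => ne; apply: h => i _ [Ey Ei].
  by apply: h' => j _ [Ey' Ej]; apply: ne; rewrite Ey Ey' (@num_inj i j) // -Ei.
Qed.

Lemma desc_seg W s y l : desc W s l -> (forall x, List.In x l -> opair x y ε W) ->
  desc W (seg W s y) l.
Proof.
elim: l s => // x l IH s [xs dl] h; split.
  by apply/mem_seg; split=> //; apply: h; left.
have -> : seg W (seg W s y) x = seg W (seg W s x) y.
  by apply: extM => z; rewrite !mem_seg; tauto.
by apply: IH => // z zl; apply: h; right.
Qed.

Lemma desc_mem W s l x : desc W s l -> List.In x l -> x ε s.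
Proof.
elim: l s => // y l IH s [ys dl] [<- //|/(IH _ dl) /mem_seg []] //.
Qed.

Lemma Tup_ex n W Y K : wide I K -> well_orders (rel_of W) Y -> ~ le Y K ->
  exists t, Tup n W Y t.
Proof.
move=> wK wo nY.
(* The list always consists of the first elements of [Y], so the next element is the least of the
   remaining ones. *)
suff [l [<- dl _]] : exists l, [/\ size l = n, desc W Y l
    & forall y, y ε Y -> List.In y l \/ forall x, List.In x l -> opair x y ε W].
  by exists (tup l); apply/Tup_tup.
elim: n => [|n [l [sl dl hl]]]; first by exists [::]; split=> // y _; right.
pose P y := forall x, List.In x l -> opair x y ε W.
have dP : Df1 any P by apply: Df_seq_all => x; dfn.
have [y0 [y0Y nl0]] : exists y, y ε Y /\ ~ List.In y l.
  apply: NNPP => h; apply: nY; apply: (fin_le (l := l) wK) => y yY.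
  by apply: NNPP => nl; apply: h; exists y.
have [||y [yY py hy]] := @wo_least M _ Y P wo; first by [].
  by exists y0; split=> //; case: (hl y0 y0Y).
exists (y :: l); split; first by rewrite /= sl.
  by split=> //; apply: desc_seg.
move=> z zY; case: (hl z zY) => [zl|pz]; first by left; right.
case: (hy z zY pz) => [->|/rel_ofE yz]; first by left; left.
by right=> x [<- //|/pz].
Qed.

Definition homstr (N : nat) L b Y W : Prop := [/\ well_orders (rel_of W) Y, ~ le Y L
  & forall n, n <= N -> forall t t', Tup n W Y t -> Tup n W Y t' ->
    teq (In_ L) (opair b t) (opair b t')].

Lemma homstr_mono N L L' b Y W : subset L' L -> homstr N L b Y W -> homstr N L' b Y W.
Proof.
move=> LL [h1 h2 h3]; split=> //; first exact: not_le_sub LL h2.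
by move=> n hn t t' ht ht'; apply: teq_mono (h3 n hn t t' ht ht').
Qed.

(** Homogeneity is not one formula, but it is a conjunction over formulas and parameters from [L],
    each expressible with constants in [D] because [L] is a subset of [D]. That [L] is also an
    element of [D] serves the clause on size. *)
Lemma homstr_transport N L D x x' (fb fY fW : M -> M) :
  L ε D -> subset L D -> Tm1 (In_ D) fb -> Tm1 (In_ D) fY -> Tm1 (In_ D) fW ->
  teq (In_ D) x x' -> homstr N L (fb x) (fY x) (fW x) -> homstr N L (fb x') (fY x') (fW x').
Proof.
move=> LD subD db dY dW xx [h1 h2 h3]; have ne : exists m, In_ D m by exists L.
have dT n := @Df_Tup M (In_ D) n.
split.
- apply: (@teq_Df M (In_ D) (fun z => well_orders (rel_of (fW z)) (fY z)) x x' ne _ xx).1 => //.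
  by rewrite /well_orders; dfn.
- apply: (@teq_Df M (In_ D) (fun z => ~ le (fY z) L) x x' ne _ xx).1 => //.
  by dfn.
- move=> n hn t t' ht ht' phi e he; have dTn := dT n.
  apply: ((@teq_Df M (In_ D) (fun z => forall t t', Tup n (fW z) (fY z) t ->
    Tup n (fW z) (fY z) t' -> (sat (scons (opair (fb z) t) e) phi <->
    sat (scons (opair (fb z) t') e) phi)) x x' ne _ xx).1) => //.
    have ds (g : (nat -> M) -> M) : Tm (In_ D) g -> Df (In_ D) (fun e' => sat (scons (g e') e) phi).
      move=> dg; apply: (@Df_ext _ _ (fun e' => sat (fun i => (if i is i'.+1 then fun=> e i' else g) e') phi)).
        by move=> e'; apply: sat_ext => -[].
      by apply: Df_sat => -[|i] //; apply: Tm_cst; apply: subD.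
    dfn; by apply: ds; dfn.
  by move=> s s' hs hs'; apply: (h3 n hn).
Qed.

Definition inv a (l : seq M) K : Prop := wide I K /\
  exists X W, homstr (size l) K a X W /\ desc W X l.

Lemma chain_ex K : wide I K -> exists lv, chain I lv /\ lv 0 = K.
Proof.
move=> wK; pose P (K L : M) := [/\ wide I L, forall s, subset s L -> s ε K & subset L K].
have step (k : {K | wide I K}) : exists L : {K | wide I K}, P (proj1_sig k) (proj1_sig L).
  case: k => k wk; have [L [wL tL hL]] := wide_below HI wk wk.
  exists (exist _ L wL); split=> // [s /hL []//|x /tL xL].
  by case: (hL x xL).
pose nx n := proj1_sig (constructive_indefinite_description _ (step n)).
have hnx n : P (proj1_sig n) (proj1_sig (nx n)).
  by rewrite /nx; case: constructive_indefinite_description.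
pose kv i := iter i nx (exist _ K wK).
exists (fun i => proj1_sig (kv i)); split=> //; split=> i.
- by case: (kv i).
- by case: (hnx (kv i)).
- by case: (hnx (kv i)).
Qed.

Lemma inv_start : exists K, inv emp [::] K.
Proof.
have [x nx] : exists x, ~ I x by case: HI => _ [].
have [t [tt xt]] := TC_sup x; have [K [wK _ _]] := wide_le HI tt xt nx.
exists K; split=> //; have [W wo] := wo_ex (pw K).
exists (pw K), W; split=> //; split=> //; first exact: not_le_pw.
by move=> n; rewrite leqn0 => /eqP -> t1 t2 /= -> ->.
Qed.

(* First absorb m for some tuple s of the homogeneous set, where the value at
   s of a function F on all tuples realises the type of m; then move s to l. *)
Lemma inv_absorb a l K m : inv a l K ->
  exists F L, inv (opair a F) l L /\ app F (tup l) = m.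
Proof.
move=> [wK [X [W [[wo nX hX] dl]]]]; have [lv [ch lv0]] := chain_ex wK.
rewrite -{}lv0 in nX hX {wK}; set N := size l in hX; pose t0 := tup l.
have ht0 : Tup N W X t0 by apply/Tup_tup.
have [T hT] := Tup_set N W X; have dT := @Df_Tup M any N.
(* For finitely many formulas, choice in the model gives a function whose value at every [s] behaves
   as [m] does at [t0]; saturation then covers all formulas. *)
have [|||F [_ hF]] := @saturationQ (fun F d1 d2 => exists s d, [/\ Tup N W X s, d ε lv 1,
    d1 = opair (opair (opair a t0) m) d & d2 = opair (opair (opair a s) (app F s)) d])
  (fun=> True); [by dfn|by dfn| |].
  move=> ll.
  have [||F hF] := @choiceM M (fun s y => forall phi, List.In phi ll -> forall d, d ε lv 1 ->
    (sat (fun=> opair (opair (opair a t0) m) d) phi <->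
     sat (fun=> opair (opair (opair a s) y) d) phi)) T.
  - by apply: Df_seq_all => phi; dfn; dfn_sat; dfn.
  - move=> s /hT hs; apply: (fin_ext m ll ch); exact: (hX N).
  exists F; split=> // d1 d2 [s [d [hs dd -> ->]]] phi pl; apply: hF => //.
  by apply/hT.
have {}hF s : Tup N W X s -> teq (In_ (lv 4)) (opair (opair a s) (app F s)) (opair (opair a t0) m).
  move=> hs; apply: teq_sym; apply: (eqt_teq (i := 1) ch) => d dd.
  by apply: hF; exists s, d.
have ch4 := chain_shift 4 ch; have ch8 := chain_shift 8 ch.
have [m1 hm] := homog N ch8.
have [|Y [YX nY hY]] := hm W X (opair a F) wo.
  by apply: not_le_sub nX; apply: (chain_le ch).
(* One index beyond what homogeneity needs, so that [L] is itself an element of [lv 8]. The 8 is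
   made of four indices for comparing [app F s] with [m] and four for [hom_ext]. *)
pose L := lv (8 + m1).+1.
have LD : L ε lv 8.
  apply: (chain_le ch (i := 8) (j := 8 + m1)); first by rewrite leq_addr.
  exact: (chain_pw ch).
have LsD : subset L (lv 8) by apply: (chain_le ch); rewrite -addnS leq_addr.
have hL : homstr N L (opair a F) Y W.
  apply: (@homstr_mono _ (lv (8 + m1))); first exact: (chain_sub ch).
  by split=> //; exact: wo_sub YX.
have [s hs] : exists s, Tup N W Y s.
  by case: (hL) => w1 w2 _; apply: Tup_ex w1 w2; apply: (chain_wide ch).
have [z hz] := hom_ext (opair F (opair Y W)) ch4 (hF s (Tup_sub YX hs)).
rewrite -[4 + 4]/8 in hz.
have ne : exists m, In_ (lv 8) m by exists L.
exists (p1 z), L; split.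
  split; first exact: (chain_wide ch).
  exists (p1 (p2 z)), (p2 (p2 z)); split.
    have := @homstr_transport N L (lv 8) _ _
      (fun u => opair (p1 (p1 (p1 u))) (p1 (p2 u)))
      (fun u => p1 (p2 (p2 u))) (fun u => p2 (p2 (p2 u))) LD LsD _ _ _ hz.
    by rewrite !(p1E, p2E); apply=> //; dfn.
  have dTn := @Df_Tup M (In_ (lv 8)) N.
  have := (@teq_Df M _ (fun u => Tup N (p2 (p2 (p2 u))) (p1 (p2 (p2 u))) (p2 (p1 (p1 u))))
    _ _ ne _ hz).1.
  by rewrite !(p1E, p2E) => h; apply/Tup_tup; apply: h => //; dfn.
have := (@teq_Df M _ (fun u => app (p1 (p2 u)) (p2 (p1 (p1 u))) = p2 (p1 u)) _ _ ne _ hz).1.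
by rewrite !(p1E, p2E); apply=> //; dfn.
Qed.

(** Positions are counted from the outermost, largest component, in step with [take k] and [drop k]
    on descending lists. *)
Fixpoint Ins (k : nat) t t' : Prop :=
  if k is k'.+1 then
    exists u u' x, [/\ t = opair u x, t' = opair u' x & Ins k' u u']
  else exists c, t' = opair t c.

Lemma Df_Ins C (k : nat) : Df2 C (Ins k).
Proof. by elim: k => [|k IH]; rewrite /Ins -/Ins; dfn. Qed.

Lemma Ins_tup (k : nat) l t' : k <= size l -> Ins k (tup l) t' ->
  exists c, t' = tup (take k l ++ c :: drop k l).
Proof.
elim: k l t' => [|k IH] l t'; first by move=> _ [c ->]; exists c; rewrite take0 drop0.
case: l => // x l hk [u [u' [x' [/= /opair_inj [<- <-] -> /(IH l _ hk) [c ->]]]]].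
by exists c.
Qed.

Lemma Ins_ex n (k : nat) W Y t' : k <= n -> Tup n.+1 W Y t' ->
  exists t, Tup n W Y t /\ Ins k t t'.
Proof.
elim: k n Y t' => [|k IH] n Y t' hk [t [x [-> xY ht]]].
  by exists t; split; [apply: Tup_sub ht => y /mem_seg []|exists x].
case: n hk ht => // n hk ht; have [u [hu iu]] := IH n _ _ hk ht.
by exists (opair u x); split; [exists u, x|exists u, t, x].
Qed.

(** Choose a tuple with one more entry in a subset homogeneous for the greater length, and delete
    its [k]-th entry. The remainder has the type of [l], so moving it to [l] carries the deleted
    entry to the required [c]. *)
Lemma inv_insert a l K (k : nat) : inv a l K -> k <= size l ->
  exists c L, inv a (take k l ++ c :: drop k l) L.
Proof.
move=> [wK [X [W [[wo nX hX] dl]]]] hk; have [lv [ch lv0]] := chain_ex wK.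
rewrite -{}lv0 in nX hX {wK}; set N := size l in hX hk; pose t0 := tup l.
have ht0 : Tup N W X t0 by apply/Tup_tup.
have ch4 := chain_shift 4 ch.
have [m1 hm] := homog N.+1 ch4.
have [|Y [YX nY hY]] := hm W X a wo.
  by apply: not_le_sub nX; apply: (chain_le ch).
pose L := lv (4 + m1).+1.
have LD : L ε lv 4.
  apply: (chain_le ch (i := 4) (j := 4 + m1)); first by rewrite leq_addr.
  exact: (chain_pw ch).
have LsD : subset L (lv 4) by apply: (chain_le ch); rewrite -addnS leq_addr.
have hL : homstr N.+1 L a Y W.
  apply: (@homstr_mono _ (lv (4 + m1))); first exact: (chain_sub ch).
  by split=> //; exact: wo_sub YX.
have [s' hs'] : exists s, Tup N.+1 W Y s.
  by case: (hL) => w1 w2 _; apply: Tup_ex w1 w2; apply: (chain_wide ch).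
have [s [hs is_]] := Ins_ex hk hs'.
have [z hz] := hom_ext (opair s' (opair Y W)) ch (hX N (leqnn N) s t0 (Tup_sub YX hs) ht0).
have ne : exists m, In_ (lv 4) m by exists L.
have dI := @Df_Ins (In_ (lv 4)) k; have dTn := @Df_Tup M (In_ (lv 4)) N.+1.
have [c Ec] : exists c, p1 z = tup (take k l ++ c :: drop k l).
  apply: Ins_tup => //.
  have := (@teq_Df M _ (fun u => Ins k (p2 (p1 u)) (p1 (p2 u))) _ _ ne _ hz).1.
  by rewrite !(p1E, p2E); apply=> //; dfn.
have sz : size (take k l ++ c :: drop k l) = N.+1.
  by rewrite size_cat /= addnS -size_cat cat_take_drop.
exists c, L; split; first exact: (chain_wide ch).
exists (p1 (p2 z)), (p2 (p2 z)); split.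
  have := @homstr_transport N.+1 L (lv 4) _ _
    (fun u => p1 (p1 u)) (fun u => p1 (p2 (p2 u))) (fun u => p2 (p2 (p2 u))) LD LsD _ _ _ hz.
  by rewrite !(p1E, p2E) sz; apply=> //; dfn.
apply/Tup_tup; rewrite sz -Ec.
have := (@teq_Df M _ (fun u => Tup N.+1 (p2 (p2 (p2 u))) (p1 (p2 (p2 u))) (p1 (p2 u)))
  _ _ ne _ hz).1.
by rewrite !(p1E, p2E); apply=> //; dfn.
Qed.

(** A wide [L0] inside [K2] injects into the large set [X], and [g] is the inverse of this
    injection, taken on one-entry tuples. Its domain [X1] is still large, so a homogeneous subset
    can be found there and one of its tuples moved to [l]. [L0] joins the parameter so that later
    stages can refer to it. *)
Lemma inv_target a l K K2 : inv a l K -> wide I K2 -> exists g L0 L,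
  [/\ subset L0 K2, inv (opair a (opair g L0)) l L,
      forall c, List.In c l -> app g (tup [:: c]) ε L0
    & forall c c', List.In c l -> List.In c' l ->
        app g (tup [:: c]) = app g (tup [:: c']) -> c = c'].
Proof.
move=> [wK [X [W [[wo nX hX] dl]]]] wK2; have [kv [kch kv0]] := chain_ex wK.
rewrite -{}kv0 in nX hX {wK}; set N := size l in hX; pose t0 := tup l.
have ht0 : Tup N W X t0 by apply/Tup_tup.
(* Choosing [L0] as an element of [kv 4] makes it a constant for the final transfer, which therefore
   leaves it unchanged. *)
have [L0 [wL0 tL0 hL0]] := wide_below HI (chain_wide kch 4) wK2.
have L0K : subset L0 (kv 4) by move=> x /tL0 /hL0 [].
have L0K' : L0 ε kv 4 by case: (hL0 L0).
have [lv [ch lv0]] := chain_ex wL0.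
have [e ie] : le L0 X.
  case: (le_total L0 X) => // XL; case: nX; apply: le_trans XL _.
  apply: le_refl_sub => x /L0K; exact: (chain_le kch).
case: (ie) => e1 e2.
have [|X1 hX1] := @sep_ex M (fun x => exists v, v ε L0 /\ opair v x ε e) X; first by dfn.
have X1X : subset X1 X by move=> x /hX1 [].
(* All subsets of [lv 1] are elements of [L0], which injects into [X1]; so Cantor's theorem
   applies. *)
have nX1 : ~ le X1 (lv 1).
  move=> h; apply: (@not_le_pw M (lv 1)); apply: le_trans h.
  apply: (@le_trans M _ L0).
    by apply: le_refl_sub => s /mem_pw; rewrite -lv0; apply: (chain_pw ch).
  exists e; split=> [v vL|]; last exact: e2.
  have [x [xX vx]] := e1 v vL; exists x; split=> //.
  by apply/hX1; split=> //; exists v.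
have [|g hg] := @sep_ex M (fun p => exists x v, [/\ p = opair (opair emp x) v, v ε L0,
    x ε X & opair v x ε e]) (cart (cart (pr emp emp) X) L0); first by dfn.
have gE : forall x v, x ε X1 -> v ε L0 -> opair v x ε e -> app g (opair emp x) = v.
  move=> x v xX1 vL vx; apply: appE.
    apply/hg; split; last by exists x, v; split=> //; apply: X1X.
    do 2 (apply/mem_cart_pair; split=> //); last exact: X1X.
    by apply/mem_pr; left.
  move=> v' /hg [_ [x' [v1 [/opair_inj [/opair_inj [_ <-] <-] v'L _ v'x]]]].
  by apply/(e2 _ _ _ _ v'L vL v'x vx).
have gL x : x ε X1 -> app g (opair emp x) ε L0.
  by move=> xX1; case/hX1: (xX1) => _ [v [vL vx]]; rewrite (gE x v).
have gI x x' : x ε X1 -> x' ε X1 -> app g (opair emp x) = app g (opair emp x') -> x = x'.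
  move=> xX1 xX1'; case/hX1: (xX1) => _ [v [vL vx]]; case/hX1: (xX1') => _ [v' [vL' vx']].
  by rewrite (gE x v) // (gE x' v') // => E; apply/(e2 _ _ _ _ vL vL' vx vx').
have [m1 hm] := homog N (chain_shift 1 ch).
have [||Y [YX1 nY hY]] := hm W X1 (opair a (opair g L0)); first exact: wo_sub X1X.
  by rewrite addn0.
have YX : subset Y X by move=> y /YX1 /X1X.
pose L := lv (1 + m1).+1.
have lvD i : subset (lv i) (kv 4).
  by move=> x /(chain_le ch (leq0n i)); rewrite lv0; apply: L0K.
have LD : L ε kv 4 by apply: (lvD (1 + m1)); apply: (chain_pw ch).
have LsD : subset L (kv 4) by apply: lvD.
have hL : homstr N L (opair a (opair g L0)) Y W.
  apply: (@homstr_mono _ (lv (1 + m1))); first exact: (chain_sub ch).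
  by split=> //; exact: wo_sub YX.
have [s hs] : exists s, Tup N W Y s.
  by case: (hL) => w1 w2 _; apply: Tup_ex w1 w2; apply: (chain_wide ch).
have [z hz] := hom_ext (opair g (opair Y W)) kch (hX N (leqnn N) s t0 (Tup_sub YX hs) ht0).
have ne : exists m, In_ (kv 4) m by exists L.
have dTn := @Df_Tup M (In_ (kv 4)) N.
have dY : desc (p2 (p2 z)) (p1 (p2 z)) l.
  apply/Tup_tup.
  have := (@teq_Df M _ (fun u => Tup N (p2 (p2 (p2 u))) (p1 (p2 (p2 u))) (p2 (p1 u)))
    _ _ ne _ hz).1.
  by rewrite !(p1E, p2E); apply=> //; dfn.
exists (p1 z), L0, L; split.
- by move=> x /tL0 /hL0 [].
- split; first exact: (chain_wide ch).
  exists (p1 (p2 z)), (p2 (p2 z)); split=> //.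
  have := @homstr_transport N L (kv 4) _ _
    (fun u => opair (p1 (p1 u)) (opair (p1 (p2 u)) L0))
    (fun u => p1 (p2 (p2 u))) (fun u => p2 (p2 (p2 u))) LD LsD _ _ _ hz.
  by rewrite !(p1E, p2E); apply=> //; dfn.
- move=> c /(desc_mem dY) cY.
  have := (@teq_Df M _ (fun u => forall x, x ε p1 (p2 (p2 u)) ->
    app (p1 (p2 u)) (opair emp x) ε L0) _ _ ne _ hz).1.
  rewrite !(p1E, p2E); apply=> //; first by dfn.
  by move=> x /YX1; apply: gL.
- move=> c c' /(desc_mem dY) cY /(desc_mem dY) cY'.
  have := (@teq_Df M _ (fun u => forall x x', x ε p1 (p2 (p2 u)) -> x' ε p1 (p2 (p2 u)) ->
    app (p1 (p2 u)) (opair emp x) = app (p1 (p2 u)) (opair emp x') -> x = x') _ _ ne _ hz).1.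
  rewrite !(p1E, p2E); apply=> //; first by dfn.
  by move=> x x' /YX1 xX /YX1 xX'; apply: gI.
Qed.

End Types.

(** * Stages and the action *)

Import Order.TTheory GRing.Theory Num.Theory.

Section Rationals.

Definition descr (ks : seq rat) : bool := pairwise (fun x y => (y < x)%R) ks.

Lemma descr_insert (ks : seq rat) (q : rat) : descr ks -> q \notin ks ->
  exists2 k, k <= size ks & descr (take k ks ++ q :: drop k ks).
Proof.
elim: ks => [|x ks IH]; first by exists 0.
rewrite inE negb_or /descr /= => /andP [hx hks] /andP [qx qks].
case: (ltgtP q x) qx => // qx _.
  have [k hk hd] := IH hks qks; exists k.+1; rewrite //= [pairwise _ _]hd andbT.
  apply/allP => y; rewrite mem_cat inE orbCA -mem_cat cat_take_drop.
  by move=> /predU1P [->|/(allP hx)].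
exists 0; rewrite //= hx hks qx /= andbT.
by apply/allP => y /(allP hx) yx; apply: lt_trans yx qx.
Qed.

Lemma descr_uniq ks : descr ks -> uniq ks.
Proof.
by rewrite /descr; elim: ks => //= x ks IH /andP [/allP hx /IH ->]; rewrite andbT;
  apply/negP => /hx; rewrite ltxx.
Qed.

Lemma descr_union (ks ks' : seq rat) : exists2 u, descr u & {subset ks <= u} /\ {subset ks' <= u}.
Proof.
suff [u du hu] : exists2 u, descr u & {subset ks ++ ks' <= u}.
  by exists u => //; split=> x hx; apply: hu; rewrite mem_cat hx ?orbT.
elim: (ks ++ ks') => [|q l [u du hu]]; first by exists [::].
have [qu|nqu] := boolP (q \in u).
  by exists u => // x; rewrite inE => /predU1P [->|/hu].
have [k hk dk] := descr_insert du nqu; exists (take k u ++ q :: drop k u) => // x.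
rewrite inE mem_cat inE orbCA -mem_cat cat_take_drop => /predU1P [->|/hu ->].
  by rewrite eqxx.
by rewrite orbT.
Qed.

Lemma descr_map (j : Aut rat_order) ks : descr ks -> descr (map j ks).
Proof.
rewrite /descr pairwise_map; apply: sub_pairwise => x y yx.
by apply: (aut_rel j y x).2.
Qed.

End Rationals.

Section Stages.

Variables (M : zmodel) (I : M -> Prop).
Hypotheses (HI : H_cut I) (sat_M : recursively_saturated M).
Implicit Types (a b c d x y z w s t u v g h W X Y K L : M).

Definition comp a f : Prop := exists g : M -> M, Tm1 (@noc M) g /\ f = g a.

Lemma comp_refl a : comp a a.
Proof. by exists id; split=> //; apply: Tm_var. Qed.

Lemma comp_trans a b f : comp a b -> comp b f -> comp a f.
Proof.
move=> [g [dg ->]] [h [dh ->]]; exists (fun x => h (g x)); split=> //.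
exact: (Tm_fun1 dh dg).
Qed.

Lemma comp_p1 a b : comp (opair a b) a.
Proof. by exists (@p1 M); split; [dfn|rewrite p1E]. Qed.

Lemma comp_p2 a b : comp (opair a b) b.
Proof. by exists (@p2 M); split; [dfn|rewrite p2E]. Qed.

(** Each point carries its rational. At least two points are kept so that [targeted] can exhibit a
    pair separated by its function. *)
Record stage := Stage {
  st_a : M;
  st_l : seq (rat * M);
  st_K : M;
  st_inv : inv I st_a (map snd st_l) st_K;
  st_desc : descr (map fst st_l);
  st_two : 1 < size st_l
}.
Implicit Types (S : stage).

Definition ext S S' : Prop := comp (st_a S') (st_a S) /\
  forall p, List.In p (st_l S) -> List.In p (st_l S').

Lemma ext_refl S : ext S S. Proof. by split=> //; apply: comp_refl. Qed.

Lemma ext_trans S S' S'' : ext S S' -> ext S' S'' -> ext S S''.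
Proof.
move=> [h1 h2] [k1 k2]; split=> [|p /h2 /k2] //; exact: comp_trans k1 h1.
Qed.

Lemma In_cat (T : Type) (x : T) (l l' : seq T) :
  List.In x (l ++ l') <-> List.In x l \/ List.In x l'.
Proof. by elim: l => [|y l IH] /=; [|rewrite IH]; tauto. Qed.

Lemma stage_insert (l : seq (rat * M)) a K q : inv I a (map snd l) K -> descr (map fst l) ->
  q \notin map fst l -> exists l' K', [/\ inv I a (map snd l') K', descr (map fst l'),
    forall p, List.In p l -> List.In p l', exists c, List.In (q, c) l' & size l <= size l'].
Proof.
move=> il dl nq; have [k hk dk] := descr_insert dl nq; rewrite size_map in hk.
have [|c [L iL]] := inv_insert HI sat_M (k := k) il; first by rewrite size_map.
exists (take k l ++ (q, c) :: drop k l), L; split.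
- by rewrite map_cat /= map_take map_drop.
- by rewrite map_cat /= map_take map_drop.
- move=> p; rewrite -{1}(cat_take_drop k l) !In_cat /=; tauto.
- by exists c; apply/In_cat; right; left.
- by rewrite size_cat /= addnS -size_cat cat_take_drop.
Qed.

Lemma stage_start : inhabited stage.
Proof.
have [K i0] := inv_start HI.
have [//|c [K1 i1]] := inv_insert HI sat_M (k := 0) i0.
have [//|c' [K2 i2]] := inv_insert HI sat_M (k := 0) i1.
by constructor; exists emp [:: (1%R, c'); (0%R, c)] K2.
Qed.

Definition absorbed S m : Prop := exists F l, [/\ comp (st_a S) F, descr (map fst l),
  forall p, List.In p l -> List.In p (st_l S) & app F (tup (map snd l)) = m].

Definition placed S (q : rat) : Prop := exists c, List.In (q, c) (st_l S).

(** Only one sample pair is recorded; indiscernibility extends the facts to all rationals once the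
    construction is complete. *)
Definition targeted S K : Prop := exists g L q q' c c', [/\ comp (st_a S) g, comp (st_a S) L,
  subset L K & [/\ List.In (q, c) (st_l S), List.In (q', c') (st_l S), (q' < q)%R,
    app g (tup [:: c]) ε L & app g (tup [:: c]) <> app g (tup [:: c'])]].

Lemma absorbed_ext S S' m : ext S S' -> absorbed S m -> absorbed S' m.
Proof.
move=> [h1 h2] [F [l [k1 k2 k3 k4]]]; exists F, l; split=> // [|p /k3 /h2] //.
exact: comp_trans h1 k1.
Qed.

Lemma placed_ext S S' q : ext S S' -> placed S q -> placed S' q.
Proof. by move=> [_ h] [c /h]; exists c. Qed.

Lemma step_absorb S m : exists S', ext S S' /\ absorbed S' m.
Proof.
case: S => a l K il dl tl; have [F [L [iL E]]] := inv_absorb HI sat_M m il.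
exists (Stage iL dl tl); split; first by split=> //=; apply: comp_p1.
by exists F, l; split=> //; apply: comp_p2.
Qed.

Lemma step_place S q : exists S', ext S S' /\ placed S' q.
Proof.
case: S => a l K il dl tl; case: (boolP (q \in map fst l)) => hq.
  exists (Stage il dl tl); split; first exact: ext_refl.
  rewrite /placed /=; elim: (l) hq => //= -[q' c] l' IH; rewrite inE.
  by move=> /predU1P [->|/IH [c' ?]]; [exists c; left|exists c'; right].
have [l' [K' [i' d' s' p' z']]] := stage_insert il dl hq.
exists (Stage i' d' (leq_trans tl z')); split=> //.
by split=> //; apply: comp_refl.
Qed.

Lemma inv_distinct a c c' l K : inv I a (c :: c' :: l) K -> c <> c'.
Proof.
move=> [_ [X [W [[wo _ _] [cX [/mem_seg [c'X h] _]]]]]] E; subst c'.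
by case: wo => irr _ _ _; apply: (irr c) => //; apply/rel_ofE.
Qed.

Lemma step_target S K : wide I K -> exists S', ext S S' /\ targeted S' K.
Proof.
case: S => a l K0 il dl tl wK.
have [g [L0 [L [LK iL gL gI]]]] := inv_target HI sat_M il wK.
exists (Stage iL dl tl); split; first by split=> //=; apply: comp_p1.
case: l il dl tl iL gL gI => [|[q c] [|[q' c'] l]] // il dl tl iL gL gI.
exists g, L0, q, q', c, c'; split=> //=.
- exact: comp_trans (comp_p2 _ _) (comp_p1 _ _).
- exact: comp_trans (comp_p2 _ _) (comp_p2 _ _).
split; [by left|by right; left| | |].
- by move: dl; rewrite /descr /= => /andP [/andP []].
- by apply: gL; left.
- by move=> /gI E; apply: (inv_distinct il); apply: E; [left|right; left].
Qed.

Variable e : nat -> M.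
Hypothesis e_surj : forall m, exists n, e n = m.

Definition qenum (n : nat) : rat := odflt 0%R (unpickle n).

Lemma step_all S n : exists S', [/\ ext S S', absorbed S' (e n), placed S' (qenum n)
  & wide I (e n) -> targeted S' (e n)].
Proof.
have [S1 [x1 a1]] := step_absorb S (e n).
have [S2 [x2 p2]] := step_place S1 (qenum n).
case: (classic (wide I (e n))) => w; last first.
  exists S2; split=> //; first exact: ext_trans x1 x2.
  exact: absorbed_ext x2 a1.
have [S3 [x3 t3]] := step_target S2 w; exists S3; split=> //.
- exact: ext_trans (ext_trans x1 x2) x3.
- exact: absorbed_ext (ext_trans x2 x3) a1.
- exact: placed_ext x3 p2.
Qed.

Definition next S n : stage :=
  proj1_sig (constructive_indefinite_description _ (step_all S n)).

Lemma nextP S n : [/\ ext S (next S n), absorbed (next S n) (e n), placed (next S n) (qenum n)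
  & wide I (e n) -> targeted (next S n) (e n)].
Proof. by rewrite /next; case: constructive_indefinite_description. Qed.

Fixpoint sq (n : nat) : stage :=
  if n is n'.+1 then next (sq n') n'
  else epsilon stage_start (fun=> True).

Lemma sq_ext m n : m <= n -> ext (sq m) (sq n).
Proof.
elim: n => [|n IH]; first by rewrite leqn0 => /eqP ->; apply: ext_refl.
rewrite leq_eqVlt => /orP [/eqP ->|/IH h]; first exact: ext_refl.
by apply: ext_trans h _; case: (nextP (sq n) n).
Qed.

(** Inclusion of entries is all that is given; since both lists of rationals descend, the smaller
    list occurs in the larger one in the same order. *)
Lemma desc_select W (sl l : seq (rat * M)) s : desc W s (map snd sl) ->
  descr (map fst sl) -> descr (map fst l) -> (forall p, List.In p l -> List.In p sl) ->
  desc W s (map snd l).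
Proof.
have below (p p' : rat * M) l' : descr (map fst (p :: l')) -> List.In p' l' -> (p'.1 < p.1)%R.
  rewrite /descr /= => /andP [/allP h _] hp; apply: h.
  by elim: l' hp => //= x l' IH [->|/IH h]; rewrite inE ?eqxx ?h ?orbT.
elim: sl s l => [|p0 sl IH] s l.
  by case: l => // p l _ _ _ /(_ p (or_introl erefl)).
move=> [p0s dsl] dp0 dl sub; have dsl' : descr (map fst sl) by case/andP: dp0.
case: l dl sub => // p l dl sub; have dl' : descr (map fst l) by case/andP: dl.
have tail q : List.In q l -> (p.1 <= p0.1)%R -> List.In q sl.
  move=> ql le; case: (sub q (or_intror ql)) => // E; subst q.
  by have := below _ _ _ dl ql; rewrite ltNge le.
case: (sub p (or_introl erefl)) => [E|psl].
  subst p0; split=> //; apply: IH => // q ql; exact: tail.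
apply: (@desc_sub _ _ (seg W s p0.2)); first by move=> z /mem_seg [].
apply: (IH _ (p :: l)) => // q [<- //|ql]; apply: tail => //.
by apply: ltW; apply: below psl.
Qed.

Lemma keys_inj (sl : seq (rat * M)) q c c' : descr (map fst sl) ->
  List.In (q, c) sl -> List.In (q, c') sl -> c = c'.
Proof.
move=> /descr_uniq; elim: sl => //= p sl IH /andP [np us].
have nin d : List.In (p.1, d) sl -> False.
  move=> h; case/negP: np; elim: (sl) h => //= x l' IH' [->|/IH' h]; by rewrite inE ?eqxx ?h ?orbT.
move=> [E|h] [E'|h']; last exact: IH.
- by move: E'; rewrite E => -[].
- by case: (nin c'); rewrite E.
- by case: (nin c); rewrite E'.
Qed.

Lemma placed_all q : exists n, placed (sq n) q.
Proof.
exists (pickle q).+1; case: (nextP (sq (pickle q)) (pickle q)) => _ _ h _.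
by move: h; rewrite /qenum pickleK.
Qed.

Definition cq (q : rat) : M :=
  epsilon (inhabited_model M) (fun c => exists n, List.In (q, c) (st_l (sq n))).

Lemma cqP q : exists n, List.In (q, cq q) (st_l (sq n)).
Proof.
apply: (epsilon_spec (inhabited_model M) (fun c => exists n, List.In (q, c) (st_l (sq n)))).
by have [n [c h]] := placed_all q; exists c, n.
Qed.

Lemma cq_eq n q c : List.In (q, c) (st_l (sq n)) -> c = cq q.
Proof.
move=> h; have [m hm] := cqP q.
have [_ h1] := sq_ext (leq_maxl n m); have [_ h2] := sq_ext (leq_maxr n m).
exact: (keys_inj (st_desc _) (h1 _ h) (h2 _ hm)).
Qed.

Lemma cq_stage (ks : seq rat) : exists n, forall m, n <= m ->
  forall q, q \in ks -> List.In (q, cq q) (st_l (sq m)).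
Proof.
elim: ks => [|q ks [n hn]]; first by exists 0.
have [n' hn'] := cqP q; exists (maxn n n') => m; rewrite geq_max => /andP [h1 h2] x.
rewrite inE => /predU1P [->|]; last exact: hn.
by have [_] := sq_ext h2; apply.
Qed.

Definition cst (n : nat) z : Prop := comp (st_a (sq n)) z \/ I z.

Lemma cst_mono m n z : m <= n -> cst m z -> cst n z.
Proof.
move=> mn [h|h]; [left|by right]; apply: comp_trans h.
by have [] := sq_ext mn.
Qed.

(** At a later stage where all rationals involved are placed, both tuples come from its homogeneous
    set. Constants computed from an earlier parameter become terms in the current one, and those in
    [I] belong to the wide set of that stage. *)
Lemma indiscernible n (ks ks' : seq rat) : descr ks -> descr ks' -> size ks = size ks' ->
  teq (cst n) (tup (map cq ks)) (tup (map cq ks')).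
Proof.
move=> dk dk' sk; have [n1 h1] := cq_stage (ks ++ ks').
pose m := maxn n n1; have {}h1 := h1 m (leq_maxr n n1).
have [wK [X [W [[wo _ hom] dX]]]] := st_inv (sq m).
have dm := st_desc (sq m).
have sel us : descr us -> {subset us <= ks ++ ks'} -> size us <= size (st_l (sq m)) /\
    Tup (size us) W X (tup (map cq us)).
  move=> du hu; pose l := [seq (q, cq q) | q <- us].
  have lin p : List.In p l -> List.In p (st_l (sq m)).
    have {}hu q : q \in us -> List.In (q, cq q) (st_l (sq m)) by move=> /hu; apply: h1.
    rewrite /l; elim: (us) hu => //= q us' IH hu [<-|].
      by apply: hu; rewrite inE eqxx.
    by apply: IH => x xu; apply: hu; rewrite inE xu orbT.
  have E1 : map fst l = us by rewrite -map_comp map_id_in.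
  have E2 : map snd l = map cq us by rewrite -map_comp.
  split; last first.
    rewrite -(size_map cq us); apply/Tup_tup; rewrite -E2.
    by apply: (desc_select dX dm) => //; rewrite E1.
  rewrite -E1 -(size_map fst (st_l (sq m))); apply: uniq_leq_size.
    by rewrite E1 descr_uniq.
  move=> q; rewrite E1 => /hu /h1 hq.
  by elim: (st_l (sq m)) hq => //= x l' IH' [->|/IH' h]; rewrite inE ?eqxx ?h ?orbT.
have [s1 t1] := sel ks dk (fun q hq => etrans (mem_cat _ _ _) (introT orP (or_introl hq))).
have [_ t2] := sel ks' dk' (fun q hq => etrans (mem_cat _ _ _) (introT orP (or_intror hq))).
rewrite -sk in t2; rewrite size_map in hom.
have h := hom _ s1 _ _ t1 t2.
set L := st_K (sq m) in wK h; set a := st_a (sq m) in h.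
move=> phi e' he.
have G i : exists g : M -> M, Tm1 (fun z => z ε L) g /\ e' i = g a.
  case: (cst_mono (leq_maxl n n1) (he i)) => [[g [dg E]]|Ie].
    by exists g; split=> //; apply: Dfn_mono dg.
  by exists (fun=> e' i); split=> //; apply: Tm_cst; apply: wK.
pose g i := proj1_sig (constructive_indefinite_description _ (G i)).
have gP i : Tm1 (fun z => z ε L) (g i) /\ e' i = g i a.
  by rewrite /g; case: constructive_indefinite_description.
pose env z i := if i is i'.+1 then g i' (p1 z) else p2 z.
have E t : sat (scons t e') phi <-> sat (env (opair a t)) phi.
  by apply: sat_ext => -[|i]; rewrite /env /= ?p2E // p1E; case: (gP i).
rewrite !E; apply: (@teq_Df M (fun z => z ε L) (fun z => sat (env z) phi)) h.
  by exists emp; apply: wK; apply: I_emp HI.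
apply: Df_sat => -[|i]; rewrite /env; first by dfn.
by have [dg _] := gP i; apply: (Tm_fun1 dg); dfn.
Qed.

Lemma represented m : exists n F ks, [/\ comp (st_a (sq n)) F, descr ks
  & m = app F (tup (map cq ks))].
Proof.
have [k <-] := e_surj m; case: (nextP (sq k) k) => _ [F [l [h1 h2 h3 h4]]] _ _.
exists k.+1, F, (map fst l); split=> //; rewrite -h4; congr (app F (tup _)).
elim: l h3 {h2 h4} => //= -[q c] l IH h; rewrite (cq_eq (n := k.+1) (h _ (or_introl erefl))).
by congr cons; apply: IH => p hp; apply: h; right.
Qed.

Lemma target K : wide I K -> exists n g, comp (st_a (sq n)) g /\
  (forall q, app g (tup [:: cq q]) ε K) /\
  (forall q q', app g (tup [:: cq q]) = app g (tup [:: cq q']) -> q = q').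
Proof.
have [k <-] := e_surj K => wK; case: (nextP (sq k) k) => _ _ _ /(_ wK).
move=> [g [L [q0 [q1 [c0 [c1 [cg cL LK [in0 in1 q10 gL gn]]]]]]]].
exists k.+1, g; split=> //.
rewrite (cq_eq (n := k.+1) in0) in gL gn; rewrite (cq_eq (n := k.+1) in1) in gn.
have ne : exists m, cst k.+1 m by exists emp; right; apply: I_emp HI.
have Cg : cst k.+1 g by left.
have CL : cst k.+1 L by left.
split=> [q|].
  apply: LK; have h := @indiscernible k.+1 [:: q0] [:: q] isT isT erefl.
  by apply: (@teq_Df M _ (fun z => app g z ε L) _ _ ne _ h).1 => //; dfn.
have key q q' : (q' < q)%R -> app g (tup [:: cq q]) <> app g (tup [:: cq q']).
  move=> qq; have d0 : descr [:: q0; q1] by rewrite /descr /= q10.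
  have d1 : descr [:: q; q'] by rewrite /descr /= qq.
  have h := indiscernible (n := k.+1) d0 d1 erefl.
  have := (@teq_Df M _ (fun z => app g (opair emp (p2 z)) <> app g (p1 z)) _ _ ne _ h).1.
  by rewrite /= !p1E !p2E; apply=> //; dfn.
move=> q q' E; case: (ltgtP q q') => // h; first by case: (key _ _ h).
by case: (key _ _ h).
Qed.

(** Extraction of a subtuple is definable uniformly in the assignment [d], hence commutes with the
    action on rationals. *)
Lemma select (us ks : seq rat) : descr us -> descr ks -> {subset ks <= us} ->
  exists G : M -> M, Tm1 (@noc M) G /\
    forall d : rat -> M, G (tup (map d us)) = tup (map d ks).
Proof.
elim: us ks => [|x us IH] ks.
  by case: ks => [|q ks] _ _ h; [exists id; split=> //; apply: Tm_var|have := h q (mem_head _ _)].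
move=> /andP [hx dus] dks sub.
case: ks dks sub => [|q ks] dks sub.
  by exists (fun=> emp); split=> //; apply: Tm_emp.
have tail (y : rat) : y \in ks -> (q <= x)%R -> y \in us.
  move=> yk qx; have := sub y; rewrite !inE yk orbT => /(_ isT) /predU1P [E|//].
  case/andP: dks => /allP /(_ y yk); by rewrite E ltNge qx.
have := sub q (mem_head _ _); rewrite inE => /predU1P [E|qus].
  subst q; have dks' : descr ks by case/andP: dks.
  have [y yk|G [dG hG]] := IH ks dus dks'; first exact: tail.
  exists (fun z => opair (G (p1 z)) (p2 z)); split=> [|d]; first by dfn.
  by rewrite /= p1E p2E hG.
have [y|G [dG hG]] := IH (q :: ks) dus dks.
  rewrite inE => /predU1P [->//|yk]; apply: tail => //.
  by apply: ltW; apply: (allP hx).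
by exists (fun z => G (p1 z)); split=> [|d]; [dfn|rewrite /= p1E hG].
Qed.

(** Two tuples with different supports are both extracted from one tuple over a common support, to
    which indiscernibility applies. *)
Lemma transfer n (B : M -> M -> Prop) (j : Aut rat_order) ks ks' : Df2 (cst n) B ->
  descr ks -> descr ks' ->
  (B (tup (map cq ks)) (tup (map cq ks')) <->
   B (tup (map cq (map j ks))) (tup (map cq (map j ks')))).
Proof.
move=> dB dk dk'; have [us du [s1 s2]] := descr_union ks ks'.
have [G [dG hG]] := select du dk s1; have [G' [dG' hG']] := select du dk' s2.
have h := indiscernible (n := n) du (descr_map j du) (esym (size_map _ _)).
have ne : exists m, cst n m by exists emp; right; apply: I_emp HI.
have {}dG : Tm1 (cst n) G by apply: Dfn_mono dG.
have {}dG' : Tm1 (cst n) G' by apply: Dfn_mono dG'.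
have := @teq_Df M _ (fun z => B (G z) (G' z)) _ _ ne _ h.
by rewrite -!map_comp !hG !hG'; apply; dfn.
Qed.

End Stages.

(** * Automorphisms and pointwise fixed transitive sets *)

Section AutomorphismFacts.

Variable M : zmodel.
Implicit Types (a b c d x y z w s t u v g h L : M).
Variable k : Aut M.

Lemma aut_surj y : exists x, k x = y.
Proof. by have [f _ h] := aut_bij k; exists (f y). Qed.

Lemma aut_inj x y : k x = k y -> x = y.
Proof. by have [f h _] := aut_bij k; move=> /(congr1 f); rewrite !h. Qed.

Lemma aut_sat phi (e : nat -> M) : sat e phi <-> sat (fun i => k (e i)) phi.
Proof.
elim: phi e => [i j|i j|p IH|p IHp q IHq|p IH] e /=.
- by rewrite aut_rel.
- by split=> [->//|/aut_inj].
- by rewrite IH.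
- by rewrite IHp IHq.
- split=> [[x /IH h]|[y h]].
    by exists (k x); apply: (sat_eqfun h) => -[].
  have [x E] := aut_surj y; exists x; apply/IH; apply: (sat_eqfun h) => -[] //=.
Qed.

Lemma aut_Df P (e : nat -> M) : Df (@noc M) P -> (P e <-> P (fun i => k (e i))).
Proof.
move=> [phi [f [_ h2 h3]]]; rewrite !h3 aut_sat; apply: sat_ext => i; rewrite /asg.
by case E: (f i) => [j|m] //; case: (h2 _ _ E).
Qed.

Lemma aut_opair a b : k (opair a b) = opair (k a) (k b).
Proof.
have d : Df (@noc M) (fun e => e 0 = opair (e 1) (e 2)) by dfn.
by apply: (aut_Df (fun i => match i with 0 => opair a b | 1 => a | _ => b end) d).1.
Qed.

Lemma aut_fix_set t : (forall x, x ε t -> k x = x) -> k t = t.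
Proof.
move=> h; apply: extM => z; split=> [zt|zt]; last by rewrite -(h z zt); apply/aut_rel.
by have [x E] := aut_surj z; move: zt; rewrite -E => /aut_rel xt; rewrite h.
Qed.

(** An injection of [L] into [t] leaves a trace on [t], which [k] fixes. The images of [L] and of
    the injection under [k] have the same trace, so by rigidity [L] is fixed and the two injections
    agree on it; hence [x] and [k x] have the same image. *)
Lemma aut_fix_le t L : transitive_set L -> le L t -> (forall x, x ε t -> k x = x) ->
  forall x, x ε L -> k x = x.
Proof.
move=> tL [h ih] fx; have [r [tr rt]] := traces_ex ih.
have fr : k r = r.
  apply: aut_fix_set => p /rt /mem_cart [a [b [ha hb ->]]].
  by rewrite aut_opair !fx.
have ft := aut_fix_set fx.
have tL' : transitive_set (k L).
  move=> y; have [y' <-] := aut_surj y => /aut_rel yL z; have [z' <-] := aut_surj z.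
  by move=> /aut_rel zy; apply/aut_rel; apply: (tL y').
have ih' : injn (k h) (k L) t.
  rewrite -ft; have d : Df (@noc M) (fun e => injn (e 0) (e 1) (e 2)) by dfn.
  exact: (aut_Df (fun i => match i with 0 => h | 1 => L | _ => t end) d).1.
have tr' : traces (k h) (k L) r.
  rewrite -fr; have d : Df (@noc M) (fun e => traces (e 0) (e 1) (e 2)).
    by rewrite /traces; dfn.
  exact: (aut_Df (fun i => match i with 0 => h | 1 => L | _ => r end) d).1.
move=> x xL; have [at_ xa _] := injn_app ih xL.
have E := rigid tL tL' ih ih' tr tr'.
have kxL : k x ε L by rewrite E; apply/aut_rel.
have : opair (k x) (app h x) ε k h by rewrite -(fx _ at_) -aut_opair; apply/aut_rel.
have [_ e1] := rigid_half tL tL' ih ih' tr tr' kxL; move=> /e1 h1.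
by apply/esym; case: ih => _ i2; apply/(i2 _ _ _ _ xL kxL xa h1).
Qed.

End AutomorphismFacts.

Lemma rat_aut_inv (j : Aut rat_order) : exists j' : Aut rat_order,
  cancel j j' /\ cancel j' j.
Proof.
have [g h1 h2] := aut_bij j.
have r (x y : rat_order) : g x ε g y <-> x ε y by rewrite -(aut_rel j) !h2.
by exists (MkAut (Bijective h2 h1) r).
Qed.

(** * The action of the order automorphisms on the model *)

Section Action.

Variables (M : zmodel) (I : M -> Prop).
Hypotheses (HI : H_cut I) (sat_M : recursively_saturated M).
Variable e : nat -> M.
Hypothesis e_surj : forall m, exists n, e n = m.
Implicit Types (x y z m F : M) (j : Aut rat_order) (ks : seq rat).

Let c := cq HI sat_M e.
Let A n F := comp (st_a (sq HI sat_M e n)) F.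
Let C := cst HI sat_M e.

Lemma rep_ex m : exists r : nat * M * seq rat,
  [/\ A r.1.1 r.1.2, descr r.2 & m = app r.1.2 (tup (map c r.2))].
Proof. by have [n [F [ks h]]] := represented HI sat_M e_surj m; exists (n, F, ks). Qed.

Definition rep m := proj1_sig (constructive_indefinite_description _ (rep_ex m)).

Definition hat j m : M := app (rep m).1.2 (tup (map c (map j (rep m).2))).

Lemma cst_comp n n' F : n <= n' -> A n F -> C n' F.
Proof. by move=> nn h; apply: (cst_mono nn); left. Qed.

(** Independence of the chosen representation: equality of two represented elements is a relation
    between their tuples, preserved by [transfer]. *)
Lemma hatE j n F ks m : A n F -> descr ks -> m = app F (tup (map c ks)) ->
  hat j m = app F (tup (map c (map j ks))).
Proof.
move=> aF dk E; rewrite /hat /rep.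
case: constructive_indefinite_description => -[[n' F'] ks'] /= [aF' dk' E'].
have c1 := cst_comp (leq_maxl n n') aF; have c2 := cst_comp (leq_maxr n n') aF'.
have d : Df2 (C (maxn n n')) (fun x y => app F' x = app F y) by dfn.
by apply/(transfer j d dk' dk); rewrite -/c -E' -E.
Qed.

Lemma hat_comp (i j : Aut rat_order) m : hat (aut_comp i j) m = hat i (hat j m).
Proof.
have [[[n F] ks] /= [aF dk E]] := rep_ex m.
rewrite (hatE _ aF dk E) (hatE j aF dk E) (hatE i aF (descr_map j dk) erefl).
by rewrite -[map i _]map_comp.
Qed.

Lemma hat_cancel (i j : Aut rat_order) m : cancel i j -> hat j (hat i m) = m.
Proof.
move=> ij; have [[[n F] ks] /= [aF dk E]] := rep_ex m.
rewrite (hatE i aF dk E) (hatE j aF (descr_map i dk) erefl) E.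
by rewrite -[map j _]map_comp (eq_map ij) map_id.
Qed.

Lemma hat_bij j : bijective (hat j).
Proof.
have [j' [h1 h2]] := rat_aut_inv j.
by exists (hat j') => m; apply: hat_cancel.
Qed.

Lemma hat_rel j x y : hat j x ε hat j y <-> x ε y.
Proof.
have [[[n F] ks] /= [aF dk E]] := rep_ex x.
have [[[n' F'] ks'] /= [aF' dk' E']] := rep_ex y.
have c1 := cst_comp (leq_maxl n n') aF; have c2 := cst_comp (leq_maxr n n') aF'.
have d : Df2 (C (maxn n n')) (fun x y => app F x ε app F' y) by dfn.
by rewrite (hatE j aF dk E) (hatE j aF' dk' E') -(transfer j d dk dk') -/c -E -E'.
Qed.

Definition hat_aut j : Aut M := MkAut (hat_bij j) (hat_rel j).

Lemma hat_c j q : hat j (c q) = c (j q).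
Proof.
have [[[n F] ks] /= [aF dk E]] := rep_ex (c q); rewrite (hatE j aF dk E).
have c1 := cst_comp (leqnn n) aF.
have d : Df2 (C n) (fun x y => app F x = p2 y) by dfn.
have := (transfer j d dk (ks' := [:: q]) isT).1.
by rewrite -/c /= !p2E; apply.
Qed.

Lemma hat_I j x : I x -> hat j x = x.
Proof.
move=> Ix; have [[[n F] ks] /= [aF dk E]] := rep_ex x; rewrite (hatE j aF dk E).
have c1 := cst_comp (leqnn n) aF; have c2 : C n x by right.
have d : Df2 (C n) (fun y _ => app F y = x) by dfn.
exact/(transfer j d dk dk)/esym.
Qed.

Lemma wide_ex : exists K, wide I K.
Proof.
have [x nx] : exists x, ~ I x by case: HI => _ [].
have [t [tt xt]] := TC_sup x.
by have [L [wL _ _]] := wide_le HI tt xt nx; exists L.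
Qed.

Lemma hat_moves j K : wide I K -> j <> aut_id -> exists2 y, y ε K & hat j y <> y.
Proof.
move=> wK nj; have [n [g [ag [gK gI]]]] := target HI sat_M e_surj wK.
have [q nq] : exists q, j q <> q.
  apply: NNPP => h; apply: nj; apply: aut_ext => q.
  by apply: NNPP => hq; apply: h; exists q.
exists (app g (tup [:: c q])) => // E; apply: nq; apply: gI.
by rewrite -[RHS]E (hatE (ks := [:: q]) j ag).
Qed.

(** The action sends [c q] to [c (j q)], and a function from [target] is injective along all the
    points [c q], so the image determines [j]. *)
Lemma hat_inj : injective hat_aut.
Proof.
move=> i j E; apply: aut_ext => q.
have [K wK] := wide_ex; have [n [g [_ [_ gI]]]] := target HI sat_M e_surj wK.
apply: gI; rewrite -/c; congr (app g (tup [:: _])).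
by rewrite -!hat_c; apply: (congr1 (fun k : Aut M => k (c q)) E).
Qed.

Lemma hat_fix j x : j <> aut_id -> (I_fix (hat_aut j) x <-> I x).
Proof.
move=> nj; split=> [fx|Ix y [s [t [ps [_ _ tmin] yt]]]]; last first.
  have [t' [It' tt' xt']] := I_trans_containment HI Ix.
  apply: hat_I; apply: (I_end HI It'); apply: (tmin t' tt' _ y yt).
  by move=> z /ps [->|->].
apply: NNPP => nx; have [t [tt st tmin]] := TC_ex (pr x x).
have xt : x ε t by apply: st; apply/mem_pr; left.
have ft y : y ε t -> hat_aut j y = y.
  by move=> yt; apply: fx; exists (pr x x), t; split=> // z; rewrite mem_pr.
have [L [wL tL leL]] := wide_le HI tt xt nx.
have [y yL] := hat_moves wL nj; apply.
exact: (aut_fix_le tL leL ft).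
Qed.

End Action.

Theorem theorem6p2 (M : structure) (I : M -> Prop) :
  countable M -> recursively_saturated M -> models_ZFC M -> H_cut I ->
  exists F : Aut rat_order -> Aut M,
    [/\ injective F,
        forall i j : Aut rat_order, F (aut_comp i j) = aut_comp (F i) (F j)
      & forall j : Aut rat_order, j <> aut_id ->
          forall x : M, I_fix (F j) x <-> I x].
Proof.
move=> [f finj] sat_M zfc HI; pose N := ZModel zfc.
have inh : inhabited M := inhabited_model N.
(* For [n] outside the range of [f] this is an arbitrary element; only surjectivity matters. *)
pose e n := epsilon inh (fun m => f m = n).
have e_surj m : exists n, e n = m.
  exists (f m); apply: finj.
  by apply: (epsilon_spec inh (fun m' => f m' = f m)); exists m.
exists (hat_aut (M := N) HI sat_M e_surj); split.
- exact: (@hat_inj N).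
- by move=> i j; apply: aut_ext => m; apply: (@hat_comp N).
- by move=> j nj x; apply: (@hat_fix N).
Qed.
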